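(* Let $0 < p < \infty$, let $C : H^p \to H^p$ be the Cesàro operator, and let $\chi \equiv 1$ denote the constant function equal to one on the open unit disk $\mathbb{D}$. Then $$\overline{\operatorname{span}}\{C^n \chi : n \geq 0\} = H^p,$$ where $\overline{\operatorname{span}}$ denotes the closed (complex) linear span in $H^p$.
   Context: $\mathbb{D} = \{z \in \mathbb{C} : |z| < 1\}$, and $m$ is Lebesgue measure on the unit circle $\partial\mathbb{D}$ normalized so that $m(\partial\mathbb{D}) = 1$. For $0 < p < \infty$, the Hardy space $H^p$ is the space of analytic functions $f$ on $\mathbb{D}$ for which $$\|f\|_{H^p} := \Big\{\sup_{0 < r < 1} \int_{\partial \mathbb{D}} |f(r \xi)|^p \, dm(\xi)\Big\}^{1/p}$$ is finite. For $1 \leq p < \infty$ this is a norm making $H^p$ a Banach space; for $0 < p < 1$, $H^p$ is given the complete metric $d(f,g) = \|f - g\|_{H^p}^p$. Closures are taken in the corresponding topology. The Cesàro operator is $$(Cf)(z) = \frac{1}{z} \int_{0}^{z} \frac{f(\xi)}{1 - \xi} \, d\xi, \quad z \in \mathbb{D},$$ (with the removable singularity at $z = 0$ filled in, i.e. $(Cf)(0) = f(0)$). It is a known fact that $C$ is a bounded linear operator on $H^p$ for every $0 < p < \infty$. *)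

(* Defs.v *)
From HB Require Import structures.
From mathcomp Require Import all_boot all_order all_algebra.
From mathcomp Require Import complex.
From mathcomp Require Import all_classical all_reals all_analysis.

Set Implicit Arguments.
Unset Strict Implicit.
Unset Printing Implicit Defensive.

Import Order.TTheory GRing.Theory Num.Theory.
Import numFieldNormedType.Exports.

Local Open Scope classical_set_scope.
Local Open Scope ring_scope.
Local Open Scope complex_scope.

(* The complex numbers are R[i].  Functions on the unit disk D are represented
   by total functions R[i] -> R[i]: membership in H^p, the norm, and the values of
   Cesaro f on D depend only on the restriction of f to D. *)

Definition unit_disk (R : realType) : set R[i] := [set z | `|z| < 1].

(* derivable over the base field R[i] in direction 1: existence of the limit of
   h^-1 * (f (z + h) - f z) as the complex number h tends to 0. *)
Definition analytic_on_disk (R : realType) (f : R[i] -> R[i]) : Prop :=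
  forall z : R[i], unit_disk z ->
    derivable (f : R[i]^o -> R[i]^o) z 1.

Definition expi (R : realType) (t : R) : R[i] := cos t +i* sin t.

(* Integral over the unit circle, against normalized Lebesgue measure, of
   |f (r xi)|^p, with xi = exp(i t) for 0 <= t <= 2 pi. *)
Definition circle_mean (R : realType) (p : R) (f : R[i] -> R[i]) (r : R) :
    \bar R :=
  (((2 * pi)^-1)%:E *
   \int[lebesgue_measure]_(t in `[0%R, (2 * pi)%R])
     ((Normc.normc (f (r%:C * expi t)) `^ p)%:E))%E.

(* Extended-valued: +oo on analytic functions outside H^p. *)
Definition Hp_norm (R : realType) (p : R) (f : R[i] -> R[i]) : \bar R :=
  (ereal_sup [set circle_mean p f r | r in [set r : R | (0 < r < 1)%R]]
     `^ (p^-1))%E.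

Definition Hp (R : realType) (p : R) : set (R[i] -> R[i]) :=
  [set f | analytic_on_disk f /\ (Hp_norm p f < +oo)%E].

Definition Hp_dist (R : realType) (p : R) (f g : R[i] -> R[i]) : \bar R :=
  let N := Hp_norm p (fun z => f z - g z) in
  if p < 1 then (N `^ p)%E else N.

Definition Hp_closure (R : realType) (p : R) (S : set (R[i] -> R[i])) :
    set (R[i] -> R[i]) :=
  [set f | Hp p f /\ forall e : R, 0 < e ->
     exists g, [/\ S g, Hp p g & (Hp_dist p f g < e%:E)%E]].

Definition complex_span (R : realType) (S : set (R[i] -> R[i])) :
    set (R[i] -> R[i]) :=
  [set f | exists (n : nat) (c : 'I_n -> R[i]) (g : 'I_n -> R[i] -> R[i]),
     (forall i, S (g i)) /\ f = (fun z => \sum_(i < n) c i * g i z)].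

Definition complex_integral01 (R : realType) (h : R -> R[i]) : R[i] :=
  Rintegral lebesgue_measure `[0%R, 1%R] (fun t => complex.Re (h t)) +i*
  Rintegral lebesgue_measure `[0%R, 1%R] (fun t => complex.Im (h t)).

(* Line integral of g from 0 to z along the segment xi = t z, 0 <= t <= 1;
   for g analytic on D any other path in D gives the same value. *)
Definition line_integral0 (R : realType) (g : R[i] -> R[i]) (z : R[i]) : R[i] :=
  complex_integral01 (fun t : R => g (t%:C * z) * z).

Definition Cesaro (R : realType) (f : R[i] -> R[i]) : R[i] -> R[i] :=
  fun z => if z == 0 then f 0
           else z^-1 * line_integral0 (fun xi => f xi / (1 - xi)) z.

Definition chi (R : realType) : R[i] -> R[i] := fun=> 1.

(* Main.v *)
(** On Taylor coefficients, C is the operator of partial means, whose inverse is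
[(A x)_n = (n + 1) x_n - n x_{n-1}].  Take [w_n = prod_{k = 1}^n k / (k + 1 - a)]
with [0 < a < 1].  In the norm [sup |x_n| / w_n] the resolvent [(A + c)^{-1}] has
norm at most [1 / (a + c)] for all [c >= 0], so by iterated Neumann series it
preserves the closed span of the orbit of [chi].  If [x] is in that closed span
and [A^2 x] is bounded, then so is [A x], being the limit of
[c (x - c (A + c)^{-1} x)] as [c] grows.  Starting from [chi], this gives all the
monomials.  Since [w_n] is at most a multiple of the coefficients of [(1 - z)^{-b}]
for [b > a], smallness in this norm implies smallness in H^p: for an integer
[m > p] and [b = 1 / (4 m)], the coefficients of the m-th power are dominated by
those of [(1 - z)^{-1/4}] (Vandermonde convolution), which are square summable.

It remains to see that polynomials are dense, that is, that the dilations
[f_s(z) = f(s z)] tend to [f] when [s -> 1].  For square summable coefficients this is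
Parseval's identity.  In general, [f = b V^n] with [|b| <= 1], [p n >= 2] and
[|f|^p <= |F|^2], where [b], [V], [F] have square summable coefficients: on each
circle of radius less than 1, [|f|^p] is comparable, up to an additive constant,
with [|exp (P / 2)|^2] for a polynomial [P] (a truncated logarithm series suffices,
as the real parts of polynomials form an algebra on the circle), and the
factors obtained on circles of radii tending to 1 converge along an ultrafilter.
Cauchy's formula comes from Goursat's theorem on rectangles, applied in the
coordinates [log r + i t]. *)

Require Import Defs.
From HB Require Import structures.
From mathcomp Require Import all_boot all_order all_algebra.
From mathcomp Require Import complex.
From mathcomp Require Import all_classical all_reals all_analysis.
From mathcomp Require Import ring lra zify.

Set Implicit Arguments.
Unset Strict Implicit.
Unset Printing Implicit Defensive.

Import Order.TTheory GRing.Theory Num.Theory.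
Import numFieldNormedType.Exports.
Import Normc.

Local Open Scope classical_set_scope.
Local Open Scope ring_scope.
Local Open Scope complex_scope.

(** The resolvent is estimated in a weighted sup-norm because there everything reduces to a
    supersolution of a first-order recursion; [0 < a] is what keeps the bound [1 / (a + c)] finite
    at [c = 0], where the resolvent is C itself. H^p comes back only through a comparison of
    coefficients. For the density of polynomials the obstacle is that no orthogonality is available
    for general p. The factorization stands in for the inner-outer one: the exponential of a
    polynomial has no zeros, so its roots of all orders are analytic, and the bounded factor [b]
    carries the zeros of [f]. The three factors then replay Vitali's convergence theorem as one
    pointwise inequality: where [V] is not large and neither [b] nor [V] moves much under dilation,
    [f] moves little; elsewhere [|F|^2] dominates, and its closeness to a bounded function plays the
    part of uniform integrability. All square means are controlled by coefficients, uniformly in the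
    radius, so a single dilation serves every circle, as the supremum in the H^p norm demands. *)

Section ComplexBasics.
Variable R : realType.
Implicit Types (z w : R[i]) (x y : R).

Lemma normCE z : `|z| = (normc z)%:C. Proof. by []. Qed.

Lemma normc_ge0 z : 0 <= normc z.
Proof. by rewrite -ler0c -normCE. Qed.

Lemma normc_sqr z : normc z ^+ 2 = complex.Re z ^+ 2 + complex.Im z ^+ 2.
Proof. by case: z => a b /=; rewrite sqr_sqrtr ?addr_ge0 ?sqr_ge0. Qed.

Lemma normc_real x : normc x%:C = `|x|.
Proof. by rewrite /= expr0n /= addr0 sqrtr_sqr. Qed.

Lemma normcX z n : normc (z ^+ n) = normc z ^+ n.
Proof. by elim: n => [|n IH]; rewrite ?expr0 ?normc1 // !exprS normcM IH. Qed.

Lemma normc_nat n : normc (n%:R : R[i]) = n%:R.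
Proof.
have -> : (n%:R : R[i]) = (n%:R : R)%:C by rewrite rmorph_nat.
by rewrite normc_real normr_nat.
Qed.

Lemma normc_sum (I : Type) (r : seq I) (P : pred I) (F : I -> R[i]) :
  normc (\sum_(i <- r | P i) F i) <= \sum_(i <- r | P i) normc (F i).
Proof.
elim/big_rec2: _ => [|i y z _ h]; first by rewrite normc0.
by rewrite (le_trans (le_normcD _ _)) // lerD2l.
Qed.

Lemma normcB_sym z w : normc (z - w) = normc (w - z).
Proof. by rewrite -normcN opprB. Qed.

Lemma normc_eq0 z : (normc z == 0) = (z == 0).
Proof. by apply/eqP/eqP => [/eq0_normc//|->]; rewrite normc0. Qed.

Lemma normc_gt0 z : (0 < normc z) = (z != 0).
Proof. by rewrite lt0r normc_eq0 normc_ge0 andbT. Qed.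

Lemma normr_Re_le z : `|complex.Re z| <= normc z.
Proof.
by rewrite -(ler_pXn2r (n := 2)) ?nnegrE ?normc_ge0 // normc_sqr
  real_normK ?num_real // lerDl sqr_ge0.
Qed.

Lemma normr_Im_le z : `|complex.Im z| <= normc z.
Proof.
by rewrite -(ler_pXn2r (n := 2)) ?nnegrE ?normc_ge0 // normc_sqr
  real_normK ?num_real // lerDr sqr_ge0.
Qed.

Lemma Re_le_normc z : complex.Re z <= normc z.
Proof. exact: le_trans (ler_norm _) (normr_Re_le z). Qed.

Lemma normc_i : normc ('i : R[i]) = 1.
Proof. by rewrite /= expr0n /= add0r expr1n sqrtr1. Qed.

Lemma normc_le_ReIm z : normc z <= `|complex.Re z| + `|complex.Im z|.
Proof.
rewrite {1}(complexE z) (le_trans (le_normcD _ _)) // normcM !normc_real.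
by rewrite normc_i mul1r.
Qed.

Lemma le_normcB z w : normc (z - w) <= normc z + normc w.
Proof. by rewrite -(normcN w) le_normcD. Qed.

Lemma le_normc_sub z w : normc z <= normc (z - w) + normc w.
Proof. by rewrite -{1}(subrK w z) le_normcD. Qed.

Lemma normcJ z : normc (conjc z) = normc z.
Proof. by case: z => a b /=; rewrite sqrrN. Qed.

Lemma mulrJ z : z * conjc z = (normc z ^+ 2)%:C.
Proof. by rewrite -sqr_normc normCE rmorphXn. Qed.

Lemma ReD z w : complex.Re (z + w) = complex.Re z + complex.Re w.
Proof. by case: z => a b; case: w => c d. Qed.
Lemma ImD z w : complex.Im (z + w) = complex.Im z + complex.Im w.
Proof. by case: z => a b; case: w => c d. Qed.
Lemma ReN z : complex.Re (- z) = - complex.Re z. Proof. by case: z. Qed.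
Lemma ImN z : complex.Im (- z) = - complex.Im z. Proof. by case: z. Qed.
Lemma ReB z w : complex.Re (z - w) = complex.Re z - complex.Re w.
Proof. by rewrite ReD ReN. Qed.
Lemma ImB z w : complex.Im (z - w) = complex.Im z - complex.Im w.
Proof. by rewrite ImD ImN. Qed.
Lemma ReM z w : complex.Re (z * w) =
  complex.Re z * complex.Re w - complex.Im z * complex.Im w.
Proof. by case: z => a b; case: w => c d. Qed.
Lemma ImM z w : complex.Im (z * w) =
  complex.Re z * complex.Im w + complex.Im z * complex.Re w.
Proof. by case: z => a b; case: w => c d. Qed.

Lemma eq_complexP z w : complex.Re z = complex.Re w ->
  complex.Im z = complex.Im w -> z = w.
Proof. by case: z => a b; case: w => c d /= -> ->. Qed.


End ComplexBasics.

Arguments normc : simpl never.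

(** * Complex differentiability *)

Section ComplexContinuity.
Variable R : realType.
Implicit Types (z w : R[i]) (x y a b : R).

(** The norm of [R[i]] takes its values in [R[i]]; these forms use the real-valued [normc], so that
    estimates can be handed to real arithmetic. In [cderiv] the quotient is multiplied out, and
    [w = z] needs no exception. *)
Definition ccont_at (f : R[i] -> R[i]) z := forall e : R, 0 < e ->
  exists2 d : R, 0 < d & forall w, normc (w - z) < d -> normc (f w - f z) < e.

Definition cderiv (f : R[i] -> R[i]) z l := forall e : R, 0 < e ->
  exists2 d : R, 0 < d & forall w, normc (w - z) < d ->
    normc (f w - f z - l * (w - z)) <= e * normc (w - z).

Definition curve_cont (h : R -> R[i]) x := forall e : R, 0 < e ->
  exists2 d : R, 0 < d & forall y, `|y - x| < d -> normc (h y - h x) < e.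

Lemma cderiv_cont f z l : cderiv f z l -> ccont_at f z.
Proof.
move=> /(_ 1 ltr01)[d d0 h] e e0.
have k0 : 0 < 1 + normc l by rewrite ltr_wpDr ?normc_ge0.
exists (Num.min d (e / (1 + normc l))); first by rewrite lt_min d0 divr_gt0.
move=> w; rewrite lt_min => /andP[/h hw]; rewrite ltr_pdivlMr // => he.
rewrite (le_lt_trans _ he) // (le_trans (le_normc_sub _ (l * (w - z)))) //.
by rewrite [leRHS]mulrDr mulr1 lerD ?(le_trans hw) ?mul1r // normcM mulrC.
Qed.

Lemma cderiv_ext f g z l (d : R) : 0 < d ->
  (forall w, normc (w - z) < d -> f w = g w) -> cderiv f z l -> cderiv g z l.
Proof.
move=> d0 fg hf e /hf[d' d'0 h]; exists (Num.min d d'); first by rewrite lt_min d0.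
move=> w; rewrite lt_min => /andP[hd hd']; rewrite -fg // -fg ?h //.
by rewrite subrr normc0.
Qed.

Lemma cderiv_cst c z : cderiv (fun=> c) z 0.
Proof.
move=> e e0; exists 1 => // w _; rewrite subrr mul0r subrr normc0.
by rewrite mulr_ge0 ?normc_ge0 ?ltW.
Qed.

Lemma cderiv_id z : cderiv id z 1.
Proof.
move=> e e0; exists 1 => // w _; rewrite mul1r subrr normc0.
by rewrite mulr_ge0 ?normc_ge0 ?ltW.
Qed.

Lemma cderivD f g z l m : cderiv f z l -> cderiv g z m ->
  cderiv (fun w => f w + g w) z (l + m).
Proof.
move=> hf hg e e0; have e20 : 0 < e / 2 by rewrite divr_gt0.
have [d1 d10 h1] := hf _ e20; have [d2 d20 h2] := hg _ e20.
exists (Num.min d1 d2); first by rewrite lt_min d10.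
move=> w; rewrite lt_min => /andP[/h1 hw1 /h2 hw2].
rewrite (_ : _ - _ - _ = (f w - f z - l * (w - z)) + (g w - g z - m * (w - z)));
  last by ring.
rewrite (le_trans (le_normcD _ _)) // (splitr e) mulrDl lerD //.
Qed.

(* The product and chain rules both come from the Caratheodory form: the
   difference quotient extends continuously. *)
Lemma cderivP f z l : cderiv f z l <->
  exists q : R[i] -> R[i],
    [/\ forall w, f w = f z + q w * (w - z), q z = l & ccont_at q z].
Proof.
split=> [hf|[q [fq qz qc]] e e0].
- exists (fun w => if w == z then l else (f w - f z) / (w - z)); split.
  + move=> w; case: eqP => [->|/eqP nz]; first by rewrite subrr mulr0 addr0.
    by rewrite divfK ?subr_eq0 // addrC subrK.
  + by rewrite eqxx.
  + move=> e e0; have [d d0 h] := hf _ (divr_gt0 e0 (ltr0n _ 2)).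
    exists d => // w hw; rewrite eqxx; case: eqP => [_|/eqP nz].
      by rewrite subrr normc0.
    have wz0 : w - z != 0 by rewrite subr_eq0.
    rewrite -(ltr_pM2r (_ : 0 < normc (w - z))) ?normc_gt0 // -normcM.
    rewrite mulrBl divfK // (le_lt_trans (h _ hw)) //.
    by rewrite ltr_pM2r ?normc_gt0 // ltr_pdivrMr // mulr2n mulrDr mulr1 ltrDl.
- have [d d0 h] := qc _ e0; exists d => // w hw.
  rewrite (_ : _ - _ - _ = (q w - q z) * (w - z)); last by rewrite (fq w) qz; ring.
  rewrite normcM ler_wpM2r ?normc_ge0 //.
  exact/ltW/h.
Qed.

Lemma ccontD f g z : ccont_at f z -> ccont_at g z ->
  ccont_at (fun w => f w + g w) z.
Proof.
move=> hf hg e e0; have e20 : 0 < e / 2 by rewrite divr_gt0.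
have [d1 d10 h1] := hf _ e20; have [d2 d20 h2] := hg _ e20.
exists (Num.min d1 d2); first by rewrite lt_min d10.
move=> w; rewrite lt_min => /andP[/h1 hw1 /h2 hw2].
rewrite (_ : _ - _ = (f w - f z) + (g w - g z)); last by ring.
by rewrite (le_lt_trans (le_normcD _ _)) // (splitr e) ltrD.
Qed.

Lemma ccontM f g z : ccont_at f z -> ccont_at g z ->
  ccont_at (fun w => f w * g w) z.
Proof.
move=> hf hg e e0.
pose k := 1 + normc (f z) + normc (g z).
have k0 : 0 < k by rewrite /k -addrA ltr_wpDr ?addr_ge0 ?normc_ge0.
have k1 : 1 <= k by rewrite /k -addrA lerDl addr_ge0 ?normc_ge0.
(* The bound 1 on one increment turns the quadratic term of the expansion below into a linear one;
   [k] collects the three coefficients. *)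
pose e' := Num.min 1 (e / (2 * k)).
have e'0 : 0 < e' by rewrite lt_min ltr01 divr_gt0 // mulr_gt0.
have [d1 d10 h1] := hf _ e'0; have [d2 d20 h2] := hg _ e'0.
exists (Num.min d1 d2); first by rewrite lt_min d10.
move=> w; rewrite lt_min => /andP[/h1 hw1 /h2 hw2].
rewrite (_ : _ - _ = (f w - f z) * (g w - g z) + ((f w - f z) * g z +
   f z * (g w - g z))); last by ring.
rewrite (le_lt_trans (le_normcD _ _)) //.
apply: (@le_lt_trans _ _ (normc (f w - f z) * 1 + (normc (f w - f z) * normc (g z) +
  normc (f z) * normc (g w - g z)))).
  rewrite lerD //.
    rewrite normcM ler_wpM2l ?normc_ge0 // (le_trans (ltW hw2)) //.
    by rewrite ge_min lexx.
  by rewrite (le_trans (le_normcD _ _)) // !normcM.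
apply: (@le_lt_trans _ _ (e' * k)).
  have := normc_ge0 (f z); have := normc_ge0 (g z); rewrite /k; nra.
have : e' <= e / (2 * k) by rewrite ge_min lexx orbT.
rewrite ler_pdivlMr ?mulr_gt0 // => h.
by rewrite (lt_le_trans _ h) // mulrA ltr_pM2r // mulr2n mulrDr mulr1 ltrDl.
Qed.

Lemma ccont_cst c z : ccont_at (fun=> c) z.
Proof. exact: cderiv_cont (cderiv_cst _ _). Qed.

Lemma ccont_ext f g z (d : R) : 0 < d ->
  (forall w, normc (w - z) < d -> f w = g w) -> ccont_at f z -> ccont_at g z.
Proof.
move=> d0 fg hf e /hf[d' d'0 h]; exists (Num.min d d'); first by rewrite lt_min d0.
move=> w; rewrite lt_min => /andP[hd hd']; rewrite -fg // -fg ?h //.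
by rewrite subrr normc0.
Qed.

Lemma ccont_comp f g z : ccont_at g z -> ccont_at f (g z) ->
  ccont_at (f \o g) z.
Proof.
by move=> hg hf e /hf[d /hg[d' d'0 h] hd]; exists d' => // w /h /hd.
Qed.

Lemma ccont_inv z : z != 0 -> ccont_at (fun w => w^-1) z.
Proof.
move=> z0 e e0; have nz0 : 0 < normc z by rewrite normc_gt0.
(* The first radius keeps [normc w] above [normc z / 2]; the second then compensates for
   [normc (w * z)], which exceeds [normc z ^+ 2 / 2]. *)
exists (Num.min (normc z / 2) (e * normc z ^+ 2 / 2)).
  by rewrite lt_min !divr_gt0 // mulr_gt0 // exprn_gt0.
move=> w; rewrite lt_min => /andP[h1 h2].
have wz : normc z / 2 < normc w.
  have := le_normc_sub z w; rewrite normcB_sym => h; lra.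
have w0 : 0 < normc w by rewrite (lt_trans _ wz) // divr_gt0.
have w0' : w != 0 by rewrite -normc_gt0.
rewrite (_ : w^-1 - z^-1 = (z - w) / (w * z)); last first.
  by field; apply/andP.
rewrite normcM normcV !normcM -normcB_sym ltr_pdivrMr ?mulr_gt0 //.
rewrite (lt_le_trans h2) // -mulrA ler_wpM2l ?ltW //; nra.
Qed.

Lemma cderivM f g z l m : cderiv f z l -> cderiv g z m ->
  cderiv (fun w => f w * g w) z (l * g z + f z * m).
Proof.
move=> hf hg; have fc := cderiv_cont hf.
move/cderivP : hf => [q [fq <- qc]]; move/cderivP : hg => [r [gr <- rc]].
apply/cderivP; exists (fun w => q w * g z + f w * r w); split => //.
- by move=> w; rewrite [in LHS](gr w) [X in X * (g z + _)](fq w) {1}(fq w); ring.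
- exact: ccontD (ccontM qc (ccont_cst _ _)) (ccontM fc rc).
Qed.

Lemma cderiv_comp f g z l m : cderiv g z m -> cderiv f (g z) l ->
  cderiv (f \o g) z (l * m).
Proof.
move=> hg hf; have gc := cderiv_cont hg.
move/cderivP : hf => [q [fq <- qc]]; move/cderivP : hg => [r [gr <- rc]].
apply/cderivP; exists (fun w => q (g w) * r w); split => //.
- by move=> w /=; rewrite fq -mulrA; congr (_ + _ * _); rewrite (gr w); ring.
- exact: ccontM (ccont_comp gc qc) rc.
Qed.

Lemma cderiv_inv z : z != 0 -> cderiv (fun w => w^-1) z (- (z^-1) ^+ 2).
Proof.
move=> z0; have nz0 : 0 < normc z by rewrite normc_gt0.
(* [cderivP] asks for the factorization at every [w], but [w^-1 = z^-1 - w^-1 * z^-1 * (w - z)]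
   fails at [w = 0]; the inverse is therefore first replaced by this right-hand side, which agrees
   with it near [z]. *)
apply: (@cderiv_ext (fun w => z^-1 - (if w == 0 then 0 else w^-1) * z^-1 * (w - z)) _ _ _ _ nz0).
  move=> w; case: eqP => [->|/eqP w0 _].
    by rewrite sub0r normcN ltxx.
  by field; apply/andP.
apply/cderivP; exists (fun w => - ((if w == 0 then 0 else w^-1) * z^-1)); split.
- by move=> w; rewrite subrr mulr0 subr0; ring.
- by rewrite (negPf z0) expr2.
- apply: (@ccont_ext (fun w => w^-1 * (- z^-1)) _ _ _ nz0) => [w|].
    by case: eqP => [->|_ _]; rewrite ?sub0r ?normcN ?ltxx //; ring.
  exact: ccontM (ccont_inv z0) (ccont_cst _ _).
Qed.

Lemma cderivX f z l n : cderiv f z l ->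
  cderiv (fun w => f w ^+ n) z (n%:R * f z ^+ n.-1 * l).
Proof.
move=> hf; elim: n => [|n IH]; first by rewrite !mul0r; exact: cderiv_cst.
have := cderivM hf IH.
rewrite (_ : _ + _ = n.+1%:R * f z ^+ n.+1.-1 * l).
  by apply: (@cderiv_ext _ _ _ _ 1) => // w _; rewrite exprS.
case: n {IH} => [|n] /=; first by rewrite expr0; ring.
by rewrite exprS -[in RHS]natr1; ring.
Qed.

Lemma curve_comp f (h : R -> R[i]) x : ccont_at f (h x) -> curve_cont h x ->
  curve_cont (f \o h) x.
Proof.
by move=> hf hh e /hf[d /hh[d' d'0 h'] hd]; exists d' => // y /h' /hd.
Qed.

Lemma curve_contP (h : R -> R[i]) x : curve_cont h x <->
  {for x, continuous (fun y => complex.Re (h y))} /\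
  {for x, continuous (fun y => complex.Im (h y))}.
Proof.
split=> [hh|[hr hi] e e0].
- split; apply/cvgrPdist_lt => e /hh[d d0 hd]; near=> y;
  (have hy : `|y - x| < d by rewrite distrC; near: y; exact: cvgr_dist_lt);
  rewrite distrC (le_lt_trans _ (hd _ hy)) // -?ReB -?ImB ?normr_Re_le ?normr_Im_le //.
- have e20 : 0 < e / 2 by rewrite divr_gt0.
  have /nbhs_ballP[d1 /= d10 h1] : \forall y \near x, `|complex.Re (h x) - complex.Re (h y)| < e / 2.
    by move/cvgrPdist_lt : hr => /(_ _ e20).
  have /nbhs_ballP[d2 /= d20 h2] : \forall y \near x, `|complex.Im (h x) - complex.Im (h y)| < e / 2.
    by move/cvgrPdist_lt : hi => /(_ _ e20).
  exists (Num.min d1 d2); first by rewrite lt_min d10.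
  move=> y; rewrite lt_min distrC => /andP[/h1 hy1 /h2 hy2].
  rewrite (le_lt_trans (normc_le_ReIm _)) // ReB ImB (splitr e).
  by rewrite ![`|_ (h y) - _|]distrC ltrD.
Unshelve. all: by end_near. Qed.

Lemma curve_cst c x : curve_cont (fun=> c) x.
Proof. by move=> e e0; exists 1 => // y _; rewrite subrr normc0. Qed.

Lemma curveD h k x : curve_cont h x -> curve_cont k x ->
  curve_cont (fun y => h y + k y) x.
Proof.
move=> hh hk e e0; have e20 : 0 < e / 2 by rewrite divr_gt0.
have [d1 d10 h1] := hh _ e20; have [d2 d20 h2] := hk _ e20.
exists (Num.min d1 d2); first by rewrite lt_min d10.
move=> w; rewrite lt_min => /andP[/h1 hw1 /h2 hw2].
rewrite (_ : _ - _ = (h w - h x) + (k w - k x)); last by ring.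
by rewrite (le_lt_trans (le_normcD _ _)) // (splitr e) ltrD.
Qed.

Lemma curveM h k x : curve_cont h x -> curve_cont k x ->
  curve_cont (fun y => h y * k y) x.
Proof.
move=> /curve_contP[hr hi] /curve_contP[kr ki]; apply/curve_contP; split.
- rewrite (_ : (fun y => _) = (fun y => complex.Re (h y) * complex.Re (k y) -
      complex.Im (h y) * complex.Im (k y))); last by apply/funext => y; rewrite ReM.
  by apply: continuousB; apply: continuousM.
- rewrite (_ : (fun y => _) = (fun y => complex.Re (h y) * complex.Im (k y) +
      complex.Im (h y) * complex.Re (k y))); last by apply/funext => y; rewrite ImM.
  by apply: continuousD; apply: continuousM.
Qed.

Lemma curve_normc h x : curve_cont h x ->
  {for x, continuous (fun y => normc (h y))}.
Proof.
move=> hh; apply/cvgrPdist_lt => e /hh[d d0 hd]; near=> y.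
have hy : `|y - x| < d by rewrite distrC; near: y; exact: cvgr_dist_lt.
rewrite distrC (le_lt_trans _ (hd _ hy)) // ler_norml; apply/andP; split.
  rewrite lerBrDl -lerBrDr opprK normcB_sym addrC; exact: le_normc_sub.
by rewrite lerBlDr; exact: le_normc_sub.
Unshelve. all: by end_near. Qed.

End ComplexContinuity.

(** * Integrals and Goursat's theorem *)

Section Integrals.
Variable R : realType.
Implicit Types (a b c x : R) (f g : R -> R) (h k : R -> R[i]).
Local Notation mu := (@lebesgue_measure R).

Definition RI a b f : R := \int[mu]_(x in `[a, b]) f x.

Definition rcont a b f := forall x, a <= x <= b -> {for x, continuous f}.

Lemma rcont_integrable a b f : rcont a b f ->
  mu.-integrable `[a, b] (EFin \o f).
Proof.
move=> fc; apply: continuous_compact_integrable; first exact: segment_compact.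
by apply: continuous_in_subspaceT => x; rewrite inE /= in_itv /= => /fc.
Qed.

Lemma RI_D a b f g : rcont a b f -> rcont a b g ->
  RI a b (fun x => f x + g x) = RI a b f + RI a b g.
Proof. by move=> fc gc; rewrite /RI RintegralD //; exact: rcont_integrable. Qed.

Lemma RI_B a b f g : rcont a b f -> rcont a b g ->
  RI a b (fun x => f x - g x) = RI a b f - RI a b g.
Proof. by move=> fc gc; rewrite /RI RintegralB //; exact: rcont_integrable. Qed.

Lemma RI_Z a b f r : rcont a b f -> RI a b (fun x => r * f x) = r * RI a b f.
Proof. by move=> fc; rewrite /RI RintegralZl //; exact: rcont_integrable. Qed.

Lemma RI_le a b f g : rcont a b f -> rcont a b g ->
  (forall x, a <= x <= b -> f x <= g x) -> RI a b f <= RI a b g.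
Proof.
move=> fc gc fg; apply: le_Rintegral => //; try exact: rcont_integrable.
Qed.

Lemma RI_ge0 a b f : (forall x, a <= x <= b -> 0 <= f x) -> 0 <= RI a b f.
Proof. by move=> f0; apply: Rintegral_ge0 => x /=; rewrite in_itv => /f0. Qed.

Lemma RI_cst a b r : a <= b -> RI a b (fun=> r) = r * (b - a).
Proof.
move=> ab; rewrite /RI Rintegral_cst //= lebesgue_measure_itv /= lte_fin.
by move: ab; rewrite le_eqVlt => /orP[/eqP ->|->] //; rewrite ltxx subrr.
Qed.

Lemma RI_eq a b f g : (forall x, a <= x <= b -> f x = g x) ->
  RI a b f = RI a b g.
Proof.
by move=> fg; apply: eq_Rintegral => x; rewrite inE /= in_itv /= => /fg.
Qed.

Lemma RI_cat a b c f : a <= c -> c <= b -> rcont a b f ->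
  RI a b f = RI a c f + RI c b f.
Proof.
move=> ac cb fc; have fi := rcont_integrable fc.
apply/eqP; rewrite addrC -subr_eq; apply/eqP; rewrite /RI Rintegral_itvB //.
rewrite Rintegral_itv_obnd_cbnd //.
apply: integrableS fi => //; apply: subset_itvr; rewrite bnd_simp //.
Qed.

Lemma RI_FTC a b f (F : R -> R) : a < b ->
  (forall x, is_derive x 1 F (f x)) -> continuous f -> RI a b f = F b - F a.
Proof.
move=> ab dF cf; rewrite /RI /Rintegral (continuous_FTC2 ab (F := F)) //.
- exact: continuous_subspaceT.
- have cF : continuous F.
    by move=> x; apply/differentiable_continuous/derivable1_diffP; case: (dF x).
  split; first by move=> x _; case: (dF x).
  + exact/cvg_at_right_filter/cF.
  + exact/cvg_at_left_filter/cF.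
- by move=> x _; rewrite derive1E; case: (dF x).
Qed.

Definition cint a b h : R[i] :=
  RI a b (fun x => complex.Re (h x)) +i* RI a b (fun x => complex.Im (h x)).

Definition ccont a b h := forall x, a <= x <= b -> curve_cont h x.

Lemma ccont_Re a b h : ccont a b h -> rcont a b (fun x => complex.Re (h x)).
Proof. by move=> hc x /hc/curve_contP[]. Qed.

Lemma ccont_Im a b h : ccont a b h -> rcont a b (fun x => complex.Im (h x)).
Proof. by move=> hc x /hc/curve_contP[]. Qed.

Lemma ccont_normc a b h : ccont a b h -> rcont a b (fun x => normc (h x)).
Proof. by move=> hc x /hc/curve_normc. Qed.

Lemma ccontcD a b h k : ccont a b h -> ccont a b k -> ccont a b (fun x => h x + k x).
Proof. by move=> hc kc x xab; apply: curveD; [exact: hc|exact: kc]. Qed.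

Lemma ccontcM a b h k : ccont a b h -> ccont a b k -> ccont a b (fun x => h x * k x).
Proof. by move=> hc kc x xab; apply: curveM; [exact: hc|exact: kc]. Qed.

Lemma ccontc_cst a b z : ccont a b (fun=> z).
Proof. by move=> x _; exact: curve_cst. Qed.

Lemma ccontcB a b h k : ccont a b h -> ccont a b k -> ccont a b (fun x => h x - k x).
Proof.
move=> hc kc; have := ccontcD hc (ccontcM (ccontc_cst (a := a) (b := b) (-1)) kc).
by under [X in ccont _ _ X]eq_fun do rewrite mulN1r.
Qed.

Lemma cint_eq a b h k : (forall x, a <= x <= b -> h x = k x) ->
  cint a b h = cint a b k.
Proof. by move=> hk; rewrite /cint; congr (_ +i* _); apply: RI_eq => x /hk ->. Qed.

Lemma cintD a b h k : ccont a b h -> ccont a b k ->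
  cint a b (fun x => h x + k x) = cint a b h + cint a b k.
Proof.
move=> hc kc; apply: eq_complexP; rewrite ?ReD ?ImD /=.
- by rewrite -RI_D; [apply: RI_eq => x _; rewrite ReD|exact: ccont_Re..].
- by rewrite -RI_D; [apply: RI_eq => x _; rewrite ImD|exact: ccont_Im..].
Qed.

Lemma cintZ a b h z : ccont a b h -> cint a b (fun x => z * h x) = z * cint a b h.
Proof.
move=> hc; have hr := ccont_Re hc; have hi := ccont_Im hc.
have zr (t : R) g : rcont a b g -> rcont a b (fun x => t * g x).
  by move=> gc x /gc gx; apply: continuousM => //; exact: cvg_cst.
apply: eq_complexP; rewrite ?ReM ?ImM /=.
- rewrite -!RI_Z // -RI_B; try exact: zr.
  by apply: RI_eq => x _; rewrite ReM.
- rewrite -!RI_Z // -RI_D; try exact: zr.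
  by apply: RI_eq => x _; rewrite ImM.
Qed.

Lemma cintB a b h k : ccont a b h -> ccont a b k ->
  cint a b (fun x => h x - k x) = cint a b h - cint a b k.
Proof.
move=> hc kc; rewrite -mulN1r -cintZ // -cintD //.
  by apply: cint_eq => x _; rewrite mulN1r.
by apply: ccontcM => //; exact: ccontc_cst.
Qed.

Lemma ccontc_sum a b (I : Type) (r : seq I) (F : I -> R -> R[i]) :
  (forall i, ccont a b (F i)) -> ccont a b (fun x => \sum_(i <- r) F i x).
Proof.
move=> Fc; elim: r => [|i r IH].
  by under [X in ccont _ _ X]eq_fun do rewrite big_nil; exact: ccontc_cst.
by under [X in ccont _ _ X]eq_fun do rewrite big_cons; exact: ccontcD.
Qed.

Lemma cint_sum a b (I : Type) (r : seq I) (F : I -> R -> R[i]) :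
  (forall i, ccont a b (F i)) ->
  cint a b (fun x => \sum_(i <- r) F i x) = \sum_(i <- r) cint a b (F i).
Proof.
move=> Fc; elim: r => [|i r IH].
  rewrite big_nil -[RHS](mul0r (cint a b (fun=> 0))) -cintZ; last exact: ccontc_cst.
  by apply: cint_eq => x _; rewrite big_nil mul0r.
rewrite big_cons -IH -cintD //; last exact: ccontc_sum.
by apply: cint_eq => x _; rewrite big_cons.
Qed.

Lemma cint_cst a b z : a <= b -> cint a b (fun=> z) = z * (b - a)%:C.
Proof.
move=> ab; rewrite /cint !RI_cst //; apply: eq_complexP;
by rewrite ?ReM ?ImM /= ?mulr0 ?subr0 ?add0r.
Qed.

Lemma cint_cat a b c h : a <= c -> c <= b -> ccont a b h ->
  cint a b h = cint a c h + cint c b h.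
Proof.
move=> ac cb hc; apply: eq_complexP; rewrite ?ReD ?ImD /=; apply: RI_cat => //.
- exact: ccont_Re.
- exact: ccont_Im.
Qed.

(* With z the value of the integral, the modulus of z is the integral of the
   real part of (conj z / |z|) h. *)
Lemma normc_cint a b h : a <= b -> ccont a b h ->
  normc (cint a b h) <= RI a b (fun x => normc (h x)).
Proof.
move=> ab hc; set z := cint a b h; have nhc := ccont_normc hc.
have [z0|z0] := eqVneq z 0.
  by rewrite z0 normc0 RI_ge0 // => x _; exact: normc_ge0.
have cc : ccont a b (fun x => conjc z * h x).
  by apply: ccontcM => //; exact: ccontc_cst.
rewrite -(ler_pM2l (_ : 0 < normc z)) ?normc_gt0 // -expr2.
have -> : normc z ^+ 2 = complex.Re (cint a b (fun x => conjc z * h x)).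
  by rewrite cintZ // -/z mulrC mulrJ.
rewrite -RI_Z //.
apply: (RI_le (f := fun x => complex.Re (conjc z * h x))).
- exact: ccont_Re.
- by move=> x /nhc xc; apply: continuousM => //; exact: cvg_cst.
- by move=> x _; rewrite (le_trans (Re_le_normc _)) // normcM normcJ.
Qed.

Lemma normc_cint_le a b h M : a <= b -> ccont a b h ->
  (forall x, a <= x <= b -> normc (h x) <= M) -> normc (cint a b h) <= M * (b - a).
Proof.
move=> ab hc hM; rewrite (le_trans (normc_cint ab hc)) // -RI_cst //.
apply: RI_le => //; first exact: ccont_normc.
by move=> x _; exact: cvg_cst.
Qed.

End Integrals.

(** * Goursat's theorem by bisection of rectangles *)

Section Goursat.
Variable R : realType.
Implicit Types (a b c d x y : R) (G : R -> R -> R[i]).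

(** The counterclockwise contour integral: bottom minus top, and ['i] times right minus left. [G]
    takes two real coordinates since it will be a function composed with [cexp], in log-polar
    coordinates. *)
Definition rect_int G a b c d : R[i] :=
  cint a b (fun x => G x c) - cint a b (fun x => G x d) +
  'i * (cint c d (fun y => G b y) - cint c d (fun y => G a y)).

Arguments rect_int : simpl never.

(** A single complex slope [l], in place of a real linear map of the plane, encodes the
    Cauchy-Riemann equations. *)
Definition holo_at G x y := exists l : R[i], forall e : R, 0 < e ->
  exists2 r : R, 0 < r & forall x' y', `|x' - x| < r -> `|y' - y| < r ->
  normc (G x' y' - G x y - l * ((x' - x) +i* (y' - y))) <=
  e * (`|x' - x| + `|y' - y|).

Definition holo_on G a b c d := forall x y, a <= x <= b -> c <= y <= d -> holo_at G x y.

Lemma holo_at_close G x y (e : R) : holo_at G x y -> 0 < e ->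
  exists2 r : R, 0 < r & forall x' y', `|x' - x| < r -> `|y' - y| < r ->
  normc (G x' y' - G x y) < e.
Proof.
move=> [l /(_ 1 ltr01)[r r0 hr]] e0.
have k0 : 0 < 1 + normc l by rewrite ltr_wpDr ?normc_ge0.
exists (Num.min r (e / (1 + normc l) / 2)); first by rewrite lt_min r0 !divr_gt0.
move=> x' y'; rewrite !lt_min => /andP[xr xe] /andP[yr ye].
have hk : normc ((x' - x) +i* (y' - y)) <= `|x' - x| + `|y' - y|.
  by rewrite (le_trans (normc_le_ReIm _)).
have hs : `|x' - x| + `|y' - y| < e / (1 + normc l) by lra.
move: hs; rewrite ltr_pdivlMr // => he; rewrite (le_lt_trans _ he) //.
rewrite (le_trans (le_normc_sub _ (l * ((x' - x) +i* (y' - y))))) //.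
rewrite mulrDr mulr1 lerD //; first by rewrite (le_trans (hr _ _ xr yr)) ?mul1r.
by rewrite normcM mulrC ler_wpM2r ?normc_ge0.
Qed.

Lemma holo_contx G x y : holo_at G x y -> curve_cont (fun x' => G x' y) x.
Proof.
move=> hG e e0; have [r r0 hr] := holo_at_close hG e0.
by exists r => // x' hx; apply: hr; rewrite // subrr normr0.
Qed.

Lemma holo_conty G x y : holo_at G x y -> curve_cont (fun y' => G x y') y.
Proof.
move=> hG e e0; have [r r0 hr] := holo_at_close hG e0.
by exists r => // x' hx; apply: hr; rewrite // subrr normr0.
Qed.

Lemma holo_ccontx G a b c d y : holo_on G a b c d -> c <= y <= d ->
  ccont a b (fun x => G x y).
Proof. by move=> hG yc x xa; apply: holo_contx; exact: hG. Qed.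

Lemma holo_cconty G a b c d x : holo_on G a b c d -> a <= x <= b ->
  ccont c d (fun y => G x y).
Proof. by move=> hG yc y xa; apply: holo_conty; exact: hG. Qed.

Lemma rect_int_quarters G a b c d m n : holo_on G a b c d ->
  a <= m <= b -> c <= n <= d ->
  rect_int G a b c d = rect_int G a m c n + rect_int G m b c n +
                      (rect_int G a m n d + rect_int G m b n d).
Proof.
move=> hG /andP[am mb] /andP[cn nd]; rewrite /rect_int.
have ab := le_trans am mb; have cd := le_trans cn nd.
rewrite (cint_cat am mb (h := fun x => G x c)); last first.
  by apply: (holo_ccontx hG); rewrite lexx.
rewrite (cint_cat am mb (h := fun x => G x d)); last first.
  by apply: (holo_ccontx hG); rewrite lexx andbT.
rewrite (cint_cat cn nd (h := fun y => G a y)); last first.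
  by apply: (holo_cconty hG); rewrite lexx.
rewrite (cint_cat cn nd (h := fun y => G b y)); last first.
  by apply: (holo_cconty hG); rewrite lexx andbT.
ring.
Qed.

(** Opposite sides are paired. The affine part of [G] at [(x, y)] then contributes a constant to
    each pair, and the two contributions cancel, so only the remainder of size [e] is integrated. *)
Lemma rect_int_small G a b c d x y l (e : R) : holo_on G a b c d ->
  a <= b -> c <= d ->
  (forall x' y', a <= x' <= b -> c <= y' <= d ->
    normc (G x' y' - G x y - l * ((x' - x) +i* (y' - y))) <= e) ->
  normc (rect_int G a b c d) <= 2 * e * ((b - a) + (d - c)).
Proof.
move=> hG ab cd he.
pose E x' y' := G x' y' - G x y - l * ((x' - x) +i* (y' - y)).
have aa : a <= a <= b by rewrite lexx.
have bb : a <= b <= b by rewrite lexx andbT.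
have cc : c <= c <= d by rewrite lexx.
have dd : c <= d <= d by rewrite lexx andbT.
pose h1 x' := G x' c - G x' d - l * (0 +i* (c - d)).
pose h2 y' := G b y' - G a y' - l * ((b - a) +i* 0).
have h1c : ccont a b h1.
  apply: ccontcB; last exact: ccontc_cst.
  by apply: ccontcB; exact: (holo_ccontx hG).
have h2c : ccont c d h2.
  apply: ccontcB; last exact: ccontc_cst.
  by apply: ccontcB; exact: (holo_cconty hG).
have -> : rect_int G a b c d = cint a b h1 + 'i * cint c d h2.
  rewrite /h1 /h2 cintB; last exact: ccontc_cst.
  rewrite cintB; [|exact: (holo_ccontx hG)..].
  rewrite cintB; last exact: ccontc_cst.
  rewrite cintB; [|exact: (holo_cconty hG)..].
  rewrite !cint_cst // /rect_int.
  have -> : 0 +i* (c - d) = - 'i * (d - c)%:C.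
    by apply: eq_complexP; rewrite ?ReM ?ImM /=; ring.
  have -> : (b - a) +i* 0 = (b - a)%:C by [].
  ring.
  by apply: ccontcB; exact: (holo_cconty hG).
  by apply: ccontcB; exact: (holo_ccontx hG).
rewrite (le_trans (le_normcD _ _)) // normcM.
rewrite normc_i mul1r.
rewrite mulrDr lerD //; apply: normc_cint_le => // t tin.
- rewrite /h1 (_ : _ - _ - _ = E t c - E t d).
    by rewrite (le_trans (le_normcB _ _)) // mulrDl mul1r lerD // he.
  rewrite /E (_ : _ +i* (c - d) = (t - x) +i* (c - y) - ((t - x) +i* (d - y))).
    ring.
  by apply: eq_complexP; rewrite ?ReB ?ImB /=; ring.
- rewrite /h2 (_ : _ - _ - _ = E b t - E a t).
    by rewrite (le_trans (le_normcB _ _)) // mulrDl mul1r lerD // he.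
  rewrite /E (_ : (b - a) +i* 0 = (b - x) +i* (t - y) - ((a - x) +i* (t - y))).
    ring.
  by apply: eq_complexP; rewrite ?ReB ?ImB /=; ring.
Qed.

Lemma norm_quarter (u z1 z2 z3 z4 : R[i]) (e : R) : u = z1 + z2 + (z3 + z4) ->
  e <= normc u -> [\/ e / 4 <= normc z1, e / 4 <= normc z2,
                     e / 4 <= normc z3 | e / 4 <= normc z4].
Proof.
move=> -> h.
have [?|h1] := leP (e / 4) (normc z1); first by constructor 1.
have [?|h2] := leP (e / 4) (normc z2); first by constructor 2.
have [?|h3] := leP (e / 4) (normc z3); first by constructor 3.
have [?|h4] := leP (e / 4) (normc z4); first by constructor 4.
have := le_normcD (z1 + z2) (z3 + z4).
have := le_normcD z1 z2; have := le_normcD z3 z4; lra.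
Qed.

(** Lower ends increase and upper ends decrease, so every lower end is below every upper end; the
    supremum of the lower ends works. *)
Lemma nested_point (s : nat -> R) W : (forall k, s k <= s k.+1) ->
  (forall k, s k.+1 + W / 2 ^+ k.+1 <= s k + W / 2 ^+ k) -> 0 <= W ->
  exists X, forall k, s k <= X <= s k + W / 2 ^+ k.
Proof.
move=> s1 s2 W0.
have sm : {homo s : m n / (m <= n)%N >-> m <= n}.
  exact: (homo_leq (@lexx _ _) (@le_trans _ _)).
have sm2 : forall m n, (m <= n)%N -> s n + W / 2 ^+ n <= s m + W / 2 ^+ m.
  move=> m n /subnK <-; elim: (n - m)%N => [|k IH]; first by rewrite add0n.
  by rewrite addSn (le_trans (s2 _)).
have W2 k : 0 <= W / 2 ^+ k by rewrite divr_ge0 // exprn_ge0.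
have cross j k : s j <= s k + W / 2 ^+ k.
  have [jk|kj] := leqP j k; first by rewrite (le_trans (sm _ _ jk)) // lerDl.
  by rewrite (le_trans _ (sm2 _ _ (ltnW kj))) // lerDl.
exists (sup (range s)) => k; apply/andP; split.
  apply: sup_upper_bound; last by exists k.
  by split; [exists (s 0), 0%N|exists (s 0 + W / 2 ^+ 0) => _ [j _ <-]].
by apply: sup_le_ub; [exists (s 0), 0%N|move=> _ [j _ <-]].
Qed.

Lemma expr2_small W (e : R) : 0 < e -> exists k, W / 2 ^+ k < e.
Proof.
move=> e0; have [k hk] : exists k : nat, W / e < k%:R.
  exists (Num.truncn `|W / e|).+1; rewrite (le_lt_trans (ler_norm _)) //.
  exact: truncnS_gt.
exists k; rewrite ltr_pdivrMr ?exprn_gt0 // mulrC -ltr_pdivrMr //.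
rewrite (lt_trans hk) // -natrX ltr_nat; exact: ltn_expl.
Qed.

(** If the integral had modulus [eta > 0], repeated quartering would give rectangles shrinking to a
    point with integrals of modulus at least [eta / 4 ^+ k], whereas differentiability at that point
    makes them negligible compared with the square of the side. *)
Theorem goursat G a b c d : a <= b -> c <= d -> holo_on G a b c d ->
  rect_int G a b c d = 0.
Proof.
move=> ab cd hG; apply/eqP; rewrite -normc_eq0; apply/negPn/negP => n0.
set eta := normc (rect_int G a b c d) in n0.
have eta0 : 0 < eta by rewrite lt0r n0 normc_ge0.
pose W := b - a; pose H := d - c.
have W0 : 0 <= W by rewrite subr_ge0.
have H0 : 0 <= H by rewrite subr_ge0.
(* A rectangle of stage [k] is coded by its lower left corner alone, its sides being [W / 2 ^+ k]
   and [H / 2 ^+ k]. *)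
pose bad k (q : R * R) := [/\ a <= q.1, q.1 + W / 2 ^+ k <= b, c <= q.2,
  q.2 + H / 2 ^+ k <= d & eta / 4 ^+ k <=
  normc (rect_int G q.1 (q.1 + W / 2 ^+ k) q.2 (q.2 + H / 2 ^+ k))].
pose good k (q q' : R * R) := [/\ bad k.+1 q', q.1 <= q'.1, q.2 <= q'.2,
  q'.1 + W / 2 ^+ k.+1 <= q.1 + W / 2 ^+ k & q'.2 + H / 2 ^+ k.+1 <= q.2 + H / 2 ^+ k].
have half (V : R) k : V / 2 ^+ k = V / 2 ^+ k.+1 + V / 2 ^+ k.+1.
  rewrite exprS; field.
  by rewrite expf_neq0 ?pnatr_eq0.
have Vk (V : R) k : 0 <= V -> 0 <= V / 2 ^+ k.
  by move=> V0; rewrite divr_ge0 // exprn_ge0.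
have step k q : bad k q -> exists q', good k q q'.
  case: q => x y [/= ax xb cy yd he].
  have hW := half W k; have hH := half H k.
  have w0 := Vk W k.+1 W0; have h0 := Vk H k.+1 H0.
  set w := W / 2 ^+ k.+1 in hW w0; set h := H / 2 ^+ k.+1 in hH h0.
  have hsub : holo_on G x (x + W / 2 ^+ k) y (y + H / 2 ^+ k).
    move=> x' y' /andP[x1 x2] /andP[y1 y2]; apply: hG.
      by rewrite (le_trans ax x1) (le_trans x2 xb).
    by rewrite (le_trans cy y1) (le_trans y2 yd).
  have e4 : eta / 4 ^+ k / 4 = eta / 4 ^+ k.+1.
    by rewrite exprSr invfM mulrA.
  have bnd (u v o p : R) : o <= u -> u + (v + v) <= p -> 0 <= v ->
      [/\ o <= u + v, u + v <= p, u + v + v <= p, u <= u + v & u + v <= u + (v + v)].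
    by clear; split; lra.
  have [ax1 xb1 xb2 xx xw] := bnd _ _ _ _ ax (eq_rect _ (fun V => x + V <= b) xb _ hW) w0.
  have [cy1 yd1 yd2 yy yh] := bnd _ _ _ _ cy (eq_rect _ (fun V => y + V <= d) yd _ hH) h0.
  have goodI x' y' : a <= x' -> x' + w <= b -> c <= y' -> y' + h <= d ->
      x <= x' -> y <= y' -> x' + w <= x + (w + w) -> y' + h <= y + (h + h) ->
      eta / 4 ^+ k.+1 <= normc (rect_int G x' (x' + w) y' (y' + h)) ->
      good k (x, y) (x', y').
    by move=> *; rewrite /good /bad /= -/w -/h hW hH; split.
  have [] := norm_quarter (rect_int_quarters hsub (m := x + w) (n := y + h) _ _) he.
  - by rewrite xx hW xw.
  - by rewrite yy hH yh.
  - by rewrite e4 => q1; exists (x, y); apply: goodI; rewrite ?lexx.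
  - rewrite e4 hW addrA => q1; exists (x + w, y).
    by apply: goodI => //; rewrite -?addrA.
  - rewrite e4 hH addrA => q1; exists (x, y + h).
    by apply: goodI => //; rewrite -?addrA.
  - rewrite e4 hW hH !addrA => q1; exists (x + w, y + h).
    by apply: goodI => //; rewrite -?addrA.
pose next k q := if pselect (exists q', good k q q') is left ex
  then projT1 (cid ex) else q.
pose s := fix s k := if k is k'.+1 then next k' (s k') else (a, c).
have next_good k q : bad k q -> good k q (next k q).
  move=> /step ex; rewrite /next; case: pselect => // ex'.
  by case: (cid ex').
have bads k : bad k (s k).
  elim: k => [|k IH] /=; last by case: (next_good _ _ IH).
  rewrite /bad /= expr0 !divr1 /W /H !lexx.
  by rewrite [a + _]addrC subrK [c + _]addrC subrK !lexx; split.
have goods k : good k (s k) (s k.+1) by apply: next_good.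
have [X hX] : exists X, forall k, (s k).1 <= X <= (s k).1 + W / 2 ^+ k.
  by apply: nested_point => // k; case: (goods k).
have [Y hY] : exists Y, forall k, (s k).2 <= Y <= (s k).2 + H / 2 ^+ k.
  by apply: nested_point => // k; case: (goods k).
have inX : a <= X <= b.
  by have := hX 0; have := bads 0 => -[/= *]; apply/andP; split; lra.
have inY : c <= Y <= d.
  by have := hY 0; have := bads 0 => -[/= *]; apply/andP; split; lra.
have [l hl] := hG X Y inX inY.
(* At stage [k] the estimate will be [2 * e * (W + H) ^+ 2 / 4 ^+ k], to be less than
   [eta / 4 ^+ k]; the added 1 covers a rectangle reduced to a point. *)
have WH : 0 < 4 * (W + H) ^+ 2 + 1.
  by rewrite ltr_wpDl // mulr_ge0 // sqr_ge0.
pose e := eta / (4 * (W + H) ^+ 2 + 1).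
have e0 : 0 < e by rewrite divr_gt0.
have [r r0 hr] := hl e e0.
have [k hk] := expr2_small (W + H) r0.
have := bads k; case: (s k) (hX k) (hY k) => x y /= /andP[xX Xx] /andP[yY Yy].
move=> [/= ax xb cy yd].
have w0 := Vk W k W0; have h0 := Vk H k H0.
have WHk : (W + H) / 2 ^+ k = W / 2 ^+ k + H / 2 ^+ k by rewrite mulrDl.
set w := W / 2 ^+ k in w0 xX Xx xb WHk *.
set h := H / 2 ^+ k in h0 yY Yy yd WHk *.
apply/negP; rewrite -ltNge.
have hsub : holo_on G x (x + w) y (y + h).
  move=> x' y' /andP[x1 x2] /andP[y1 y2]; apply: hG.
    by rewrite (le_trans ax x1) (le_trans x2 xb).
  by rewrite (le_trans cy y1) (le_trans y2 yd).
have wr : w < r by rewrite (le_lt_trans _ hk) // WHk lerDl.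
have hr' : h < r by rewrite (le_lt_trans _ hk) // WHk lerDr.
apply: (@le_lt_trans _ _ (2 * (e * (w + h)) * ((x + w - x) + (y + h - y)))).
  apply: (@rect_int_small _ _ _ _ _ X Y l) => //; rewrite ?lerDl //.
  move=> x' y' /andP[x1 x2] /andP[y1 y2].
  have ux : `|x' - X| <= w.
    by rewrite ler_distl lerBlDr (le_trans Xx) ?lerD2r // (le_trans x2) ?lerD2r.
  have uy : `|y' - Y| <= h.
    by rewrite ler_distl lerBlDr (le_trans Yy) ?lerD2r // (le_trans y2) ?lerD2r.
  apply: le_trans (hr _ _ (le_lt_trans ux wr) (le_lt_trans uy hr')) _.
  by rewrite ler_wpM2l ?(ltW e0) // lerD.
have -> : x + w - x + (y + h - y) = w + h by ring.
rewrite -WHk.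
have -> : 2 * (e * ((W + H) / 2 ^+ k)) * ((W + H) / 2 ^+ k) =
   2 * e * (W + H) ^+ 2 / 4 ^+ k.
  rewrite (_ : 4 = 2 ^+ 2 :> R) -?exprM ?(mulnC 2) ?exprM; last by ring.
  by field; rewrite expf_neq0 ?pnatr_eq0.
rewrite ltr_pM2r ?invr_gt0 ?exprn_gt0 //.
rewrite /e mulrAC mulrC -mulrA -[ltRHS]mulr1 ltr_pM2l // mulrC.
by rewrite ltr_pdivrMr // mul1r; have := sqr_ge0 (W + H); lra.
Qed.

End Goursat.

(** * Circle means and Cauchy's formula *)

Section ComplexExponential.
Variable R : realType.
Implicit Types (z w : R[i]) (x y t : R).

Lemma is_derive_lin (f : R -> R) x l (e : R) : is_derive x 1 f l -> 0 < e ->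
  exists2 d : R, 0 < d & forall y, `|y - x| < d ->
    `|f y - f x - l * (y - x)| <= e * `|y - x|.
Proof.
move=> [df <-] e0; move/cvgrPdist_lt : (df) => /(_ _ e0).
rewrite near_withinE => /nbhs_ballP[d /= d0 hd]; exists d => // y yd.
have [->|yx] := eqVneq y x; first by rewrite !subrr mulr0 subr0 normr0 mulr0.
have yx0 : y - x != 0 by rewrite subr_eq0.
have := hd (y - x); rewrite /ball /= sub0r normrN => /(_ yd yx0).
rewrite /GRing.scale /= mulr1 subrK => h.
rewrite -(ler_pM2l (_ : 0 < `|(y - x)^-1|)) ?normr_gt0 ?invr_eq0 //.
rewrite -normrM mulrBr (mulrC (_^-1) (_ * (y - x))) mulfK //.
rewrite mulrCA normfV mulVf ?normr_eq0 // mulr1 distrC; exact: ltW h.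
Qed.

Definition cexp z : R[i] := (expR (complex.Re z))%:C * expi (complex.Im z).

Lemma expi0 : expi 0 = 1 :> R[i].
Proof. by rewrite /expi cos0 sin0. Qed.

Lemma expiD x y : expi (x + y) = expi x * expi y.
Proof.
apply: eq_complexP; rewrite ?ReM ?ImM /= ?cosD ?sinD //.
by rewrite addrC.
Qed.

Lemma normc_expi t : normc (expi t) = 1.
Proof.
apply/eqP; rewrite -(eqrXn2 (n := 2)) ?normc_ge0 //.
by rewrite normc_sqr /= expr1n cos2Dsin2.
Qed.

Lemma expi_2pi : expi (2 * pi) = 1 :> R[i].
Proof. by rewrite /expi mulr_natl cos2pi sin2pi. Qed.

Lemma cexpD z w : cexp (z + w) = cexp z * cexp w.
Proof. by rewrite /cexp ReD ImD expRD expiD rmorphM /=; ring. Qed.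

Lemma cexp0 : cexp 0 = 1.
Proof. by rewrite /cexp /= expR0 expi0 mulr1. Qed.

Lemma normc_cexp z : normc (cexp z) = expR (complex.Re z).
Proof. by rewrite normcM normc_expi mulr1 normc_real ger0_norm ?expR_ge0. Qed.

Lemma cexpMn z n : cexp (n%:R * z) = cexp z ^+ n.
Proof.
elim: n => [|n IH]; first by rewrite mul0r cexp0.
by rewrite -natr1 mulrDl mul1r cexpD IH exprSr.
Qed.

Lemma cexp_ln (r t : R) : 0 < r -> cexp (ln r +i* t) = r%:C * expi t.
Proof. by move=> r0; rewrite /cexp /= lnK. Qed.

Lemma cderiv_cexp0 : cderiv cexp 0 1.
Proof.
(* The error terms below add up to [8 * e' * normc w]; the bound [e' <= 1] keeps [expR x] and
   [1 + x] below constants. *)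
move=> e e0; have [e' [e'0 e'1 e'8]] : exists e' : R, [/\ 0 < e', e' <= 1 & e' <= e / 8].
  exists (Num.min 1 (e / 8)).
  by rewrite lt_min ltr01 divr_gt0 // !ge_min !lexx orbT.
have [d1 d10 h1] := is_derive_lin (is_derive_expR (0 : R)) e'0.
have [d2 d20 h2] := is_derive_lin (is_derive_cos (0 : R)) e'0.
have [d3 d30 h3] := is_derive_lin (is_derive_sin (0 : R)) e'0.
exists (Num.min (Num.min d1 e') (Num.min d2 d3)).
  by rewrite !lt_min d10 e'0 d20 d30.
move=> w; rewrite !lt_min subr0 => /andP[/andP[w1 we] /andP[w2 w3]].
rewrite cexp0 mul1r.
have hx := normr_Re_le w; have hy := normr_Im_le w.
set x := complex.Re w in hx *; set y := complex.Im w in hy *.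
have := h1 x; have := h2 y; have := h3 y.
rewrite sin0 cos0 expR0 !subr0 oppr0 !mul0r !subr0 !mul1r.
move=> /(_ (le_lt_trans hy w3)) k3 /(_ (le_lt_trans hy w2)) k2.
move=> /(_ (le_lt_trans hx w1)) k1.
rewrite (le_trans (normc_le_ReIm _)) //.
rewrite !ReB !ImB /cexp ReM ImM /= -/x -/y !mul0r !subr0 addr0.
have cosy : `|cos y| <= 1 by rewrite ler_norml cos_geN1 cos_le1.
have -> : expR x * cos y - 1 - x =
   (expR x - 1 - x) * cos y + (1 + x) * (cos y - 1) by ring.
have -> : expR x * sin y - y = (sin y - y) * expR x + (expR x - 1) * y by ring.
have nx : `|1 + x| <= 2.
  rewrite (le_trans (ler_normD _ _)) // normr1.
  have : `|x| <= 1 by lra.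
  lra.
have ex1 : `|expR x - 1| <= 2 * e'.
  rewrite -(subrK x (expR x - 1)) (le_trans (ler_normD _ _)) //.
  have : e' * `|x| <= e' by rewrite ger_pMr //; lra.
  lra.
have ex : `|expR x| <= 3.
  by rewrite -(subrK 1 (expR x)) (le_trans (ler_normD _ _)) // normr1; lra.
have := normc_ge0 w; set N := normc w in hx hy we w1 w2 w3 * => N0.
apply: (@le_trans _ _ (e' * N + 2 * (e' * N) + (3 * (e' * N) + 2 * e' * N))); last first.
  have : e' * N <= e / 8 * N by rewrite ler_wpM2r.
  lra.
have eN t : `|t| <= N -> e' * `|t| <= e' * N by move=> ?; apply: ler_wpM2l => //; exact: ltW.
rewrite lerD //.
- rewrite (le_trans (ler_normD _ _)) // !normrM lerD //.
  + by rewrite -[leRHS]mulr1 ler_pM // (le_trans k1) ?eN.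
  + by rewrite ler_pM // (le_trans k2) ?eN.
- rewrite (le_trans (ler_normD _ _)) // !normrM lerD //.
  + by rewrite mulrC ler_pM // (le_trans k3) ?eN.
  + by rewrite ler_pM.
Qed.

(** The functional equation [cexp w = cexp z * cexp (w - z)] carries the derivative at 0 to [z]. *)
Lemma cderiv_cexp z : cderiv cexp z (cexp z).
Proof.
have h0 : cderiv (fun w => w - z) z 1.
  rewrite -[X in cderiv _ _ X]addr0; apply: cderivD; first exact: cderiv_id.
  exact: cderiv_cst.
have h1 : cderiv cexp (z - z) 1 by rewrite subrr; exact: cderiv_cexp0.
have := cderivM (cderiv_cst (cexp z) z) (cderiv_comp h0 h1).
rewrite mul0r add0r !mulr1; apply: (@cderiv_ext _ _ _ _ _ 1) => // w _ /=.
by rewrite -cexpD addrC subrK.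
Qed.

Lemma curve_expi (r t : R) : curve_cont (fun s => r%:C * expi s) t.
Proof.
apply: curveM; first exact: curve_cst.
by apply/curve_contP; split => /=; [exact: continuous_cos|exact: continuous_sin].
Qed.

End ComplexExponential.

(** * Means over circles and their independence of the radius *)

Section CircleMeans.
Variable R : realType.
Implicit Types (f g : R[i] -> R[i]) (r : R) (z w : R[i]).
Local Notation pi2 := (2 * pi : R).

Lemma pi2_gt0 : 0 < pi2. Proof. by rewrite mulr_gt0 // pi_gt0. Qed.

(** The contour integral of [f w / w] divided by [2 pi i]; for this reason the Cauchy kernel appears
    below as [w / (w - z)]. *)
Definition cmean f r : R[i] :=
  (pi2^-1)%:C * cint 0 pi2 (fun t => f (r%:C * expi t)).

Definition circle_cont f r := forall z, normc z = r -> ccont_at f z.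

Lemma circle_cont_cst z r : circle_cont (fun=> z) r.
Proof. by move=> w _; exact: ccont_cst. Qed.

Lemma circle_contM f g r : circle_cont f r -> circle_cont g r ->
  circle_cont (fun w => f w * g w) r.
Proof. by move=> fc gc w wr; apply: ccontM; [exact: fc|exact: gc]. Qed.

Lemma circle_contB f g r : circle_cont f r -> circle_cont g r ->
  circle_cont (fun w => f w - g w) r.
Proof.
move=> fc gc w wr; have := ccontD (fc w wr) (ccontM (ccont_cst (-1) w) (gc w wr)).
by apply: (@ccont_ext _ _ _ _ 1) => // u _; rewrite mulN1r.
Qed.

Lemma normc_polar r t : 0 <= r -> normc (r%:C * expi t) = r.
Proof. by move=> r0; rewrite normcM normc_expi mulr1 normc_real ger0_norm. Qed.

Lemma circle_ccont f r a b : 0 <= r -> circle_cont f r ->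
  ccont a b (fun t => f (r%:C * expi t)).
Proof.
move=> r0 fc t _; apply: (@curve_comp _ f (fun t => r%:C * expi t)).
  by apply: fc; rewrite normc_polar.
exact: curve_expi.
Qed.

Lemma cmean_eq f g r : 0 <= r -> (forall z, normc z = r -> f z = g z) ->
  cmean f r = cmean g r.
Proof.
by move=> r0 fg; congr (_ * _); apply: cint_eq => t _; rewrite fg ?normc_polar.
Qed.

Lemma cmeanB f g r : 0 <= r -> circle_cont f r -> circle_cont g r ->
  cmean (fun z => f z - g z) r = cmean f r - cmean g r.
Proof. by move=> r0 fc gc; rewrite /cmean -mulrBr cintB //; exact: circle_ccont. Qed.

Lemma cmeanZ f r z : 0 <= r -> circle_cont f r ->
  cmean (fun w => z * f w) r = z * cmean f r.
Proof.
by move=> r0 fc; rewrite /cmean cintZ; [rewrite mulrCA|exact: circle_ccont].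
Qed.

Lemma cmean_cst z r : cmean (fun=> z) r = z.
Proof.
rewrite /cmean cint_cst ?(ltW pi2_gt0) // subr0 mulrCA -rmorphM /= mulVf ?mulr1 //.
by rewrite gt_eqF // pi2_gt0.
Qed.

Lemma cmean_sum r (I : Type) (s : seq I) (F : I -> R[i] -> R[i]) : 0 <= r ->
  (forall i, circle_cont (F i) r) ->
  cmean (fun z => \sum_(i <- s) F i z) r = \sum_(i <- s) cmean (F i) r.
Proof.
move=> r0 Fc; rewrite /cmean cint_sum ?mulr_sumr // => i; exact: circle_ccont.
Qed.

Lemma normc_cmean_le f r M : 0 <= r -> circle_cont f r ->
  (forall z, normc z = r -> normc (f z) <= M) -> normc (cmean f r) <= M.
Proof.
move=> r0 fc hM; rewrite normcM normc_real ger0_norm ?invr_ge0 ?(ltW pi2_gt0) //.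
rewrite mulrC ler_pdivrMr ?pi2_gt0 // -[X in _ <= _ * X]subr0.
apply: normc_cint_le; first exact/ltW/pi2_gt0; first exact: circle_ccont.
by move=> t _; rewrite hM ?normc_polar.
Qed.

(** [goursat] for [f] composed with [cexp] on the rectangle with sides from [ln r1] to [ln r2] and
    from 0 to [2 * pi]: the horizontal sides cancel by periodicity, and the vertical sides are the
    two circles. *)
Lemma cmean_annulus f (r1 r2 : R) : 0 < r1 -> r1 <= r2 ->
  (forall z, r1 <= normc z <= r2 -> exists l, cderiv f z l) ->
  cmean f r1 = cmean f r2.
Proof.
move=> r10 r12 hf; have r20 := lt_le_trans r10 r12.
pose G (u t : R) := f (cexp (u +i* t)).
have hG : holo_on G (ln r1) (ln r2) 0 pi2.
  move=> u t /andP[u1 u2] _.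
  have [|l hl] := hf (cexp (u +i* t)).
    by rewrite normc_cexp /= -[r1]lnK // -[r2]lnK // !ler_expR u1.
  exists (l * cexp (u +i* t)) => e e0.
  have [d d0 hd] := cderiv_comp (cderiv_cexp _) hl e0.
  exists (d / 2); first by rewrite divr_gt0.
  move=> u' t' hu ht.
  have hn : normc ((u' - u) +i* (t' - t)) <= `|u' - u| + `|t' - t|.
    exact: normc_le_ReIm.
  have := hd (u' +i* t').
  rewrite (_ : u' +i* t' - (u +i* t) = (u' - u) +i* (t' - t)); last first.
    by apply: eq_complexP; rewrite ?ReB ?ImB.
  move=> h; apply: le_trans (h _) _.
    by rewrite (le_lt_trans hn) // (splitr d) ltrD.
  by rewrite ler_wpM2l // ltW.
have ln12 : ln r1 <= ln r2 by rewrite ler_ln ?posrE.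
have := goursat ln12 (ltW pi2_gt0) hG; rewrite /rect_int.
have -> : cint (ln r1) (ln r2) (fun x => G x 0) =
          cint (ln r1) (ln r2) (fun x => G x pi2).
  by apply: cint_eq => x _; rewrite /G /cexp /= expi0 expi_2pi.
rewrite subrr add0r => /eqP; rewrite mulf_eq0 => /orP[|].
  by rewrite -normc_eq0 normc_i oner_eq0.
rewrite subr_eq0 => /eqP h; rewrite /cmean; congr (_ * _).
transitivity (cint 0 pi2 (fun y => G (ln r1) y)).
  by apply: cint_eq => t _; rewrite /G cexp_ln.
by rewrite -h; apply: cint_eq => t _; rewrite /G cexp_ln.
Qed.

(** The mean does not depend on the radius, and at small radii it is close to [f 0] by
    continuity. *)
Lemma cmean_center f r : 0 < r ->
  (forall z, normc z <= r -> exists l, cderiv f z l) -> cmean f r = f 0.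
Proof.
move=> r0 hf; apply/eqP; rewrite -subr_eq0 -normc_eq0; apply/eqP/le_anti.
rewrite normc_ge0 andbT; apply/ler_addgt0Pr => e e0; rewrite add0r.
have [l hl] : exists l, cderiv f 0 l by apply: hf; rewrite normc0 ltW.
have [d d0 hd] := cderiv_cont hl e0.
pose s := Num.min (d / 2) r.
have s0 : 0 < s by rewrite lt_min r0 divr_gt0.
have sr : s <= r by rewrite ge_min lexx orbT.
have sd : s < d by rewrite gt_min; apply/orP; left; lra.
have fcont z : normc z = s -> ccont_at f z.
  by move=> zs; have [|m /cderiv_cont //] := hf z; rewrite zs.
rewrite -(cmean_annulus (r1 := s) s0 sr); last by move=> z /andP[_ /hf].
rewrite -[X in _ - X](cmean_cst _ s) -cmeanB ?(ltW s0) //; last first.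
  exact: circle_cont_cst.
apply: normc_cmean_le; first exact: ltW.
  by apply: circle_contB => //; exact: circle_cont_cst.
by move=> z zs; rewrite ltW // hd // subr0 zs.
Qed.

End CircleMeans.

(** * Cauchy's formula, Taylor remainders and the maximum principle *)

Section CauchyFormula.
Variable R : realType.
Implicit Types (f g : R[i] -> R[i]) (r : R) (z w : R[i]).
Local Notation pi2 := (2 * pi : R).

Definition cderivable f z := exists l, cderiv f z l.

(** Compactness of the range of angles makes the continuity at the points of the circle uniform in
    [t]. *)
Lemma circle_uniform f r (e : R) : 0 < r -> circle_cont f r -> 0 < e ->
  exists2 d : R, 0 < d & forall s t, `|s - r| < d -> 0 <= t <= pi2 ->
    normc (f (s%:C * expi t) - f (r%:C * expi t)) < e.
Proof.
move=> r0 fc e0.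
have /compact_near_coveringP := @segment_compact _ (0 : R) pi2.
move=> /(_ _ (nbhs r) (fun s t => normc (f (s%:C * expi t) - f (r%:C * expi t)) < e)).
move=> /(_ _) [].
  move=> t _; have e20 : 0 < e / 2 by rewrite divr_gt0.
  have [d d0 hd] := fc (r%:C * expi t) (normc_polar _ (ltW r0)) _ e20.
  have rd0 : 0 < d / 2 / (r + 1) by rewrite !divr_gt0 // ltr_wpDl // ltW.
  have [c c0 hc] := @curve_expi _ 1 t _ rd0.
  exists (ball t c, ball r (d / 2)).
    by split; apply: nbhsx_ballx; rewrite ?divr_gt0.
  move=> [t' s] [/= tt' ss'].
  have he : normc (expi t' - expi t) < d / 2 / (r + 1).
    have := hc t'; rewrite distrC => /(_ tt').
    by rewrite rmorph1 !mul1r.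
  have hre : r * normc (expi t' - expi t) < d / 2.
    move: he; rewrite ltr_pdivlMr ?ltr_wpDl ?ltW //.
    by have := normc_ge0 (expi t' - expi t); nra.
  have h1 : normc (r%:C * expi t' - r%:C * expi t) < d.
    by rewrite -mulrBr normcM normc_real ger0_norm ?ltW //; lra.
  have h2 : normc (s%:C * expi t' - r%:C * expi t) < d.
    rewrite (_ : _ - _ = (s - r)%:C * expi t' + r%:C * (expi t' - expi t)).
      rewrite (le_lt_trans (le_normcD _ _)) // !normcM !normc_real normc_expi.
      rewrite mulr1 (ger0_norm (ltW r0)) (splitr d) ltrD //.
      by move: ss'; rewrite /ball /= distrC.
    by rewrite rmorphB /=; ring.
  rewrite (_ : _ - _ = (f (s%:C * expi t') - f (r%:C * expi t)) -
    (f (r%:C * expi t') - f (r%:C * expi t))); last by ring.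
  by rewrite (le_lt_trans (le_normcB _ _)) // (splitr e) ltrD // hd.
move=> d /= d0 hd; exists d => // s t sd td; apply: (hd s) => /=.
  by rewrite distrC.
by rewrite in_itv.
Qed.

(** Meant for a difference quotient, known to be continuous but not yet differentiable at its
    center, which lies on the circle of radius [r0]. Means are constant on either side of [r0], and
    uniform continuity matches the two constants. *)
Lemma cmean_cross f (rho r0 r : R) : 0 < r0 -> r0 < r -> r < rho ->
  (forall z, normc z < rho -> normc z != r0 -> cderivable f z) ->
  circle_cont f r0 -> cmean f r = f 0.
Proof.
move=> r00 r0r rrho hf fc.
apply/eqP; rewrite -subr_eq0 -normc_eq0; apply/eqP/le_anti.
rewrite normc_ge0 andbT; apply/ler_addgt0Pr => e e0; rewrite add0r.
have [d d0 hd] := circle_uniform r00 fc (divr_gt0 e0 (ltr0n _ 2)).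
have [s1 [s10 s1r s1d]] : exists s1, [/\ 0 < s1, s1 < r0 & `|s1 - r0| < d].
  exists (Num.max (r0 / 2) (r0 - d / 2)).
  case: (leP (r0 / 2) (r0 - d / 2)) => h; split; rewrite ?ltr_norml;
    try (apply/andP; split); lra.
have [s2 [s20 s2r s2d]] : exists s2, [/\ r0 < s2, s2 <= r & `|s2 - r0| < d].
  exists (Num.min r (r0 + d / 2)).
  case: (leP r (r0 + d / 2)) => h; split; rewrite ?ltr_norml;
    try (apply/andP; split); lra.
have close s : 0 <= s -> circle_cont f s -> `|s - r0| < d ->
    normc (cmean f s - cmean f r0) <= e / 2.
  move=> s0 sc sd; rewrite /cmean -mulrBr -cintB; last 2 first.
  - exact: circle_ccont.
  - by apply: circle_ccont => //; exact: ltW.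
  rewrite normcM normc_real ger0_norm ?invr_ge0 ?(ltW (pi2_gt0 R)) //.
  rewrite mulrC ler_pdivrMr ?pi2_gt0 // -[X in _ <= _ * X]subr0.
  apply: normc_cint_le; first exact/ltW/pi2_gt0.
    by apply: ccontcB; apply: circle_ccont => //; exact: ltW.
  by move=> t ht; apply/ltW/hd.
have c1 : circle_cont f s1.
  move=> z zs; have [| |l /cderiv_cont //] := hf z; rewrite zs; first lra.
  by rewrite lt_eqF.
have c2 : circle_cont f s2.
  move=> z zs; have [| |l /cderiv_cont //] := hf z; rewrite zs; first lra.
  by rewrite gt_eqF.
have e1 : cmean f s1 = f 0.
  apply: cmean_center => // z zs; apply: hf; first lra.
  by rewrite lt_eqF // (le_lt_trans zs).
have e2 : cmean f s2 = cmean f r.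
  apply: cmean_annulus => //; first lra.
  move=> z /andP[z1 z2]; apply: hf; first lra.
  by rewrite gt_eqF // (lt_le_trans s20).
rewrite -e1 -e2 (_ : _ - _ = (cmean f s2 - cmean f r0) - (cmean f s1 - cmean f r0)).
  rewrite (le_trans (le_normcB _ _)) // (splitr e) lerD // close //; lra.
by ring.
Qed.

Lemma cderivable_shift z w : cderiv (fun w => w - z) w 1.
Proof.
rewrite -[X in cderiv _ _ X]addr0; apply: cderivD; first exact: cderiv_id.
exact: cderiv_cst.
Qed.

Lemma cderivable_div f g z : cderivable f z -> cderivable g z -> g z != 0 ->
  cderivable (fun w => f w / g w) z.
Proof.
move=> [l hl] [m hm] gz; have := cderivM hl (cderiv_comp hm (cderiv_inv gz)).
by eexists; exact: H.
Qed.

Lemma cderivableM f g z : cderivable f z -> cderivable g z ->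
  cderivable (fun w => f w * g w) z.
Proof. by move=> [l hl] [m hm]; eexists; exact: cderivM hl hm. Qed.

Lemma cderivableB f g z : cderivable f z -> cderivable g z ->
  cderivable (fun w => f w - g w) z.
Proof.
move=> [l hl] [m hm]; exists (l + (0 * g z + (-1) * m)).
have := cderivD hl (cderivM (cderiv_cst (-1) z) hm).
by apply: (@cderiv_ext _ _ _ _ _ 1) => // w _; rewrite mulN1r.
Qed.

Lemma cderivable_id z : cderivable id z.
Proof. by exists 1; exact: cderiv_id. Qed.

Lemma cderivable_cst c z : cderivable (fun=> c) z.
Proof. by exists 0; exact: cderiv_cst. Qed.

Lemma cderivable_cont f z : cderivable f z -> ccont_at f z.
Proof. by move=> [l /cderiv_cont]. Qed.

Lemma normc_sub_ge z w : normc w - normc z <= normc (w - z).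
Proof. by rewrite lerBlDr le_normc_sub. Qed.

Lemma cderivable_kernel z w : normc z < normc w ->
  cderivable (fun w => w / (w - z)) w.
Proof.
move=> zw; apply: (@cderivable_div id (fun w => w - z)).
- exact: cderivable_id.
- by exists 1; exact: cderivable_shift.
- by rewrite subr_eq0; apply: contraTneq zw => ->; rewrite ltxx.
Qed.

Lemma cmean_kernel z r : normc z < r -> cmean (fun w => w / (w - z)) r = 1.
Proof.
move=> zr; have r0 := le_lt_trans (normc_ge0 z) zr.
apply/eqP; rewrite -subr_eq0 -normc_eq0; apply/eqP/le_anti.
rewrite normc_ge0 andbT; apply/ler_addgt0Pr => e e0; rewrite add0r.
(* On the circle of radius [s] the kernel differs from 1 by [z / (w - z)], of modulus at most
   [normc z / (s - normc z) <= e]. *)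
pose s := r + normc z / e.
have rs : r <= s by rewrite lerDl divr_ge0 ?normc_ge0 ?ltW.
have zs := lt_le_trans zr rs; have s0 := lt_le_trans r0 rs.
rewrite (cmean_annulus r0 rs) => [|w /andP[rw _]]; last first.
  by apply: cderivable_kernel; rewrite (lt_le_trans zr).
rewrite -(cmean_cst 1 s) -cmeanB ?(ltW s0) //; last 2 first.
- by move=> w ws; apply/cderivable_cont/cderivable_kernel; rewrite ws.
- exact: circle_cont_cst.
apply: normc_cmean_le; first exact: ltW.
  move=> w ws; apply/cderivable_cont/cderivableB; last exact: cderivable_cst.
  by apply: cderivable_kernel; rewrite ws.
move=> w ws; have wz : w - z != 0.
  by rewrite subr_eq0; apply: contraTneq zs => <-; rewrite ws ltxx.
rewrite (_ : _ - _ = z / (w - z)); last by field.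
rewrite normcM normcV ler_pdivrMr ?normc_gt0 // mulrC -ler_pdivrMr //.
by rewrite (le_trans _ (normc_sub_ge z w)) // ws /s; lra.
Qed.

Theorem cauchy_formula f (rho r : R) z : normc z < r -> r < rho ->
  (forall w, normc w < rho -> cderivable f w) ->
  cmean (fun w => f w * (w / (w - z))) r = f z.
Proof.
move=> zr rrho hf; have r0 := le_lt_trans (normc_ge0 z) zr.
(* [cmean_cross] needs a positive exceptional radius, here [normc z], so the center is treated
   directly. *)
have [z0|z0] := eqVneq z 0.
  rewrite z0 -(cmean_center (f := f) r0) => [|w wr]; last by apply: hf; lra.
  apply: cmean_eq; first exact: ltW.
  move=> w wr; rewrite subr0 divff ?mulr1 //.
  by rewrite -normc_gt0 wr.
have [l hl] : cderivable f z by apply: hf; lra.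
have [q [fq ql qc]] := (cderivP _ _ _).1 hl.
(* Away from [z] this is [w * (f w - f z) / (w - z)]; it is continuous at [z] and zero at 0, so its
   mean vanishes. With the mean of the kernel known, that is the formula. *)
pose k w := w * q w.
have kE w : w != z -> k w = w * ((f w - f z) / (w - z)).
  move=> wz; rewrite /k (fq w) addrAC subrr add0r mulfK //.
  by rewrite subr_eq0.
have kd w : normc w < rho -> w != z -> cderivable k w.
  move=> wr wz; have wz0 : w - z != 0 by rewrite subr_eq0.
  have [||m hm] := @cderivableM id (fun w => (f w - f z) / (w - z)) w.
  - exact: cderivable_id.
  - apply: cderivable_div => //; last by exists 1; exact: cderivable_shift.
    by apply: cderivableB; [exact: hf|exact: cderivable_cst].
  exists m; apply: cderiv_ext hm; first by rewrite -normc_gt0 in wz0; exact: wz0.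
  move=> u uw; rewrite kE //; apply: contraTneq uw => ->.
  by rewrite normcB_sym ltxx.
have k0 : cmean k r = 0.
  rewrite (@cmean_cross k rho (normc z) r) ?normc_gt0 //; first by rewrite /k mul0r.
    by move=> w wr wz; apply: kd => //; apply: contraNneq wz => ->.
  move=> w wz; have [->|wz'] := eqVneq w z; last first.
    by apply/cderivable_cont/kd => //; rewrite wz; lra.
  by apply: ccontM qc; apply/cderivable_cont/cderivable_id.
have kc : circle_cont (fun w => w / (w - z)) r.
  by move=> w wr; apply/cderivable_cont/cderivable_kernel; rewrite wr.
have fc : circle_cont f r.
  by move=> w wr; apply/cderivable_cont/hf; rewrite wr.
have : cmean (fun w => f w * (w / (w - z)) - f z * (w / (w - z))) r = 0.
  rewrite -[RHS]k0; apply: cmean_eq; first exact: ltW.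
  move=> w wr; rewrite kE; first by ring.
  by apply: contraTneq zr => <-; rewrite wr ltxx.
rewrite cmeanB ?ltW //.
- rewrite cmeanZ ?ltW // cmean_kernel // mulr1 => /eqP.
  by rewrite subr_eq0 => /eqP.
- exact: circle_contM.
- by apply: circle_contM => //; exact: circle_cont_cst.
Qed.

(** For [f] analytic beyond the closed disk these are the Taylor coefficients, taken as Fourier
    coefficients on the unit circle. *)
Definition tcoef f n := cmean (fun w => f w * w^-1 ^+ n) 1.

Lemma unit_circle_invX n : circle_cont (fun w => w^-1 ^+ n) 1.
Proof.
move=> w w1; have w0 : w != 0 by rewrite -normc_gt0 w1.
exact: cderiv_cont (cderivX n (cderiv_inv w0)).
Qed.

(** Cauchy's formula with the geometric series in [z / w] cut at [n]: what remains of the kernel is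
    [(z / w) ^+ n * (w / (w - z))]. *)
Theorem taylor_remainder f (rho M : R) z n : 1 < rho ->
  (forall w, normc w < rho -> cderivable f w) ->
  (forall w, normc w = 1 -> normc (f w) <= M) -> normc z < 1 ->
  normc (f z - \sum_(k < n) tcoef f k * z ^+ k) <= M * normc z ^+ n / (1 - normc z).
Proof.
move=> rho1 hf hM z1.
have fc : circle_cont f 1.
  by move=> w wr; apply/cderivable_cont/hf; rewrite wr.
have kc : circle_cont (fun w => w / (w - z)) 1.
  by move=> w wr; apply/cderivable_cont/cderivable_kernel; rewrite wr.
have tc k : circle_cont (fun w => f w * w^-1 ^+ k) 1.
  by apply: circle_contM => //; exact: unit_circle_invX.
have ztc k : circle_cont (fun w => z ^+ k * (f w * w^-1 ^+ k)) 1.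
  by apply: circle_contM => //; exact: circle_cont_cst.
have sc : circle_cont (fun w => \sum_(k < n) z ^+ k * (f w * w^-1 ^+ k)) 1.
  elim: n => [|n IH] w wr.
    by apply: (@ccont_ext _ (fun=> 0) _ _ 1) (ccont_cst _ _) => // u _; rewrite big_ord0.
  apply: (@ccont_ext _ _ _ _ 1 ltr01 _ (ccontD (IH w wr) (ztc n w wr))) => u _.
  by rewrite big_ord_recr.
have fkc : circle_cont (fun w => f w * (w / (w - z))) 1.
  exact: circle_contM.
rewrite -(cauchy_formula z1 rho1 hf).
have -> : \sum_(k < n) tcoef f k * z ^+ k =
    cmean (fun w => \sum_(k < n) z ^+ k * (f w * w^-1 ^+ k)) 1.
  rewrite (@cmean_sum _ _ _ _ (fun k : 'I_n => fun w => z ^+ k * (f w * w^-1 ^+ k))) //.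
  by apply: eq_bigr => k _; rewrite cmeanZ // mulrC.
rewrite -cmeanB //; apply: normc_cmean_le => //.
  exact: circle_contB.
move=> w w1; have w0 : w != 0 by rewrite -normc_gt0 w1.
have wz : w - z != 0.
  by rewrite subr_eq0; apply: contraTneq z1 => <-; rewrite w1 ltxx.
have -> : f w * (w / (w - z)) - \sum_(k < n) z ^+ k * (f w * w^-1 ^+ k) =
   f w * (z / w) ^+ n * (w / (w - z)).
  have -> : \sum_(k < n) z ^+ k * (f w * w^-1 ^+ k) =
     f w * \sum_(k < n) (z / w) ^+ k.
    by rewrite mulr_sumr; apply: eq_bigr => k _; rewrite exprMn; ring.
  have := subrX1 (z / w) n; set S := \sum_(_ < _) _ => hS.
  have e : w / (w - z) = S + (z / w) ^+ n * (w / (w - z)).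
    have h : (z / w) ^+ n = 1 + (z / w - 1) * S by rewrite -hS; ring.
    by rewrite h; field; apply/andP.
  by rewrite {1}e; ring.
rewrite !normcM normcX normcM !normcV w1 invr1 mulr1 mul1r.
have nz : 0 < 1 - normc z by lra.
have := normc_sub_ge z w; rewrite w1 => h.
rewrite ler_pM ?mulr_ge0 ?exprn_ge0 ?invr_ge0 ?normc_ge0 //.
  by rewrite ler_wpM2r ?exprn_ge0 ?normc_ge0 // hM.
by rewrite lef_pV2 // posrE (lt_le_trans nz).
Qed.

Lemma bernoulli_unbounded (x B : R) : 1 < x -> exists k, B < x ^+ k.
Proof.
move=> x1; have h k : 1 + (x - 1) * k%:R <= x ^+ k.
  elim: k => [|k IH]; first by rewrite mulr0 addr0.
  have k0 : 0 <= (k%:R : R) by [].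
  have : x * (1 + (x - 1) * k%:R) <= x * x ^+ k by rewrite ler_wpM2l //; lra.
  have := mulr_ge0 (sqr_ge0 (x - 1)) k0.
  rewrite -natr1 [x ^+ k.+1]exprS; lra.
have [k hk] : exists k : nat, B / (x - 1) < k%:R.
  exists (Num.truncn `|B / (x - 1)|).+1; rewrite (le_lt_trans (ler_norm _)) //.
  exact: truncnS_gt.
exists k; apply: lt_le_trans (h k).
by rewrite ltr_pdivrMr ?subr_gt0 // in hk; lra.
Qed.

(** Cauchy's formula for the powers of [f] gives [normc (f z) ^+ k <= (1 - normc z)^-1] for all [k],
    which is impossible if [normc (f z) > 1]. *)
Theorem max_modulus f (rho : R) z : 1 < rho ->
  (forall w, normc w < rho -> cderivable f w) ->
  (forall w, normc w = 1 -> normc (f w) <= 1) -> normc z < 1 -> normc (f z) <= 1.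
Proof.
move=> rho1 hf h1 z1; rewrite leNgt; apply/negP => fz.
have [k] := bernoulli_unbounded (1 - normc z)^-1 fz; apply/negP; rewrite -leNgt.
have hfk w : normc w < rho -> cderivable (fun w => f w ^+ k) w.
  by move=> /hf[l /(cderivX k) hl]; eexists; exact: hl.
rewrite -normcX -(cauchy_formula z1 rho1 hfk); apply: normc_cmean_le => //.
  move=> w w1; apply: ccontM; first by apply/cderivable_cont/hfk; rewrite w1.
  by apply/cderivable_cont/cderivable_kernel; rewrite w1.
move=> w w1; have h := normc_sub_ge z w.
rewrite normcM normcX -[leRHS]mul1r ler_pM ?exprn_ge0 ?normc_ge0 //.
  by rewrite exprn_ile1 ?normc_ge0 ?h1.
rewrite normcM normcV w1 mul1r lef_pV2 ?posrE; rewrite ?w1 in h; lra.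
Qed.

End CauchyFormula.

(** * Power series *)

Section PowerSeries.
Variable R : realType.
Implicit Types (z w : R[i]) (c d : nat -> R[i]) (g : R[i] -> R[i]) (K : R).

Lemma complex_eqP z w : (forall e : R, 0 < e -> normc (z - w) <= e) -> z = w.
Proof.
move=> h; apply/eqP; rewrite -subr_eq0 -normc_eq0; apply/eqP/le_anti.
rewrite normc_ge0 andbT; apply/ler_addgt0Pr => e e0; rewrite add0r; exact: h.
Qed.

Lemma geometric_small (x M e : R) : 0 <= x < 1 -> 0 < e ->
  exists N, forall n, (N <= n)%N -> M * x ^+ n < e.
Proof.
move=> /andP[x0 x1] e0.
have : (fun n => M * x ^+ n) @ \oo --> (0 : R).
  by apply: cvg_geometric; rewrite ger0_norm.
move=> /cvgr0Pnorm_lt /(_ _ e0) [N _ hN]; exists N => n /hN.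
by move=> /(le_lt_trans (ler_norm _)).
Qed.

Definition psum c N z := \sum_(k < N) c k * z ^+ k.

(** The error bound is the exact sum of the tail of [K * normc z ^+ k]. Hence, as soon as the series
    is known to converge to [g], any bound on the coefficients may serve as [K]
    ([has_ps_improve]). *)
Definition has_ps K c g := (forall k, normc (c k) <= K) /\
  forall z N, normc z < 1 -> normc (g z - psum c N z) <= K * normc z ^+ N / (1 - normc z).

Lemma psumS c N z : psum c N.+1 z = psum c N z + c N * z ^+ N.
Proof. by rewrite /psum big_ord_recr. Qed.

Lemma has_ps_ge0 K c g : has_ps K c g -> 0 <= K.
Proof. by move=> [/(_ 0%N) h _]; exact: le_trans (normc_ge0 _) h. Qed.

(** Keeping the second tail on the right makes the induction on [m] exact. *)
Lemma psum_cauchy K c z N m : (forall k, normc (c k) <= K) -> normc z < 1 ->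
  normc (psum c (N + m) z - psum c N z) <=
  K * normc z ^+ N / (1 - normc z) - K * normc z ^+ (N + m) / (1 - normc z).
Proof.
move=> cK z1; have nz : 1 - normc z != 0 by rewrite subr_eq0 gt_eqF.
elim: m => [|m IH]; first by rewrite addn0 !subrr normc0.
rewrite addnS psumS addrAC (le_trans (le_normcD _ _)) //.
have : normc (c (N + m)%N * z ^+ (N + m)) <= K * normc z ^+ (N + m).
  by rewrite normcM normcX ler_wpM2r // exprn_ge0 // normc_ge0.
set X := normc _ in IH *; set Y := normc _ => hY.
rewrite exprS (_ : K * _ / (1 - normc z) - K * (normc z * normc z ^+ (N + m)) / (1 - normc z) =
  (K * normc z ^+ N / (1 - normc z) - K * normc z ^+ (N + m) / (1 - normc z)) +
   K * normc z ^+ (N + m)); last by field.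
exact: lerD.
Qed.

Lemma psum_lim K c z N g : (forall k, normc (c k) <= K) -> normc z < 1 ->
  (forall e : R, 0 < e -> exists N0, forall n, (N0 <= n)%N ->
     normc (g z - psum c n z) <= e) ->
  normc (g z - psum c N z) <= K * normc z ^+ N / (1 - normc z).
Proof.
move=> cK z1 hg; apply/ler_addgt0Pr => e /hg[N0 hN0].
have := psum_cauchy N N0 cK z1.
have K0 : 0 <= K by exact: le_trans (normc_ge0 _) (cK 0%N).
have : 0 <= K * normc z ^+ (N + N0) / (1 - normc z).
  by rewrite !mulr_ge0 ?exprn_ge0 ?normc_ge0 // invr_ge0 subr_ge0 ltW.
have := hN0 (N + N0)%N (leq_addl _ _).
set A := normc (g z - _); set B := normc (_ - psum c N z).
rewrite (_ : g z - psum c N z = (g z - psum c (N + N0) z) +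
  (psum c (N + N0) z - psum c N z)); last by ring.
have := le_normcD (g z - psum c (N + N0) z) (psum c (N + N0) z - psum c N z).
rewrite -/A -/B; lra.
Qed.

Lemma has_ps_small K c g z (e : R) : has_ps K c g -> normc z < 1 -> 0 < e ->
  exists N0, forall n, (N0 <= n)%N -> normc (g z - psum c n z) <= e.
Proof.
move=> [_ hg] z1 e0.
have [|N hN] := @geometric_small (normc z) (K / (1 - normc z)) e _ e0.
  by rewrite normc_ge0.
exists N => n /hN h; rewrite (le_trans (hg _ _ z1)) //.
by rewrite mulrAC ltW.
Qed.

Lemma has_ps_improve K M c g : (forall k, normc (c k) <= K) -> has_ps M c g ->
  has_ps K c g.
Proof.
move=> cK hg; split=> // z N z1; apply: psum_lim => // e.
exact: has_ps_small hg z1.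
Qed.

Lemma has_ps_bound K c g z : has_ps K c g -> normc z < 1 ->
  normc (g z) <= K / (1 - normc z).
Proof.
by move=> [_ /(_ z 0%N)] h /h; rewrite /psum big_ord0 subr0 expr0 mulr1.
Qed.

Lemma real_series_lim (u : nat -> R) (K x : R) : 0 <= x < 1 ->
  (forall k, `|u k| <= K * x ^+ k) ->
  exists l, forall e, 0 < e -> exists N0, forall n, (N0 <= n)%N ->
    `|l - \sum_(k < n) u k| <= e.
Proof.
move=> /andP[x0 x1] hu.
have cu : cvgn (series u).
  apply: normed_cvg; apply: (@series_le_cvg _ _ (geometric K x)).
  - by move=> n; exact: normr_ge0.
  - by move=> n; rewrite /geometric /= (le_trans _ (hu n)).
  - exact: hu.
  - by apply: is_cvg_geometric_series; rewrite ger0_norm.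
exists (limn (series u)) => e e0.
move/cvgrPdist_le : cu => /(_ _ e0) [N _ hN]; exists N => n /hN.
by rewrite /series /= big_mkord.
Qed.

Lemma ps_exists c K z : (forall k, normc (c k) <= K) -> normc z < 1 ->
  exists l, forall e, 0 < e -> exists N0, forall n, (N0 <= n)%N ->
    normc (l - psum c n z) <= e.
Proof.
move=> cK z1.
have nz : 0 <= normc z < 1 by rewrite normc_ge0.
have hr k : `|complex.Re (c k * z ^+ k)| <= K * normc z ^+ k.
  rewrite (le_trans (normr_Re_le _)) // normcM normcX ler_wpM2r //.
  by rewrite exprn_ge0 ?normc_ge0.
have hi k : `|complex.Im (c k * z ^+ k)| <= K * normc z ^+ k.
  rewrite (le_trans (normr_Im_le _)) // normcM normcX ler_wpM2r //.
  by rewrite exprn_ge0 ?normc_ge0.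
have [a ha] := real_series_lim nz hr; have [b hb] := real_series_lim nz hi.
have sumRe n : complex.Re (psum c n z) = \sum_(k < n) complex.Re (c k * z ^+ k).
  by elim: n => [|n IH]; rewrite /psum ?big_ord0 // !big_ord_recr /= ReD -IH.
have sumIm n : complex.Im (psum c n z) = \sum_(k < n) complex.Im (c k * z ^+ k).
  by elim: n => [|n IH]; rewrite /psum ?big_ord0 // !big_ord_recr /= ImD -IH.
exists (a +i* b) => e e0; have e20 : 0 < e / 2 by rewrite divr_gt0.
have [N1 h1] := ha _ e20; have [N2 h2] := hb _ e20.
exists (maxn N1 N2) => n; rewrite geq_max => /andP[/h1 n1 /h2 n2].
rewrite (le_trans (normc_le_ReIm _)) // ReB ImB sumRe sumIm /=.
by rewrite (splitr e) lerD.
Qed.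

(** [xget] selects the sum of the series where it converges, and 0 elsewhere. *)
Definition PS c z : R[i] := xget 0 [set l | forall e : R, 0 < e ->
  exists N0, forall n, (N0 <= n)%N -> normc (l - psum c n z) <= e].

Lemma PS_has_ps K c : (forall k, normc (c k) <= K) -> has_ps K c (PS c).
Proof.
move=> cK; split=> // z N z1; apply: psum_lim => //.
have [l hl] := ps_exists cK z1.
by rewrite /PS; case: xgetP => [y _ //|/(_ l)].
Qed.

Lemma has_ps_inj K M c f g z : has_ps K c f -> has_ps M c g -> normc z < 1 ->
  f z = g z.
Proof.
move=> hf hg z1; apply: complex_eqP => e e0.
have e20 : 0 < e / 2 by rewrite divr_gt0.
have [N1 h1] := has_ps_small hf z1 e20; have [N2 h2] := has_ps_small hg z1 e20.
have := h1 (maxn N1 N2) (leq_maxl _ _); have := h2 (maxn N1 N2) (leq_maxr _ _).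
set p := psum c _ _ => a b.
rewrite (_ : f z - g z = (f z - p) - (g z - p)); last by ring.
by rewrite (le_trans (le_normcB _ _)) // (splitr e) lerD.
Qed.

(** Synthetic division: as a series in [w], these are the coefficients of the difference quotient of
    [PS c] between [z] and [w] ([PS_diff]). *)
Definition ps_tail c z i := PS (fun m => c (i.+1 + m)%N) z.

Lemma ps_tail_bound K c z i : (forall k, normc (c k) <= K) -> normc z < 1 ->
  normc (ps_tail c z i) <= K / (1 - normc z).
Proof. by move=> cK z1; apply: has_ps_bound => //; exact: PS_has_ps. Qed.

Lemma PS_shift K c z : (forall k, normc (c k) <= K) -> normc z < 1 ->
  PS c z = c 0%N + z * PS (fun m => c (m.+1)) z.
Proof.
move=> cK z1; apply: complex_eqP => e e0.
have e20 : 0 < e / 2 by rewrite divr_gt0.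
have [N1 h1] := has_ps_small (PS_has_ps cK) z1 e20.
have [N2 h2] := has_ps_small (PS_has_ps (c := fun m => c m.+1) (fun k => cK _)) z1 e20.
have := h1 (maxn N1 N2).+1 (leqW (leq_maxl _ _)).
have := h2 (maxn N1 N2) (leq_maxr _ _).
have -> : psum c (maxn N1 N2).+1 z =
    c 0%N + z * psum (fun m => c m.+1) (maxn N1 N2) z.
  rewrite /psum big_ord_recl expr0 mulr1; congr (_ + _); rewrite mulr_sumr.
  by apply: eq_bigr => k _; rewrite /= exprS mulrCA.
set p := psum _ _ _ => a b.
rewrite (_ : PS c z - _ = (PS c z - (c 0%N + z * p)) -
   z * (PS (fun m => c m.+1) z - p)); last by ring.
rewrite (le_trans (le_normcB _ _)) // (splitr e) lerD // normcM.
rewrite (le_trans _ a) // ler_piMl ?normc_ge0 // ltW //.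
Qed.

Lemma ps_tailS K c z i : (forall k, normc (c k) <= K) -> normc z < 1 ->
  ps_tail c z i = c i.+1 + z * ps_tail c z i.+1.
Proof.
move=> cK z1; rewrite /ps_tail (@PS_shift K) // addn0.
have -> // : (fun m => c (i.+1 + m.+1)%N) = (fun m => c (i.+2 + m)%N).
by apply/funext => m; rewrite addnS.
Qed.

(** Division by [w - z] with the full tails as coefficients; the last term is what the cut at [N]
    leaves over, and it tends to 0. *)
Lemma psum_tail K c z w N : (forall k, normc (c k) <= K) -> normc z < 1 ->
  psum c N.+1 w = PS c z + (w - z) * psum (ps_tail c z) N w
     - z * ps_tail c z N * w ^+ N.
Proof.
move=> cK z1; elim: N => [|N IH].
  rewrite /psum big_ord1 big_ord0 !expr0 !mulr1 mulr0 addr0.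
  by rewrite (PS_shift cK z1) /ps_tail; ring.
rewrite psumS IH psumS; have := ps_tailS N cK z1.
set t := ps_tail c z N => ->.
rewrite exprS; ring.
Qed.

Lemma diff_regroup (a b d p q r : R[i]) :
  a - (b + r * d) = (a - (b + d * p - q)) - q - (r - p) * d.
Proof. ring. Qed.

Lemma PS_diff K c z w : (forall k, normc (c k) <= K) -> normc z < 1 -> normc w < 1 ->
  PS c w = PS c z + PS (ps_tail c z) w * (w - z).
Proof.
move=> cK z1 w1; apply: complex_eqP => e e0.
have e30 : 0 < e / 4 by rewrite divr_gt0.
have tK i := ps_tail_bound i cK z1.
have [N1 h1] := has_ps_small (PS_has_ps cK) w1 e30.
have [N2 h2] := has_ps_small (PS_has_ps tK) w1 e30.
have [|N3 h3] := @geometric_small (normc w) (K / (1 - normc z)) (e / 4) _ e30.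
  by rewrite normc_ge0.
pose N := maxn N1 (maxn N2 N3).
have := h1 N.+1 (leqW (leq_maxl _ _)).
have := h2 N (leq_trans (leq_maxl _ _) (leq_maxr _ _)).
have := h3 N (leq_trans (leq_maxr _ _) (leq_maxr _ _)).
rewrite (psum_tail w N cK z1); set p := psum _ _ _; set q := z * _ * _ => a b d.
have hq : normc q <= e / 4.
  rewrite /q !normcM normcX (le_trans _ (ltW a)) // ler_wpM2r //.
    by rewrite exprn_ge0 ?normc_ge0.
  rewrite (le_trans _ (tK N)) // ler_piMl ?normc_ge0 // ltW //.
rewrite (diff_regroup _ _ _ p q).
have hwz : normc (w - z) <= 2 by rewrite (le_trans (le_normcB _ _)) //; lra.
rewrite (le_trans (le_normcB _ _)) // (_ : e = (e / 4 + e / 4) + e / 4 * 2); last by lra.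
rewrite lerD //; first by rewrite (le_trans (le_normcB _ _)) // lerD.
by rewrite normcM ler_pM ?normc_ge0.
Qed.

Lemma PS_ccont K c z : (forall k, normc (c k) <= K) -> normc z < 1 ->
  ccont_at (PS c) z.
Proof.
move=> cK z1 e e0; have K0 : 0 <= K by exact: le_trans (normc_ge0 _) (cK 0%N).
pose s := (1 - normc z) / 2.
have s0 : 0 < s by rewrite divr_gt0 // subr_gt0.
pose M := K / (1 - normc z) / s.
have M0 : 0 <= M by rewrite divr_ge0 ?(ltW s0) // divr_ge0 // subr_ge0 ltW.
have tK i := ps_tail_bound i cK z1.
exists (Num.min s (e / (M + 1))).
  by rewrite lt_min s0 divr_gt0 // ltr_wpDl.
move=> w; rewrite lt_min => /andP[ws we].
have hw : normc w <= 1 - s.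
  have := le_normc_sub w z; rewrite /s in ws *; lra.
have w1 : normc w < 1 by lra.
rewrite (PS_diff cK z1 w1) addrC addKr normcM.
have hM : normc (PS (ps_tail c z) w) <= M.
  rewrite (le_trans (has_ps_bound (PS_has_ps tK) w1)) // /M ler_wpM2l //.
    by rewrite divr_ge0 // subr_ge0 ltW.
  by rewrite lef_pV2 ?posrE //; lra.
move: we; rewrite ltr_pdivlMr ?ltr_wpDl // => we.
have := normc_ge0 (w - z); have := ler_wpM2r (normc_ge0 (w - z)) hM; lra.
Qed.

(** The difference quotient is itself a power series with bounded coefficients ([ps_tail_bound]),
    hence continuous, and [cderivP] applies without termwise differentiation. *)
Theorem has_ps_cderivable K c g z : has_ps K c g -> normc z < 1 -> cderivable g z.
Proof.
move=> hg z1; have cK := hg.1; have tK i := ps_tail_bound i cK z1.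
have d0 : 0 < 1 - normc z by rewrite subr_gt0.
exists (PS (ps_tail c z) z).
(* Since [cderivP] wants the factorization at all [w], the function is redefined by it outside the
   disk. *)
apply: (@cderiv_ext _ (fun w => if normc w < 1 then PS c w else
   PS c z + PS (ps_tail c z) w * (w - z)) _ _ _ _ d0).
  move=> w wz; have w1 : normc w < 1.
    by have := le_normc_sub w z; lra.
  by rewrite w1 (has_ps_inj (PS_has_ps cK) hg).
apply/cderivP; exists (PS (ps_tail c z)); split => //; last exact: PS_ccont tK z1.
by move=> w; rewrite z1; case: ifP => // w1; exact: PS_diff.
Qed.

End PowerSeries.

(** * Parseval's identity *)

Section RealMeans.
Variable R : realType.
Implicit Types (f : R[i] -> R[i]) (g h : R[i] -> R) (r p : R) (z w : R[i]).
Local Notation pi2 := (2 * pi : R).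

Definition rmean g r : R := pi2^-1 * RI 0 pi2 (fun t => g (r%:C * expi t)).

Definition rcirc g r := forall t, {for t, continuous (fun t => g (r%:C * expi t))}.

Lemma rcirc_rcont g r a b : rcirc g r -> rcont a b (fun t => g (r%:C * expi t)).
Proof. by move=> gc t _; exact: gc. Qed.

Lemma rmean_le g h r : 0 <= r -> rcirc g r -> rcirc h r ->
  (forall z, normc z = r -> g z <= h z) -> rmean g r <= rmean h r.
Proof.
move=> r0 gc hc gh; rewrite ler_wpM2l ?invr_ge0 ?(ltW (pi2_gt0 R)) //.
apply: RI_le; [exact: rcirc_rcont..|] => t _.
by rewrite gh ?normc_polar.
Qed.

Lemma rmean_eq g h r : 0 <= r -> (forall z, normc z = r -> g z = h z) ->
  rmean g r = rmean h r.
Proof. by move=> r0 gh; congr (_ * _); apply: RI_eq => t _; rewrite gh ?normc_polar. Qed.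

Lemma rmean_ge0 g r : 0 <= r -> (forall z, normc z = r -> 0 <= g z) -> 0 <= rmean g r.
Proof.
move=> r0 g0; rewrite mulr_ge0 ?invr_ge0 ?(ltW (pi2_gt0 R)) //.
by apply: RI_ge0 => t _; rewrite g0 ?normc_polar.
Qed.

Lemma rmeanD g h r : rcirc g r -> rcirc h r ->
  rmean (fun z => g z + h z) r = rmean g r + rmean h r.
Proof. by move=> gc hc; rewrite /rmean -mulrDr RI_D //; exact: rcirc_rcont. Qed.

Lemma rmeanZ g r k : rcirc g r -> rmean (fun z => k * g z) r = k * rmean g r.
Proof.
by move=> gc; rewrite /rmean RI_Z; [rewrite mulrCA|exact: rcirc_rcont].
Qed.

Lemma rmean_cst k r : rmean (fun=> k) r = k.
Proof.
rewrite /rmean RI_cst ?(ltW (pi2_gt0 R)) // subr0 mulrCA mulVf ?mulr1 //.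
by rewrite gt_eqF // pi2_gt0.
Qed.

Lemma rcircD g h r : rcirc g r -> rcirc h r -> rcirc (fun z => g z + h z) r.
Proof. by move=> gc hc t; apply: continuousD; [exact: gc|exact: hc]. Qed.

Lemma rcircM g h r : rcirc g r -> rcirc h r -> rcirc (fun z => g z * h z) r.
Proof. by move=> gc hc t; apply: continuousM; [exact: gc|exact: hc]. Qed.

Lemma rcirc_cst k r : rcirc (fun=> k) r.
Proof. by move=> t; exact: cvg_cst. Qed.

Lemma rcircX g r n : rcirc g r -> rcirc (fun z => g z ^+ n) r.
Proof.
move=> gc; elim: n => [|n IH]; first by under [X in rcirc X _]eq_fun do rewrite expr0; exact: rcirc_cst.
by under [X in rcirc X _]eq_fun do rewrite exprS; exact: (rcircM gc IH).
Qed.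

Lemma circle_curve f r t : 0 <= r -> circle_cont f r ->
  curve_cont (fun t => f (r%:C * expi t)) t.
Proof.
move=> r0 fc; apply: (@curve_comp _ f (fun t => r%:C * expi t)).
  by apply: fc; rewrite normc_polar.
exact: curve_expi.
Qed.

Lemma rcirc_normc f r : 0 <= r -> circle_cont f r -> rcirc (fun z => normc (f z)) r.
Proof. by move=> r0 fc t; apply: (curve_normc (circle_curve t r0 fc)). Qed.

Lemma rcirc_Re f r : 0 <= r -> circle_cont f r -> rcirc (fun z => complex.Re (f z)) r.
Proof. by move=> r0 fc t; have [] := (curve_contP _ _).1 (circle_curve t r0 fc). Qed.

Lemma rcirc_normc2 f r : 0 <= r -> circle_cont f r ->
  rcirc (fun z => normc (f z) ^+ 2) r.
Proof. by move=> r0 fc; apply: rcircX; exact: rcirc_normc. Qed.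

Lemma Re_cmean f r : complex.Re (cmean f r) = rmean (fun z => complex.Re (f z)) r.
Proof. by rewrite /cmean ReM /= mul0r subr0. Qed.

(** Where [k x = 0] the expression [expR (p * ln (k y))] is of no help, and continuity comes from
    the monotonicity of the power. *)
Lemma continuous_powR_nng (k : R -> R) p x : 0 < p -> (forall y, 0 <= k y) ->
  {for x, continuous k} -> {for x, continuous (fun y => k y `^ p)}.
Proof.
move=> p0 k0 kc; have [kx|kx] := eqVneq (k x) 0.
- apply/cvgrPdist_lt => e e0; rewrite kx powR0 ?gt_eqF //.
  have e1 : 0 < e `^ p^-1 by rewrite powR_gt0.
  move/cvgrPdist_lt : kc => /(_ _ e1); apply: filterS => y.
  rewrite kx !sub0r !normrN !ger0_norm ?powR_ge0 // => h.
  have pe : (e `^ p^-1) `^ p = e by rewrite -powRrM mulVf ?gt_eqF // powRr1 ?ltW.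
  by rewrite -[ltRHS]pe; apply: gt0_ltr_powR; rewrite ?nnegrE ?powR_ge0.
- have kx0 : 0 < k x by rewrite lt0r kx k0.
  have : {for x, continuous (fun y => expR (p * ln (k y)))}.
    apply: (@continuous_comp _ _ _ (fun y => p * ln (k y)) expR).
      apply: continuousM; first exact: cvg_cst.
      by apply: (@continuous_comp _ _ _ k (@ln R)) => //; exact: continuous_ln.
    exact: continuous_expR.
  rewrite /prop_for /continuous_at /= => h.
  rewrite [X in _ --> X](_ : _ = expR (p * ln (k x))); last by rewrite /powR (negPf kx).
  apply: cvg_trans h; apply: near_eq_cvg.
  have : \forall y \near x, 0 < k y.
    have : \forall y \near x, `|k x - k y| < k x by move/cvgrPdist_lt : kc; exact.
    apply: filterS => y.
    by rewrite ltr_norml => /andP[_]; lra.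
  by apply: filterS => y ky; rewrite /powR gt_eqF.
Qed.

Lemma rcirc_powR f r p : 0 < p -> 0 <= r -> circle_cont f r ->
  rcirc (fun z => normc (f z) `^ p) r.
Proof.
move=> p0 r0 fc t; apply: (@continuous_powR_nng (fun t => normc (f (r%:C * expi t)))) => //.
  by move=> y; exact: normc_ge0.
exact: rcirc_normc.
Qed.

End RealMeans.

Section Parseval.
Variable R : realType.
Implicit Types (f : R[i] -> R[i]) (c : nat -> R[i]) (z w : R[i]).

Lemma unit_circle_X n : circle_cont (fun w : R[i] => w ^+ n) 1.
Proof. by move=> w _; exact: cderiv_cont (cderivX n (cderiv_id w)). Qed.

Lemma unit_circleXV j k : circle_cont (fun w : R[i] => w ^+ j * w^-1 ^+ k) 1.
Proof.
by move=> w w1; apply: ccontM; [exact: unit_circle_X|exact: unit_circle_invX].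
Qed.

(** A nonnegative power is evaluated at the center; for a negative one the circle is enlarged, and
    the function tends to 0 there. *)
Lemma cmean_monomial j k : cmean (fun w : R[i] => w ^+ j * w^-1 ^+ k) 1 = (j == k)%:R.
Proof.
have [kj|jk] := leqP k j.
  rewrite (cmean_eq (g := fun w => w ^+ (j - k))) //; last first.
    move=> w w1; have w0 : w != 0 by rewrite -normc_gt0 w1.
    by rewrite exprVn exprB ?unitfE.
  rewrite cmean_center // => [|z _]; last by eexists; exact: cderivX (cderiv_id z).
  by rewrite expr0n subn_eq0 eqn_leq kj andbT.
rewrite (cmean_eq (g := fun w => w^-1 ^+ (k - j))) //; last first.
  move=> w w1; have w0 : w^-1 != 0 by rewrite invr_eq0 -normc_gt0 w1.
  by rewrite exprB ?unitfE ?(ltnW jk) // [w^-1 ^+ j]exprVn invrK mulrC.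
rewrite ltn_eqF //; apply: complex_eqP => e e0; rewrite subr0.
pose s := 1 + e^-1.
have s1 : 1 <= s by rewrite lerDl invr_ge0 ltW.
have s0 : 0 < s by lra.
rewrite (cmean_annulus (r2 := s)) // => [|z /andP[z1 _]]; last first.
  have z0 : z != 0 by rewrite -normc_gt0; lra.
  by eexists; exact: cderivX (cderiv_inv z0).
apply: normc_cmean_le; first exact: ltW.
  move=> z zs; have z0 : z != 0 by rewrite -normc_gt0 zs.
  exact: cderiv_cont (cderivX _ (cderiv_inv z0)).
move=> z zs; rewrite normcX normcV zs.
have [m ->] : exists m, (k - j = m.+1)%N by exists (k - j).-1; rewrite prednK ?subn_gt0.
have sV : s^-1 <= e.
  by rewrite -[leRHS]invrK lef_pV2 ?posrE ?invr_gt0 // /s; lra.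
rewrite exprS (le_trans _ sV) // ger_pMr ?invr_gt0 //.
apply: exprn_ile1; first by rewrite invr_ge0 ltW.
by rewrite invf_le1.
Qed.

Lemma psum_circle_cont c N r : circle_cont (psum c N) r.
Proof.
elim: N => [|N IH] w wr.
  by apply: (@ccont_ext _ (fun=> 0) _ _ 1) (ccont_cst _ _) => // u _; rewrite /psum big_ord0.
apply: (@ccont_ext _ (fun w => psum c N w + c N * w ^+ N) _ _ 1 ltr01).
  by move=> u _; rewrite psumS.
apply: ccontD; first exact: IH.
apply: ccontM; first exact: ccont_cst.
exact: cderiv_cont (cderivX N (cderiv_id w)).
Qed.

(** On the unit circle conjugation is inversion; the conjugate of a polynomial thus becomes analytic
    off 0, and its products can be integrated. *)
Definition psum_conj c N w := \sum_(k < N) conjc (c k) * w^-1 ^+ k.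

Lemma psum_conjE c N w : normc w = 1 -> conjc (psum c N w) = psum_conj c N w.
Proof.
move=> w1; rewrite /psum rmorph_sum /=; apply: eq_bigr => k _.
rewrite rmorphM rmorphXn /=; congr (_ * _ ^+ _).
have w0 : w != 0 by rewrite -normc_gt0 w1.
by apply: (mulfI w0); rewrite mulfV // mulrJ w1 expr1n.
Qed.

Lemma psum_conj_cont c N : circle_cont (psum_conj c N) 1.
Proof.
elim: N => [|N IH] w wr.
  by apply: (@ccont_ext _ (fun=> 0) _ _ 1) (ccont_cst _ _) => // u _; rewrite /psum_conj big_ord0.
apply: (@ccont_ext _ (fun w => psum_conj c N w + conjc (c N) * w^-1 ^+ N) _ _ 1 ltr01).
  by move=> u _; rewrite /psum_conj big_ord_recr.
apply: ccontD; first exact: IH.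
by apply: ccontM; [exact: ccont_cst|exact: unit_circle_invX].
Qed.

Lemma cmean_mul_conj f c N : circle_cont f 1 ->
  cmean (fun w => f w * psum_conj c N w) 1 = \sum_(k < N) conjc (c k) * tcoef f k.
Proof.
move=> fc; have fX k : circle_cont (fun w => f w * w^-1 ^+ k) 1.
  by apply: circle_contM => //; exact: unit_circle_invX.
rewrite (cmean_eq (g := fun w => \sum_(k < N) conjc (c k) * (f w * w^-1 ^+ k))) //.
  rewrite (@cmean_sum _ _ _ _ (fun k : 'I_N => fun w => conjc (c k) * (f w * w^-1 ^+ k))) //.
    by apply: eq_bigr => k _; rewrite cmeanZ.
  by move=> k w w1; apply: ccontM; [exact: ccont_cst|exact: fX].
by move=> w _; rewrite /psum_conj mulr_sumr; apply: eq_bigr => k _; rewrite mulrCA.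
Qed.

Lemma tcoef_psum c N k : tcoef (psum c N) k = if (k < N)%N then c k else 0.
Proof.
rewrite /tcoef (cmean_eq (g := fun w => \sum_(j < N) c j * (w ^+ j * w^-1 ^+ k))) //.
  rewrite (@cmean_sum _ _ _ _ (fun j : 'I_N => fun w => c j * (w ^+ j * w^-1 ^+ k))) //.
    rewrite (eq_bigr (fun j : 'I_N => c j * (j == k :> nat)%:R)); last first.
      by move=> j _; rewrite cmeanZ ?cmean_monomial //; exact: unit_circleXV.
    case: ifP => [kN|/negbT kN].
      rewrite (bigD1 (Ordinal kN)) //= eqxx mulr1 big1 ?addr0 // => j.
      by rewrite -val_eqE /= => /negPf ->; rewrite mulr0.
    rewrite big1 // => j _; rewrite ltn_eqF ?mulr0 //.
    by rewrite (leq_trans (ltn_ord j)) // leqNgt.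
  by move=> k' w w1; apply: ccontM; [exact: ccont_cst|exact: unit_circleXV].
by move=> w _; rewrite /psum mulr_suml; apply: eq_bigr => j _; rewrite mulrA.
Qed.

Lemma parseval c N :
  rmean (fun w => normc (psum c N w) ^+ 2) 1 = \sum_(k < N) normc (c k) ^+ 2.
Proof.
have -> : rmean (fun w => normc (psum c N w) ^+ 2) 1 =
  complex.Re (cmean (fun w => psum c N w * psum_conj c N w) 1).
  by rewrite Re_cmean; apply: rmean_eq => // w w1; rewrite -psum_conjE // mulrJ.
rewrite cmean_mul_conj; last exact: psum_circle_cont.
have -> : \sum_(k < N) conjc (c k) * tcoef (psum c N) k =
    (\sum_(k < N) normc (c k) ^+ 2)%:C; last by [].
rewrite rmorph_sum; apply: eq_bigr => k _.
by rewrite tcoef_psum ltn_ord mulrC mulrJ.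
Qed.

Lemma Re_mul_conj_le z w : complex.Re (2 * (z * conjc w) - w * conjc w) <= normc z ^+ 2.
Proof.
rewrite normc_sqr mulr_natl mulr2n ReB ReD; case: z => a b; case: w => c d /=.
have := sqr_ge0 (a - c); have := sqr_ge0 (b - d); nra.
Qed.

(** Let [q] be the partial sum with coefficients [tcoef f]. The mean of the real part of
    [2 * (f * conjc q) - q * conjc q] is the sum of squares, and pointwise it is at most
    [normc f ^+ 2], because [normc (f - q) ^+ 2 >= 0]. *)
Theorem bessel f N : circle_cont f 1 ->
  \sum_(k < N) normc (tcoef f k) ^+ 2 <= rmean (fun w => normc (f w) ^+ 2) 1.
Proof.
move=> fc; set c := tcoef f.
have SE : \sum_(k < N) conjc (c k) * c k = (\sum_(k < N) normc (c k) ^+ 2)%:C.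
  by rewrite rmorph_sum; apply: eq_bigr => k _; rewrite mulrC mulrJ.
have hf : circle_cont (fun w => f w * psum_conj c N w) 1.
  by apply: circle_contM => //; exact: psum_conj_cont.
have h2f : circle_cont (fun w => 2 * (f w * psum_conj c N w)) 1.
  by apply: circle_contM => //; exact: circle_cont_cst.
have hq : circle_cont (fun w => psum c N w * psum_conj c N w) 1.
  by apply: circle_contM; [exact: psum_circle_cont|exact: psum_conj_cont].
have hc : circle_cont (fun w => 2 * (f w * psum_conj c N w) - psum c N w * psum_conj c N w) 1.
  exact: circle_contB.
have <- : complex.Re (cmean (fun w => 2 * (f w * psum_conj c N w) -
    psum c N w * psum_conj c N w) 1) = \sum_(k < N) normc (c k) ^+ 2.
  rewrite cmeanB // cmeanZ // !cmean_mul_conj //; last exact: psum_circle_cont.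
  rewrite (eq_bigr (fun k : 'I_N => conjc (c k) * c k)) //; last first.
  rewrite [X in _ - X](eq_bigr (fun k : 'I_N => conjc (c k) * c k)); last first.
    by move=> k _; rewrite tcoef_psum ltn_ord.
  by rewrite SE mulr2n mulrDl mul1r addrK.
rewrite Re_cmean; apply: rmean_le => //; [exact: rcirc_Re|exact: rcirc_normc2|].
by move=> w w1; rewrite -psum_conjE //; exact: Re_mul_conj_le.
Qed.

End Parseval.

(** * Functions with square summable coefficients and their dilations *)

Section SquareSummable.
Variable R : realType.
Implicit Types (f g : R[i] -> R[i]) (c d : nat -> R[i]) (z w : R[i]) (r s E K e : R).

Lemma rmean_dil (g : R[i] -> R) r s : rmean (fun w => g (s%:C * w)) r = rmean g (s * r).
Proof.
by congr (_ * _); apply: RI_eq => t _; rewrite mulrA rmorphM.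
Qed.

Lemma has_ps_dil K c g s : 0 <= s <= 1 -> has_ps K c g ->
  has_ps K (fun k => c k * s%:C ^+ k) (fun w => g (s%:C * w)).
Proof.
move=> /andP[s0 s1] hg; have K0 := has_ps_ge0 hg; case: hg => cK hg; split.
  move=> k; rewrite normcM normcX normc_real ger0_norm //.
  by rewrite (le_trans _ (cK k)) // ler_piMr ?normc_ge0 // exprn_ile1.
move=> z N z1; have sz : normc (s%:C * z) <= normc z.
  by rewrite normcM normc_real ger0_norm // ler_piMl ?normc_ge0.
have -> : psum (fun k => c k * s%:C ^+ k) N z = psum c N (s%:C * z).
  by apply: eq_bigr => k _; rewrite exprMn mulrA.
rewrite (le_trans (hg _ N _)) //; first exact: le_lt_trans sz z1.
rewrite ler_pM ?mulr_ge0 ?exprn_ge0 ?normc_ge0 ?invr_ge0 ?subr_ge0 //.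
- by rewrite (le_trans sz) // ltW.
- by rewrite ler_wpM2l // lerXn2r ?nnegrE ?normc_ge0.
- rewrite lef_pV2 ?posrE; lra.
Qed.

Lemma psum_scale c N s w : psum (fun k => c k * s%:C ^+ k) N w = psum c N (s%:C * w).
Proof. by apply: eq_bigr => k _; rewrite exprMn mulrA. Qed.

Lemma has_psD K M c d f g : has_ps K c f -> has_ps M d g ->
  has_ps (K + M) (fun k => c k + d k) (fun w => f w + g w).
Proof.
move=> [cK hf] [dM hg]; split=> [k|z N z1].
  by rewrite (le_trans (le_normcD _ _)) // lerD.
have -> : psum (fun k => c k + d k) N z = psum c N z + psum d N z.
  by rewrite /psum -big_split; apply: eq_bigr => k _; rewrite mulrDl.
rewrite (_ : _ - _ = (f z - psum c N z) + (g z - psum d N z)); last by ring.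
rewrite (le_trans (le_normcD _ _)) // !mulrDl lerD //; [exact: hf|exact: hg].
Qed.

Lemma has_psZ K c f (k : R[i]) : has_ps K c f ->
  has_ps (normc k * K) (fun n => k * c n) (fun w => k * f w).
Proof.
move=> [cK hf]; split=> [n|z N z1].
  by rewrite normcM ler_wpM2l ?normc_ge0.
have -> : psum (fun n => k * c n) N z = k * psum c N z.
  by rewrite /psum mulr_sumr; apply: eq_bigr => i _; rewrite mulrA.
by rewrite -mulrBr normcM -!mulrA ler_wpM2l ?normc_ge0 // mulrA hf.
Qed.

Lemma has_psB K M c d f g : has_ps K c f -> has_ps M d g ->
  has_ps (K + M) (fun k => c k - d k) (fun w => f w - g w).
Proof.
move=> hf /(has_psZ (-1)); rewrite normcN normc1 mul1r => /(has_psD hf).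
by congr has_ps; apply/funext => ?; rewrite mulN1r.
Qed.

Lemma has_ps_circle K c g r : has_ps K c g -> r < 1 -> circle_cont g r.
Proof.
by move=> hg r1 z zr; apply/cderivable_cont/(has_ps_cderivable hg); rewrite zr.
Qed.

Definition sq_bound c E := forall N, \sum_(k < N) normc (c k) ^+ 2 <= E.

Lemma sq_bound_ge0 c E : sq_bound c E -> 0 <= E.
Proof. by move=> /(_ 0%N); rewrite big_ord0. Qed.

Lemma sq_bound_coef c E k : sq_bound c E -> normc (c k) <= Num.sqrt E.
Proof.
move=> hE; rewrite -(ler_pXn2r (n := 2)) ?nnegrE ?normc_ge0 ?sqrtr_ge0 //.
rewrite sqr_sqrtr ?(sq_bound_ge0 hE) //; apply: le_trans (hE k.+1).
by rewrite big_ord_recr /= lerDr sumr_ge0 // => i _; exact: sqr_ge0.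
Qed.

(** Carries Parseval's bound from polynomials to uniform limits on a circle; an a priori bound is
    asked of the limit only. *)
Lemma sq_mean_approx f r B E : 0 <= r -> circle_cont f r ->
  (forall w, normc w = r -> normc (f w) <= B) ->
  (forall e, 0 < e -> exists q, [/\ circle_cont q r,
     rmean (fun w => normc (q w) ^+ 2) r <= E &
     forall w, normc w = r -> normc (f w - q w) <= e]) ->
  rmean (fun w => normc (f w) ^+ 2) r <= E.
Proof.
move=> r0 fc fB hq; apply/ler_addgt0Pr => e e0.
have B0 : 0 <= B.
  apply: le_trans (fB (r%:C) _); first exact: normc_ge0.
  by rewrite normc_real ger0_norm.
(* With [x <= y + h], [y <= B + h] and [h <= 1], one gets [x ^+ 2 <= y ^+ 2 + h * (2 * B + 3)]. *)
have hB : 0 < 2 * B + 3 by lra.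
have [h [h0 h1 he]] : exists h, [/\ 0 < h, h <= 1 & h * (2 * B + 3) <= e].
  exists (Num.min 1 (e / (2 * B + 3))).
  rewrite lt_min ltr01 divr_gt0 // ge_min lexx; split => //.
  by rewrite -ler_pdivlMr // ge_min lexx orbT.
have [q [qc qE close]] := hq h h0.
apply: (@le_trans _ _ (rmean (fun w => normc (q w) ^+ 2 + e) r)).
  apply: rmean_le => //; first exact: rcirc_normc2.
    by apply: rcircD; [exact: rcirc_normc2|exact: rcirc_cst].
  move=> w wr; have := close w wr; have := fB w wr.
  have := le_normc_sub (f w) (q w).
  have : normc (q w) <= normc (f w - q w) + normc (f w).
    by rewrite normcB_sym le_normc_sub.
  have := normc_ge0 (f w); have := normc_ge0 (q w).
  set x := normc (f w); set y := normc (q w); set t := normc _.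
  move=> y0 x0 a b fb tb.
  have yB : y <= B + h by lra.
  have xy : x <= y + h by lra.
  have : x ^+ 2 <= (y + h) ^+ 2 by rewrite lerXn2r // nnegrE; lra.
  have : y * h <= (B + h) * h by rewrite ler_wpM2r // ltW.
  have : h * h <= h by rewrite ger_pMr.
  rewrite !expr2; lra.
rewrite rmeanD; [|exact: rcirc_normc2|exact: rcirc_cst].
by rewrite rmean_cst lerD2r.
Qed.

Lemma parseval_radius c N r :
  rmean (fun w => normc (psum c N w) ^+ 2) r =
  \sum_(k < N) normc (c k * r%:C ^+ k) ^+ 2.
Proof.
rewrite -[r in LHS]mulr1 -rmean_dil.
rewrite (rmean_eq (h := fun w => normc (psum (fun k => c k * r%:C ^+ k) N w) ^+ 2)) //.
  by rewrite parseval.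
by move=> w _; rewrite psum_scale.
Qed.

Lemma normc_scale_le c k r : 0 <= r <= 1 -> normc (c k * r%:C ^+ k) <= normc (c k).
Proof.
move=> /andP[r0 r1]; rewrite normcM normcX normc_real ger0_norm //.
by rewrite ler_piMr ?normc_ge0 // exprn_ile1.
Qed.

Lemma sq_mean_le K c g r E : has_ps K c g -> sq_bound c E -> 0 <= r < 1 ->
  rmean (fun w => normc (g w) ^+ 2) r <= E.
Proof.
move=> hg hE /andP[r0 r1].
apply: (@sq_mean_approx _ _ (K / (1 - r))) => //; first exact: has_ps_circle hg r1.
  by move=> w wr; rewrite (le_trans (has_ps_bound hg _)) ?wr.
move=> e e0.
have [|N /(_ N (leqnn N)) hN] := @geometric_small _ r (K / (1 - r)) e _ e0.
  by rewrite r0.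
exists (psum c N); split; first exact: psum_circle_cont.
  rewrite parseval_radius; apply: le_trans (hE N); apply: ler_sum => k _.
  by rewrite lerXn2r ?nnegrE ?normc_ge0 // normc_scale_le // r0 ltW.
move=> w wr; rewrite (le_trans (hg.2 _ N _)) ?wr //.
by rewrite mulrAC ltW.
Qed.

Lemma one_sub_expr_le s k : 0 <= s <= 1 -> 1 - s ^+ k <= k%:R * (1 - s).
Proof.
move=> /andP[s0 s1]; elim: k => [|k IH]; first by rewrite expr0 subrr mul0r.
have sk : 0 <= s ^+ k <= 1 by rewrite exprn_ge0 // exprn_ile1.
rewrite exprS -natr1; nra.
Qed.

(** At some index the partial sums are within [e] of their supremum; later terms cannot add more
    than that. *)
Lemma sq_tail c E e : sq_bound c E -> 0 < e ->
  exists N0, forall N, \sum_(N0 <= k < N) normc (c k) ^+ 2 <= e.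
Proof.
move=> hE e0; pose S N := \sum_(0 <= k < N) normc (c k) ^+ 2.
have Sle N : S N <= E by rewrite /S big_mkord.
have hs : has_sup (range S).
  by split; [exists (S 0%N), 0%N|exists E => _ [N _ <-]].
have [_ [N0 _ <-] hN0] := sup_adherent e0 hs.
exists N0 => N; have [N0N|NN0] := leqP N0 N; last first.
  by rewrite big_geq ?ltW // ltnW.
have : S N <= sup (range S) by apply: sup_upper_bound => //; exists N.
by rewrite /S (big_cat_nat (n := N0)) //= -/(S N0); lra.
Qed.

(** Before [N0] a coefficient is multiplied by [1 - s ^+ k <= k%:R * (1 - s)], small for [s] near 1;
    from [N0] on the sum is already small, and the multipliers are at most 1. *)
Lemma sq_bound_dil c E e : sq_bound c E -> 0 < e ->
  exists2 s0 : R, 0 <= s0 < 1 & forall s, s0 <= s < 1 ->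
    sq_bound (fun k => c k - c k * s%:C ^+ k) e.
Proof.
move=> hE e0; have e20 : 0 < e / 2 by rewrite divr_gt0.
have E0 := sq_bound_ge0 hE.
have [N0 hN0] := sq_tail hE e20.
pose m : R := N0%:R + 1.
have m1 : 1 <= m by rewrite lerDr.
(* The bound [dl <= 1] allows one factor [dl] of [(m * dl) ^+ 2] to be dropped. *)
pose dl := Num.min 1 (e / 2 / ((E + 1) * m ^+ 2)).
have Em : 0 < (E + 1) * m ^+ 2.
  by rewrite mulr_gt0 ?exprn_gt0 //; lra.
have dl0 : 0 < dl by rewrite lt_min ltr01 divr_gt0.
have dl1 : dl <= 1 by rewrite ge_min lexx.
have dle : dl * ((E + 1) * m ^+ 2) <= e / 2 by rewrite -ler_pdivlMr // ge_min lexx orbT.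
exists (1 - dl); first by apply/andP; split; lra.
move=> s /andP[s1 s2]; have s0 : 0 <= s by lra.
have h1 k : normc (c k - c k * s%:C ^+ k) ^+ 2 <= normc (c k) ^+ 2.
  rewrite lerXn2r ?nnegrE ?normc_ge0 //.
  rewrite (_ : _ - _ = c k * (1 - s ^+ k)%:C); last by rewrite rmorphB rmorphXn /=; ring.
  have sk : 0 <= s ^+ k <= 1 by rewrite exprn_ge0 // exprn_ile1 // ltW.
  rewrite normcM normc_real ger0_norm ?ler_piMr ?normc_ge0 //; lra.
have h2 k : (k < N0)%N -> normc (c k - c k * s%:C ^+ k) ^+ 2 <=
    normc (c k) ^+ 2 * (dl * m ^+ 2).
  move=> kN.
  rewrite (_ : _ - _ = c k * (1 - s ^+ k)%:C); last by rewrite rmorphB rmorphXn /=; ring.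
  have sk : 0 <= s ^+ k <= 1 by rewrite exprn_ge0 // exprn_ile1 // ltW.
  rewrite normcM normc_real ger0_norm ?exprMn ?ler_wpM2l ?sqr_ge0 //; last lra.
  have h : 1 - s ^+ k <= m * dl.
    rewrite (le_trans (one_sub_expr_le k _)) //; first by rewrite s0 ltW.
    apply: ler_pM; rewrite ?subr_ge0 ?(ltW s2) //; last lra.
    by rewrite (le_trans (_ : _ <= N0%:R)) ?ler_nat ?(ltnW kN) // lerDl.
  have : (1 - s ^+ k) ^+ 2 <= (m * dl) ^+ 2.
    rewrite lerXn2r // nnegrE; last by rewrite mulr_ge0 //; lra.
    lra.
  move=> h'; rewrite (le_trans h') // exprMn mulrC ler_wpM2r ?sqr_ge0 //.
  by rewrite expr2 ger_pMr.
move=> N; rewrite -(big_mkord xpredT (fun k => normc (c k - c k * s%:C ^+ k) ^+ 2)).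
have [NN0|N0N] := leqP N N0.
  apply: (@le_trans _ _ (\sum_(0 <= k < N) normc (c k) ^+ 2 * (dl * m ^+ 2))).
    by apply: ler_sum_nat => k /andP[_ kN]; apply: h2; exact: leq_trans NN0.
  rewrite -mulr_suml big_mkord.
  have := hE N; set S := \sum_(_ < _) _ => SE.
  have : S * (dl * m ^+ 2) <= (E + 1) * (dl * m ^+ 2).
    by rewrite ler_wpM2r ?mulr_ge0 ?sqr_ge0 ?(ltW dl0) //; lra.
  lra.
rewrite (big_cat_nat (n := N0)) //= ?(ltnW N0N) // (splitr e) lerD //; last first.
  by rewrite (le_trans _ (hN0 N)) //; apply: ler_sum => k _.
apply: (@le_trans _ _ (\sum_(0 <= k < N0) normc (c k) ^+ 2 * (dl * m ^+ 2))).
  by apply: ler_sum_nat => k /andP[_ kN]; exact: h2.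
rewrite -mulr_suml big_mkord.
have := hE N0; set S := \sum_(_ < _) _ => SE.
have : S * (dl * m ^+ 2) <= (E + 1) * (dl * m ^+ 2).
  by rewrite ler_wpM2r ?mulr_ge0 ?sqr_ge0 ?(ltW dl0) //; lra.
lra.
Qed.

(** The threshold [s0] comes from the coefficients alone, so it serves all radii [r] at once. *)
Theorem sq_dilation K c g E e : has_ps K c g -> sq_bound c E -> 0 < e ->
  exists2 s0 : R, 0 <= s0 < 1 & forall s r, s0 <= s < 1 -> 0 <= r < 1 ->
    rmean (fun w => normc (g w - g (s%:C * w)) ^+ 2) r <= e.
Proof.
move=> hg hE e0; have [s0 s01 hs] := sq_bound_dil hE e0.
exists s0 => // s r ss r01; have s01' : 0 <= s <= 1.
  by move: ss s01 => /andP[? ?] /andP[? ?]; apply/andP; split; lra.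
apply: (sq_mean_le (has_psB hg (has_ps_dil s01' hg))) => //.
exact: hs.
Qed.

End SquareSummable.

(** * Ultralimits *)

Section UltraLimits.
Variable R : realType.
Variables (U : set_system nat) (UU : UltraFilter U).
Implicit Types (x y : nat -> R[i]) (l m : R[i]) (M e : R).

Lemma ultra_proper : ProperFilter U. Proof. by case: UU. Qed.
#[local] Existing Instance ultra_proper.

(** The limit is the supremum of the [a] that are below [u] on a set of [U]; beyond it, the
    complementary set belongs to [U]. *)
Lemma ultra_real_lim (u : nat -> R) M : (forall j, `|u j| <= M) ->
  exists l : R, forall e, 0 < e -> U [set j | `|u j - l| <= e].
Proof.
move=> uM; pose S := [set a | U [set j | a <= u j]].
have hs : has_sup S.
  split.
    exists (- M); rewrite /S /=; apply: filterS filterT => j _ /=.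
    by have := uM j; rewrite ler_norml => /andP[].
  exists M => a /filter_ex[j /=] /le_trans; apply.
  exact: le_trans (ler_norm _) (uM j).
exists (sup S) => e e0.
have [a Sa ha] := sup_adherent e0 hs.
have nS : ~ S (sup S + e).
  by move=> h; have := sup_upper_bound hs h; lra.
have [//|nU] := @in_ultra_setVsetC _ U [set j | sup S + e <= u j] UU.
apply: filterS (filterI Sa nU) => j [/= h1 /negP]; rewrite -ltNge => h2.
by rewrite ler_norml; apply/andP; split; lra.
Qed.

Definition ucvg x l := forall e, 0 < e -> U [set j | normc (x j - l) <= e].

Lemma ucvg_bounded x M : (forall j, normc (x j) <= M) -> exists l, ucvg x l.
Proof.
move=> xM.
have [|a ha] := @ultra_real_lim (fun j => complex.Re (x j)) M.
  by move=> j; exact: le_trans (normr_Re_le _) (xM j).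
have [|b hb] := @ultra_real_lim (fun j => complex.Im (x j)) M.
  by move=> j; exact: le_trans (normr_Im_le _) (xM j).
exists (a +i* b) => e e0; have e20 : 0 < e / 2 by rewrite divr_gt0.
apply: filterS (filterI (ha _ e20) (hb _ e20)) => j [/= h1 h2].
rewrite (le_trans (normc_le_ReIm _)) // ReB ImB /= (splitr e).
exact: lerD.
Qed.

Lemma ucvg_close x l M z : ucvg x l -> (forall j, normc (x j - z) <= M) ->
  normc (l - z) <= M.
Proof.
move=> xl xM; apply/ler_addgt0Pr => e /xl/filter_ex[j /= hj].
rewrite (_ : l - z = (x j - z) - (x j - l)); last by ring.
by rewrite (le_trans (le_normcB _ _)) // lerD.
Qed.

Lemma ucvg_unique x l m : ucvg x l -> ucvg x m -> l = m.
Proof.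
move=> xl xm; apply: complex_eqP => e e0; have e20 : 0 < e / 2 by rewrite divr_gt0.
have [j [/= h1 h2]] := filter_ex (filterI (xl _ e20) (xm _ e20)).
rewrite (_ : l - m = (x j - m) - (x j - l)); last by ring.
by rewrite (le_trans (le_normcB _ _)) // (splitr e) lerD.
Qed.

Lemma ucvgD x y l m : ucvg x l -> ucvg y m -> ucvg (fun j => x j + y j) (l + m).
Proof.
move=> xl ym e e0; have e20 : 0 < e / 2 by rewrite divr_gt0.
apply: filterS (filterI (xl _ e20) (ym _ e20)) => j [/= h1 h2].
rewrite (_ : _ - _ = (x j - l) + (y j - m)); last by ring.
by rewrite (le_trans (le_normcD _ _)) // (splitr e) lerD.
Qed.

Lemma ucvgM x y l m : ucvg x l -> ucvg y m -> ucvg (fun j => x j * y j) (l * m).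
Proof.
move=> xl ym e e0; pose k := 1 + normc l + normc m.
have nl := normc_ge0 l; have nm := normc_ge0 m.
have k0 : 0 < k by rewrite /k; lra.
have [d [d0 d1 de]] : exists d, [/\ 0 < d, d <= 1 & d * k <= e].
  exists (Num.min 1 (e / k)); rewrite lt_min ltr01 divr_gt0 // !ge_min lexx; split => //.
  by rewrite -ler_pdivlMr // ge_min lexx orbT.
apply: filterS (filterI (xl _ d0) (ym _ d0)) => j [/= h1 h2].
rewrite (_ : _ - _ = (x j - l) * (y j - m) + ((x j - l) * m + l * (y j - m))); last by ring.
rewrite (le_trans (le_normcD _ _)) //.
have := le_normcD ((x j - l) * m) (l * (y j - m)); rewrite !normcM.
have := normc_ge0 (x j - l); have := normc_ge0 (y j - m).
move: de; rewrite /k; nra.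
Qed.

Lemma ucvg_cst l : ucvg (fun=> l) l.
Proof.
by move=> e e0; apply: filterS filterT => j _ /=; rewrite subrr normc0 ltW.
Qed.

Lemma ucvgX x l n : ucvg x l -> ucvg (fun j => x j ^+ n) (l ^+ n).
Proof.
move=> xl; elim: n => [|n IH]; first exact: ucvg_cst.
by under eq_fun do rewrite exprS; rewrite exprS; exact: ucvgM.
Qed.

Lemma ucvg_psum (c : nat -> nat -> R[i]) d N z : (forall k, ucvg (fun j => c j k) (d k)) ->
  ucvg (fun j => psum (c j) N z) (psum d N z).
Proof.
move=> cd; elim: N => [|N IH].
  by rewrite /psum big_ord0; under eq_fun do rewrite big_ord0; exact: ucvg_cst.
rewrite psumS; under eq_fun do rewrite psumS.
by apply: ucvgD => //; apply: ucvgM => //; exact: ucvg_cst.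
Qed.

Lemma ucvg_sum_sq (c : nat -> nat -> R[i]) d N e : (forall k, ucvg (fun j => c j k) (d k)) ->
  0 < e -> U [set j | \sum_(k < N) normc (d k) ^+ 2 <= \sum_(k < N) normc (c j k) ^+ 2 + e].
Proof.
move=> cd; elim: N e => [|N IH] e e0.
  by apply: filterS filterT => j _ /=; rewrite !big_ord0 add0r ltW.
have e20 : 0 < e / 2 by rewrite divr_gt0.
pose k := 2 * normc (d N) + 1.
have k0 : 0 < k by rewrite ltr_wpDl // mulr_ge0 ?normc_ge0.
apply: filterS (filterI (IH _ e20) (cd N _ (divr_gt0 e20 k0))) => j [/= h1 h2].
rewrite !big_ord_recr /=; move: h2; rewrite ler_pdivlMr //.
have := le_normc_sub (d N) (c j N); rewrite normcB_sym.
have := normc_ge0 (c j N - d N); have := normc_ge0 (c j N); have := normc_ge0 (d N).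
rewrite /k; set a := normc (d N); set b := normc (c j N); set t := normc _.
move=> a0 b0 t0 ab tk.
have : a ^+ 2 <= b ^+ 2 + 2 * a * t by have [|] := leP a t; nra.
lra.
Qed.

Lemma three_term (a b d z : R[i]) : a - z = (a - b) + (b - d) - (z - d).
Proof. ring. Qed.

(** The common bound [Num.sqrt E] on all coefficients makes the tails small uniformly in [j], so
    coefficientwise limits along [U] yield pointwise limits in the disk. *)
Theorem sq_limit (E : R) (c : nat -> nat -> R[i]) (g : nat -> R[i] -> R[i]) :
  (forall j, sq_bound (c j) E) -> (forall j, exists K, has_ps K (c j) (g j)) ->
  exists d h, [/\ sq_bound d E, has_ps (Num.sqrt E) d h &
    forall z, normc z < 1 -> ucvg (fun j => g j z) (h z)].
Proof.
move=> cE cg.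
have cb j k : normc (c j k) <= Num.sqrt E by exact: sq_bound_coef (cE j).
have gps j : has_ps (Num.sqrt E) (c j) (g j).
  by have [K hK] := cg j; exact: has_ps_improve hK.
have /(_ _)/cid-/all_sig[d hd] k := ucvg_bounded (fun j => cb j k).
have dE : sq_bound d E.
  move=> N; apply/ler_addgt0Pr => e e0.
  have /filter_ex[j /= hj] := ucvg_sum_sq N hd e0.
  by rewrite (le_trans hj) // lerD2r; exact: cE.
have db k : normc (d k) <= Num.sqrt E by exact: sq_bound_coef dE.
exists d, (PS d); split=> //; first exact: PS_has_ps.
move=> z z1 e e0; have e30 : 0 < e / 3 by rewrite divr_gt0.
have [|N /(_ N (leqnn N)) hN] := @geometric_small _ (normc z) (Num.sqrt E / (1 - normc z)) _ _ e30.
  by rewrite normc_ge0.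
apply: filterS (ucvg_psum N z hd e30) => j /= hj.
have h1 : normc (g j z - psum (c j) N z) <= e / 3.
  by rewrite (le_trans ((gps j).2 _ N z1)) // mulrAC ltW.
have h2 : normc (PS d z - psum d N z) <= e / 3.
  by rewrite (le_trans ((PS_has_ps db).2 _ N z1)) // mulrAC ltW.
rewrite (three_term _ (psum (c j) N z) (psum d N z)).
rewrite (le_trans (le_normcB _ _)) // (_ : e = e / 3 + e / 3 + e / 3); last by lra.
by rewrite lerD // (le_trans (le_normcD _ _)) // lerD.
Qed.

End UltraLimits.

(** * Majorants and factorization in H^p *)

Section PolynomialApproximation.
Variable R : realType.
Implicit Types (f : R[i] -> R[i]) (c : nat -> R[i]) (z w : R[i]) (r e rho : R).

Lemma unit_polar w : normc w = 1 -> exists2 t : R, - pi <= t <= pi & w = expi t.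
Proof.
move=> w1; have := normc_sqr w; rewrite w1 expr1n; case: w w1 => a b /= w1 ab.
have a1 : -1 <= a <= 1.
  by have b2 := sqr_ge0 b; apply/andP; split; nra.
have sab : Num.sqrt (1 - a ^+ 2) = `|b|.
  by rewrite ab addrAC subrr add0r sqrtr_sqr.
have ac := acosK; have [/andP[t0 tpi] ct] := acos_def a1.
have pi0 := pi_ge0 R.
have [b0|b0] := leP 0 b.
  exists (acos a); first by apply/andP; split; lra.
  by rewrite /expi ct sin_acos // sab ger0_norm.
exists (- acos a); first by apply/andP; split; lra.
by rewrite /expi cosN sinN ct sin_acos // sab ltr0_norm // opprK.
Qed.

Lemma circle_bounded f r : 0 < r -> circle_cont f r ->
  exists M, forall w, normc w = r -> normc (f w) <= M.
Proof.
move=> r0 fc; have pipi : - pi <= pi :> R by have := pi_ge0 R; lra.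
have [|t _ ht] := @EVT_max R (fun t => normc (f (r%:C * expi t))) _ _ pipi.
  by apply: continuous_subspaceT; exact: (rcirc_normc (ltW r0) fc).
exists (normc (f (r%:C * expi t))) => w wr.
have rC0 : r%:C != 0 :> R[i] by rewrite -normc_gt0 normc_real gtr0_norm.
have [|s sp ws] := @unit_polar (w / r%:C).
  by rewrite normcM normcV normc_real gtr0_norm // wr divff // gt_eqF.
have -> : w = r%:C * expi s by rewrite -ws mulrCA divff // mulr1.
by apply: ht; rewrite in_itv.
Qed.

Lemma cderivable_dil f (s : R) z : cderivable f (s%:C * z) ->
  cderivable (fun w => f (s%:C * w)) z.
Proof.
move=> [l hl].
have hg : cderiv (fun w => s%:C * w) z (0 * z + s%:C * 1).
  exact: cderivM (cderiv_cst _ _) (cderiv_id z).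
by eexists; exact: (cderiv_comp hg hl).
Qed.

(** The Taylor remainder estimate, which lives on the open unit disk, is applied to [f (tau * w)]
    with [1 < tau < rho] and evaluated at [w / tau]; the closed disk then lies at distance from the
    circle. *)
Theorem poly_approx f rho e : 1 < rho -> (forall w, normc w < rho -> cderivable f w) ->
  0 < e -> exists c N, forall w, normc w <= 1 -> normc (f w - psum c N w) <= e.
Proof.
move=> rho1 hf e0; pose tau := (1 + rho) / 2.
have tau1 : 1 < tau by rewrite /tau; lra.
have taur : tau < rho by rewrite /tau; lra.
have tau0 : 0 < tau by lra.
have tC0 : tau%:C != 0 :> R[i] by rewrite -normc_gt0 normc_real gtr0_norm.
pose g w := f (tau%:C * w).
have hg w : normc w < rho / tau -> cderivable g w.
  rewrite ltr_pdivlMr // => wr; apply: cderivable_dil; apply: hf.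
  by rewrite normcM normc_real gtr0_norm // mulrC.
have rt1 : 1 < rho / tau by rewrite ltr_pdivlMr // mul1r.
have [M hM] : exists M, forall w, normc w = 1 -> normc (g w) <= M.
  apply: circle_bounded => // w w1; apply: cderivable_cont; apply: hg.
  by rewrite w1.
have M0 : 0 <= M by apply: le_trans (hM 1 _); rewrite ?normc_ge0 ?normc1.
pose x := tau^-1.
have x1 : x < 1 by rewrite invf_lt1.
have x0 : 0 < x by rewrite invr_gt0.
have [|N /(_ N (leqnn N)) hN] := @geometric_small _ x (M / (1 - x)) e _ e0.
  by rewrite ltW.
exists (fun k => tcoef g k * x%:C ^+ k), N => w w1.
have xw : normc (x%:C * w) <= x.
  by rewrite normcM normc_real gtr0_norm // ger_pMr.
have := taylor_remainder (z := x%:C * w) N rt1 hg hM (le_lt_trans xw x1).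
have -> : g (x%:C * w) = f w.
  by rewrite /g mulrA -rmorphM /x divff ?gt_eqF // rmorph1 mul1r.
have -> : \sum_(k < N) tcoef g k * (x%:C * w) ^+ k = psum (fun k => tcoef g k * x%:C ^+ k) N w.
  by apply: eq_bigr => k _; rewrite exprMn mulrA.
move=> /le_trans; apply; apply: le_trans (ltW hN).
rewrite mulrAC -mulrA -[leRHS]mulrA; apply: ler_wpM2l => //.
rewrite ler_pM ?invr_ge0 ?exprn_ge0 ?normc_ge0 //; first lra.
  by rewrite lef_pV2 ?posrE; lra.
by rewrite lerXn2r // nnegrE ?normc_ge0 // ltW.
Qed.

End PolynomialApproximation.

(** * Real parts of polynomials as an algebra on the unit circle *)

Section RealPartsOfPolynomials.
Variable R : realType.
Implicit Types (u v : R[i] -> R) (w a b : R[i]).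

(** On the unit circle these are the real trigonometric polynomials. Written as real parts, they
    become logarithms of moduli of analytic functions [cexp P] without zeros. *)
Definition RePoly u := exists P : {poly R[i]}, forall w, normc w = 1 -> u w = complex.Re P.[w].

Lemma RePoly_cst (k : R) : RePoly (fun=> k).
Proof. by exists (k%:C)%:P => w _; rewrite hornerC. Qed.

Lemma RePolyD u v : RePoly u -> RePoly v -> RePoly (fun w => u w + v w).
Proof. by move=> [P hP] [Q hQ]; exists (P + Q) => w w1; rewrite hornerD ReD hP ?hQ. Qed.

Lemma RePoly_ext u v : (forall w, normc w = 1 -> u w = v w) -> RePoly u -> RePoly v.
Proof. by move=> uv [P hP]; exists P => w w1; rewrite -uv ?hP. Qed.

Lemma RePoly_monomial a n : RePoly (fun w => complex.Re (a * w ^+ n)).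
Proof. by exists (a *: 'X^n) => w _; rewrite hornerZ hornerXn. Qed.

Lemma RePoly_sum (I : Type) (s : seq I) (F : I -> R[i] -> R) :
  (forall i, RePoly (F i)) -> RePoly (fun w => \sum_(i <- s) F i w).
Proof.
move=> hF; elim: s => [|i s IH].
  by apply: RePoly_ext (RePoly_cst 0) => w _; rewrite big_nil.
by apply: RePoly_ext (RePolyD (hF i) IH) => w _; rewrite big_cons.
Qed.

Lemma ReJ w : complex.Re (conjc w) = complex.Re w. Proof. by case: w. Qed.

(** On the circle [w * conjc w = 1] cancels the smaller exponent; if a power of [conjc w] is left,
    conjugation does not change the real part. *)
Lemma RePoly_monomialJ a j k : RePoly (fun w => complex.Re (a * w ^+ j * conjc w ^+ k)).
Proof.
have wJ w : normc w = 1 -> w * conjc w = 1 by move=> w1; rewrite mulrJ w1 expr1n.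
have [kj|/ltnW jk] := leqP k j.
- apply: RePoly_ext (RePoly_monomial a (j - k)) => w w1.
  rewrite -{2}(subnK kj) exprD -mulrA -(mulrA (w ^+ (j - k))) -exprMn wJ //.
  by rewrite expr1n mulr1.
- apply: RePoly_ext (RePoly_monomial (conjc a) (k - j)) => w w1.
  rewrite -ReJ rmorphM /= conjcK rmorphXn /=.
  rewrite -{2}(subnK jk) addnC exprD mulrA -(mulrA a) -exprMn wJ //.
  by rewrite expr1n mulr1.
Qed.

Lemma ReM_half a b : complex.Re a * complex.Re b =
  2^-1 * (complex.Re (a * b) + complex.Re (a * conjc b)).
Proof. by case: a => a1 a2; case: b => b1 b2 /=; field. Qed.

Lemma RePolyZ (k : R) u : RePoly u -> RePoly (fun w => k * u w).
Proof.
move=> [P hP]; exists (k%:C *: P) => w w1.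
by rewrite hornerZ ReM /= mul0r subr0 hP.
Qed.

Lemma Re_sum (I : Type) (s : seq I) (F : I -> R[i]) :
  complex.Re (\sum_(i <- s) F i) = \sum_(i <- s) complex.Re (F i).
Proof. by elim: s => [|i s IH]; rewrite ?big_nil // !big_cons ReD IH. Qed.

Lemma RePoly_mulJ (P Q : {poly R[i]}) : RePoly (fun w => complex.Re (P.[w] * conjc Q.[w])).
Proof.
apply: (@RePoly_ext (fun w => \sum_(j < size P) \sum_(k < size Q)
   complex.Re (P`_j * conjc Q`_k * w ^+ j * conjc w ^+ k))).
  move=> w _; rewrite !horner_coef rmorph_sum /= mulr_suml Re_sum.
  apply: eq_bigr => j _; rewrite mulr_sumr Re_sum; apply: eq_bigr => k _.
  by rewrite rmorphM rmorphXn /=; congr complex.Re; ring.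
by apply: RePoly_sum => j; apply: RePoly_sum => k; exact: RePoly_monomialJ.
Qed.

(** Twice the product of two real parts is the real part of [P * Q] plus that of [P * conjc Q]; the
    second is handled by [RePoly_mulJ]. *)
Lemma RePolyM u v : RePoly u -> RePoly v -> RePoly (fun w => u w * v w).
Proof.
move=> [P hP] [Q hQ].
apply: (@RePoly_ext (fun w => 2^-1 * (complex.Re (P * Q).[w] + complex.Re (P.[w] * conjc Q.[w])))).
  by move=> w w1; rewrite hornerM -ReM_half hP ?hQ.
by apply: RePolyZ; apply: RePolyD; [exists (P * Q)|exact: RePoly_mulJ].
Qed.

Lemma RePolyX u n : RePoly u -> RePoly (fun w => u w ^+ n).
Proof.
move=> hu; elim: n => [|n IH].
  by apply: RePoly_ext (RePoly_cst 1) => w _; rewrite expr0.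
by apply: RePoly_ext (RePolyM hu IH) => w _; rewrite exprS.
Qed.

Lemma RePoly_normc2 (c : nat -> R[i]) N : RePoly (fun w => normc (psum c N w) ^+ 2).
Proof.
pose P : {poly R[i]} := \poly_(k < N) c k.
apply: (@RePoly_ext (fun w => complex.Re (P.[w] * conjc P.[w]))); last exact: RePoly_mulJ.
move=> w _; rewrite mulrJ /=; congr (normc _ ^+ 2).
by rewrite horner_poly.
Qed.

Lemma cderivable_horner (P : {poly R[i]}) z : cderivable (fun w => P.[w]) z.
Proof.
elim/poly_ind: P => [|P c [l hl]].
  by exists 0; apply: (@cderiv_ext _ (fun=> 0) _ _ _ 1) (cderiv_cst _ _) => // w _; rewrite horner0.
have := cderivD (cderivM hl (cderiv_id z)) (cderiv_cst c z).
move=> h; eexists; apply: (cderiv_ext ltr01 _ h) => w _.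
by rewrite hornerD hornerMX hornerC.
Qed.

End RealPartsOfPolynomials.

(** * A polynomial whose exponential is comparable with the [p]-th power of the modulus *)

Section Majorant.
Variable R : realType.
Implicit Types (x y p : R).

(** The Taylor polynomial of degree [N] of [ln] at 1. *)
Definition logpoly N y : R := - \sum_(k < N) (1 - y) ^+ k.+1 / k.+1%:R.

Lemma is_derive_logpoly N y : is_derive y 1 (logpoly N) (\sum_(k < N) (1 - y) ^+ k).
Proof.
elim: N => [|N IH].
  rewrite big_ord0; have -> : logpoly 0 = cst 0 :> (R -> R).
    by apply/funext => x; rewrite /logpoly big_ord0 oppr0.
  exact: is_derive_cst.
have -> : logpoly N.+1 = logpoly N - (N.+1%:R^-1 \*: ((cst 1 - id) ^+ N.+1)) :> (R -> R).
  apply/funext => x; rewrite /logpoly big_ord_recr /= opprD; congr (_ + _).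
  by rewrite !fctE /= mulrC.
apply: is_derive_eq; rewrite big_ord_recr /= !fctE /GRing.scale /=.
congr (_ + _); rewrite sub0r mulrN mulrN opprK mulr1 mulrA mulVf ?mul1r //.
Qed.

(** By the geometric sum, [logpoly N - ln] has derivative exactly [- (1 - y) ^+ N / y], and it
    vanishes at 1; the mean value theorem gives both bounds. *)
Lemma logpoly_bounds N y : 0 < y <= 1 ->
  ln y <= logpoly N y <= ln y + (1 - y) ^+ N / y.
Proof.
have l1 : logpoly N 1 = 0.
  by rewrite /logpoly big1 ?oppr0 // => k _; rewrite subrr expr0n mul0r.
move=> /andP[y0]; rewrite le_eqVlt => /orP[/eqP ->|y1].
  by rewrite ln1 l1 lexx subrr add0r divr1 exprn_ge0.
pose D x := logpoly N x - ln x.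
pose dD x := \sum_(k < N) (1 - x) ^+ k - x^-1.
have hD x : 0 < x -> is_derive x 1 D (dD x).
  by move=> x0; apply: is_deriveB; [exact: is_derive_logpoly|exact: is_derive1_ln].
have dDE x : 0 < x -> dD x = - ((1 - x) ^+ N / x).
  move=> x0; rewrite /dD; have := subrX1 (1 - x) N.
  set S := \sum_(_ < _) _ => hS; have x0' : x != 0 by rewrite gt_eqF.
  apply: (mulIf x0'); rewrite mulrBl mulVf // mulNr divfK //.
  move: hS; lra.
have [| |xi] := @MVT _ D dD y 1 y1.
- by move=> x; rewrite in_itv /= => /andP[yx _]; apply: hD; exact: lt_trans yx.
- apply: continuous_in_subspaceT => x; rewrite inE /= in_itv /= => /andP[yx _].
  apply/differentiable_continuous/derivable1_diffP.
  by have [] := hD x (lt_le_trans y0 yx).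
rewrite in_itv /= => /andP[yxi xi1].
have xi0 := lt_trans y0 yxi.
rewrite dDE // {1}/D ln1 subr0 l1 sub0r mulNr => /oppr_inj; rewrite /D => e.
have h0 : 0 <= (1 - xi) ^+ N / xi by rewrite divr_ge0 ?exprn_ge0 //; lra.
have h1 : (1 - xi) ^+ N / xi <= (1 - y) ^+ N / y.
  rewrite ler_pM ?invr_ge0 ?exprn_ge0 //; try lra.
    by rewrite lerXn2r ?nnegrE //; lra.
  by rewrite lef_pV2 ?posrE //; lra.
have y1' : 0 <= 1 - y <= 1 by apply/andP; split; lra.
by apply/andP; split; move: e; nra.
Qed.

(** An error of 1 is good enough: after exponentiation it only costs the factor [expR (p / 2)] in
    [majorant]. *)
Lemma logpoly_approx (d : R) : 0 < d -> exists N, forall y, d <= y <= 1 ->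
  ln y <= logpoly N y <= ln y + 1.
Proof.
move=> d0; have [d1|d1] := leP d 1; last first.
  by exists 0%N => y /andP[a b]; lra.
have [||N /(_ N (leqnn N)) hN] := @geometric_small _ (1 - d) d^-1 1.
- by apply/andP; split; lra.
- exact: ltr01.
exists N => y /andP[dy y1]; have y0 : 0 < y by lra.
have := @logpoly_bounds N y; rewrite y0 y1 => /(_ isT)/andP[-> h] /=.
rewrite (le_trans h) // lerD2l (le_trans _ (ltW hN)) // mulrC.
rewrite ler_pM ?invr_ge0 ?exprn_ge0 ?(ltW y0) //; try lra.
  by rewrite lef_pV2 ?posrE.
by rewrite lerXn2r ?nnegrE //; lra.
Qed.

Lemma powR_ge0D x y p : 0 <= p -> 0 <= x -> 0 <= y ->
  (x + y) `^ p <= 2 `^ p * (x `^ p + y `^ p).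
Proof.
move=> p0; wlog xy : x y / x <= y => [hw|x0 y0].
  have [xy|/ltW yx] := leP x y; first exact: hw.
  by move=> x0 y0; rewrite addrC [x `^ p + _]addrC; exact: hw.
have h : (x + y) `^ p <= (2 * y) `^ p.
  by apply: ge0_ler_powR; rewrite ?nnegrE //; lra.
rewrite (le_trans h) // powRM // ler_wpM2l ?powR_ge0 // lerDr powR_ge0 //.
Qed.

Lemma powR_sq2 x p : 0 <= x -> (x ^+ 2) `^ (p / 2) = x `^ p.
Proof. by move=> x0; rewrite -powR_mulrn // -powRrM mulrC divfK. Qed.

Lemma sqr_le_dbl x y : 0 <= x -> x <= y + 1 -> x ^+ 2 <= 2 * (y ^+ 2 + 1).
Proof.
move=> x0 xy; have h : x ^+ 2 <= (y + 1) ^+ 2 by rewrite lerXn2r // nnegrE; lra.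
by have := sqr_ge0 (y - 1); rewrite sqrrB sqrrD !expr1n !mulr1 in h *; lra.
Qed.

Lemma dbl_le_sqr x y : 0 <= x -> 0 <= y -> y <= x + 1 ->
  2 * (y ^+ 2 + 1) <= (2 * (x + 1)) ^+ 2.
Proof.
move=> x0 y0 yx; have h : y ^+ 2 <= (x + 1) ^+ 2 by rewrite lerXn2r // nnegrE; lra.
by have := sqr_ge0 x; rewrite exprMn !sqrrD !expr1n !mulr1 in h *; lra.
Qed.

(** The real part of [P] approximates [p / 2 * ln (2 * (x w + 1))], where [x] is the squared modulus
    of a polynomial within distance 1 of [f]. The 1 added to [x] keeps the logarithm bounded near
    the zeros of [f]; it is paid for by the [+ 1] on the right. *)
Theorem majorant (f : R[i] -> R[i]) (rho p : R) : 0 < p -> 1 < rho ->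
  (forall w, normc w < rho -> cderivable f w) ->
  exists P : {poly R[i]}, forall w, normc w = 1 ->
    normc (f w) `^ p <= expR (complex.Re P.[w]) <=
    expR (p / 2) * 4 `^ p * (normc (f w) `^ p + 1).
Proof.
move=> p0 rho1 hf; have [c [M hM]] := poly_approx rho1 hf ltr01.
pose x w := normc (psum c M w) ^+ 2.
have [B hB] := circle_bounded ltr01 (psum_circle_cont c M (r := 1)).
have B0 : 0 <= B by apply: le_trans (hB 1 _); rewrite ?normc_ge0 ?normc1.
pose L := B ^+ 2 + 1.
have L0 : 0 < L by rewrite ltr_wpDl ?sqr_ge0.
(* Division by [L] brings the argument into the interval from [L^-1] to 1, where one truncation of
   the logarithm serves all [w]. *)
pose y w := (x w + 1) / L.
have x0 w : 0 <= x w by exact: sqr_ge0.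
have yb w : normc w = 1 -> L^-1 <= y w <= 1.
  move=> w1; have xB : x w <= B ^+ 2 by rewrite lerXn2r ?nnegrE ?normc_ge0 ?hB.
  rewrite /y ler_pdivrMr // mul1r lerD2r xB andbT.
  by rewrite ler_pdivlMr // mulVf ?gt_eqF // lerDr.
have L0' : 0 < L^-1 by rewrite invr_gt0.
have [N hN] := logpoly_approx L0'.
pose T w := p / 2 * (ln (2 * L) + logpoly N (y w)).
have [P hP] : RePoly T.
  apply: RePolyZ; apply: RePolyD; first exact: RePoly_cst.
  apply: (@RePoly_ext _ (fun w => -1 * \sum_(k < N) (k.+1%:R)^-1 * (1 + (- L^-1) * (x w + 1)) ^+ k.+1)).
    move=> w _; rewrite mulN1r /logpoly; congr (- _); apply: eq_bigr => k _.
    by rewrite mulrC /y; congr (_ ^+ _ / _); ring.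
  apply: RePolyZ; apply: RePoly_sum => k; apply: RePolyZ; apply: RePolyX.
  apply: RePolyD; first exact: RePoly_cst.
  apply: RePolyZ; apply: RePolyD; last exact: RePoly_cst.
  exact: RePoly_normc2.
exists P => w w1; rewrite -hP //.
have y0 : 0 < y w by rewrite divr_gt0 // ltr_wpDl.
have /andP[l1 l2] := hN _ (yb w w1).
have lnE : ln (2 * L) + ln (y w) = ln (2 * (x w + 1)).
  have -> : 2 * (x w + 1) = 2 * L * y w by rewrite /y; field; rewrite gt_eqF.
  rewrite [RHS]lnM // posrE //; exact: mulr_gt0.
have X0 : 0 < 2 * (x w + 1) by rewrite mulr_gt0 // ltr_wpDl.
have XE : (2 * (x w + 1)) `^ (p / 2) = expR (p / 2 * ln (2 * (x w + 1))).
  by rewrite /powR gt_eqF.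
have fx : normc (f w - psum c M w) <= 1 by apply: hM; rewrite w1.
have f0 := normc_ge0 (f w); have q0 := normc_ge0 (psum c M w).
have h1 : normc (f w) <= normc (psum c M w) + 1.
  by have := le_normc_sub (f w) (psum c M w); lra.
have h2 : normc (psum c M w) <= normc (f w) + 1.
  by have := le_normc_sub (psum c M w) (f w); rewrite normcB_sym; lra.
have p20 : 0 <= p / 2 by rewrite divr_ge0 // ltW.
apply/andP; split.
- rewrite -powR_sq2 //; apply: (@le_trans _ _ ((2 * (x w + 1)) `^ (p / 2))).
    apply: ge0_ler_powR => //; rewrite ?nnegrE ?sqr_ge0 ?(ltW X0) //.
    exact: sqr_le_dbl.
  by rewrite XE ler_expR /T ler_wpM2l // -lnE lerD2l.
- apply: (@le_trans _ _ (expR (p / 2) * (2 * (x w + 1)) `^ (p / 2))).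
    rewrite XE -expRD ler_expR /T -lnE -[X in _ <= X + _]mulr1 -mulrDr ler_wpM2l //.
    lra.
  rewrite -mulrA ler_wpM2l ?expR_ge0 //.
  apply: (@le_trans _ _ (((2 * (normc (f w) + 1)) ^+ 2) `^ (p / 2))).
    apply: ge0_ler_powR => //; rewrite ?nnegrE ?sqr_ge0 ?(ltW X0) //.
    exact: dbl_le_sqr.
  rewrite powR_sq2; last by lra.
  rewrite powRM //; last by lra.
  have -> : (4 : R) `^ p = 2 `^ p * 2 `^ p by rewrite -powRM //; congr (_ `^ _); ring.
  rewrite -mulrA ler_wpM2l ?powR_ge0 //.
  have := @powR_ge0D (normc (f w)) 1 p (ltW p0) f0 ler01.
  by rewrite powR1.
Qed.

End Majorant.

(** * Factorization as a limit over circles *)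

Section Factorization.
Variable R : realType.
Implicit Types (f g : R[i] -> R[i]) (z w : R[i]) (rho p S E : R).

Lemma taylor_has_ps g rho : 1 < rho -> (forall w, normc w < rho -> cderivable g w) ->
  exists K, has_ps K (tcoef g) g.
Proof.
move=> rho1 hg.
have gc : circle_cont g 1.
  by move=> w w1; apply/cderivable_cont/hg; rewrite w1.
have [M hM] := circle_bounded ltr01 gc.
exists M; split=> [k|z N z1]; last exact: taylor_remainder rho1 hg hM z1.
apply: normc_cmean_le => //.
  by apply: circle_contM => //; exact: unit_circle_invX.
by move=> w w1; rewrite normcM normcX normcV w1 invr1 expr1n mulr1 hM.
Qed.

Lemma bessel_sq_bound g rho E : 1 < rho -> (forall w, normc w < rho -> cderivable g w) ->
  rmean (fun w => normc (g w) ^+ 2) 1 <= E -> sq_bound (tcoef g) E.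
Proof.
move=> rho1 hg hE N; apply: le_trans hE; apply: bessel.
by move=> w w1; apply/cderivable_cont/hg; rewrite w1.
Qed.

Lemma ucvg_normc_cont (U : set_system nat) (UU : UltraFilter U) (phi : R -> R)
    (x : nat -> R[i]) l (e : R) : {for normc l, continuous phi} -> ucvg U x l -> 0 < e ->
  U [set j | `|phi (normc (x j)) - phi (normc l)| <= e].
Proof.
move=> phic xl e0; have UP : ProperFilter U by case: UU.
have /nbhs_ballP[d /= d0 hd] : \forall y \near normc l, `|phi (normc l) - phi y| < e.
  by move/cvgrPdist_lt : phic; exact.
apply: filterS (xl _ (_ : 0 < d / 2)) => [j /= hj|]; last by rewrite divr_gt0.
rewrite distrC ltW //; apply: hd; rewrite /ball /= distrC.
have d2 : d / 2 < d by lra.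
apply: le_lt_trans (le_lt_trans hj d2); rewrite ler_norml; apply/andP; split.
  by have := le_normc_sub l (x j); rewrite normcB_sym; lra.
by have := le_normc_sub (x j) l; lra.
Qed.

Lemma cderivable_cexp_horner (k : R[i]) (P : {poly R[i]}) z :
  cderivable (fun w => cexp (k * P.[w])) z.
Proof.
have [l hl] := cderivable_horner P z.
have hk := cderivM (cderiv_cst k z) hl.
by eexists; exact: (cderiv_comp hk (cderiv_cexp _)).
Qed.

(** The shift by 2 makes the radius positive already at [j = 0]. *)
Definition radius (j : nat) : R := 1 - (j.+2)%:R^-1.

Lemma radius_bounds j : 0 < radius j < 1.
Proof.
have j0 : 0 < (j.+2%:R : R) by [].
rewrite /radius subr_gt0 invf_lt1 // ltr1n /= gtrBl invr_gt0 //.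
Qed.

Lemma radius_near (d : R) : 0 < d -> \forall j \near \oo, 1 - radius j < d.
Proof.
move=> d0; exists (Num.truncn d^-1) => // j /= hj.
have j0 : 0 < (j.+2%:R : R) by [].
rewrite /radius opprB addrC subrK invf_plt ?posrE //.
rewrite (lt_le_trans (truncnS_gt _)) // ler_nat ltnS (leq_trans hj) //.
Qed.

Lemma dil_sub (s : R) z : s%:C * z - z = (s - 1)%:C * z.
Proof. by rewrite rmorphB rmorph1 mulrBl mul1r. Qed.

Theorem hardy_factorization f p S (n : nat) : 0 < p -> 2 <= p * n%:R ->
  (forall z, normc z < 1 -> cderivable f z) ->
  (forall r, 0 < r < 1 -> rmean (fun w => normc (f w) `^ p) r <= S) ->
  exists (K E : R) (cb cV cF : nat -> R[i]) (b V F : R[i] -> R[i]),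
   [/\ has_ps K cb b /\ sq_bound cb E, has_ps K cV V /\ sq_bound cV E,
     has_ps K cF F /\ sq_bound cF E &
     forall z, normc z < 1 -> [/\ f z = b z * V z ^+ n, normc (b z) <= 1 &
       normc (f z) `^ p <= normc (F z) ^+ 2]].
Proof.
move=> p0 pn hf hS.
have pn0 : 0 < p * n%:R by lra.
have nz : n%:R != 0 :> R by apply: contraTneq pn0 => ->; rewrite mulr0 ltxx.
have pz : p != 0 by rewrite gt_eqF.
pose fj j w := f ((radius j)%:C * w).
have hfj j w : normc w < (radius j)^-1 -> cderivable (fj j) w.
  have /andP[r0 r1] := radius_bounds j.
  move=> wr; apply: cderivable_dil; apply: hf.
  by rewrite normcM normc_real gtr0_norm // mulrC -ltr_pdivlMr // mul1r.
have rho1 j : 1 < (radius j)^-1.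
  by have /andP[r0 r1] := radius_bounds j; rewrite invf_gt1.
have /(_ _)/cid-/all_sig[P hP] j := majorant p0 (rho1 j) (@hfj j).
(* [V] is the root of order [p * n] of [cexp P], and [F] its square root; [b] is [f] divided by the
   root of order [p], so it keeps the zeros of [f]. *)
pose b j w := fj j w * cexp ((- p^-1)%:C * (P j).[w]).
pose V j w := cexp (((p * n%:R)^-1)%:C * (P j).[w]).
pose F j w := cexp ((2^-1)%:C * (P j).[w]).
have ReZ (k : R) z : complex.Re (k%:C * z) = k * complex.Re z.
  by rewrite ReM /= mul0r subr0.
have fbV j w : fj j w = b j w * V j w ^+ n.
  rewrite /b /V -cexpMn -mulrA -cexpD mulrA -mulrDl.
  rewrite (_ : _ + _ = 0) ?mul0r ?cexp0 ?mulr1 //.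
  rewrite -(rmorph_nat (real_complex R)) -rmorphM -rmorphD /=.
  by rewrite (_ : _ + _ = 0) //; field; rewrite pz nz.
have nF j w : normc (F j w) ^+ 2 = expR (complex.Re (P j).[w]).
  rewrite /F normc_cexp ReZ -expRM_natl; congr expR.
  by rewrite mulrA divff ?mul1r.
have nVn j w : normc (V j w) ^+ n = expR (p^-1 * complex.Re (P j).[w]).
  rewrite /V normc_cexp ReZ -expRM_natl; congr expR.
  by field; rewrite pz nz.
have nVnp j w : (normc (V j w) ^+ n) `^ p = normc (F j w) ^+ 2.
  by rewrite nVn nF -expRM; congr expR; field.
have b1 j w : normc w = 1 -> normc (b j w) <= 1.
  move=> w1; have /andP[h _] := hP j w w1.
  have h1 : normc (fj j w) <= expR (p^-1 * complex.Re (P j).[w]).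
    have e0 := expR_ge0 (p^-1 * complex.Re (P j).[w]).
    rewrite leNgt; apply/negP => lt.
    have : expR (p^-1 * complex.Re (P j).[w]) `^ p < normc (fj j w) `^ p.
      by apply: gt0_ltr_powR; rewrite ?nnegrE ?normc_ge0.
    rewrite -expRM mulrAC mulVf // mul1r => /lt_le_trans/(_ h).
    by rewrite ltxx.
  rewrite /b normcM normc_cexp ReZ mulNr expRN ler_pdivrMr ?expR_gt0 //.
  by rewrite mul1r.
pose S' := expR (p / 2) * 4 `^ p * (S + 1).
have S'0 : 0 <= S'.
  have : 0 <= S.
    have h2 : 0 < (2^-1 : R) < 1 by rewrite invr_gt0 ltr0n invf_lt1 // ltr1n.
    apply: le_trans (hS _ h2); apply: rmean_ge0; first by rewrite invr_ge0.
    by move=> w _; exact: powR_ge0.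
  by move=> S0; rewrite mulr_ge0 ?mulr_ge0 ?expR_ge0 ?powR_ge0 // addr_ge0.
(* One bound for the three square means: 1 for [b], [S'] for [F], and the sum for [V], because
   [p * n >= 2] makes [normc V ^+ 2] at most 1 plus the exponential of the real part of [P]. *)
pose E := 1 + S'.
have fjc j : circle_cont (fj j) 1.
  by move=> w w1; apply/cderivable_cont/hfj; rewrite w1.
have meanP j : rmean (fun w => expR (complex.Re (P j).[w])) 1 <= S'.
  have hc : rcirc (fun w => normc (fj j w) `^ p) 1 by exact: rcirc_powR.
  apply: (@le_trans _ _ (rmean (fun w => expR (p / 2) * 4 `^ p * (normc (fj j w) `^ p + 1)) 1)).
    apply: rmean_le => //.
    - move=> t; apply: (@continuous_comp _ _ _
        (fun t => complex.Re (P j).[1%:C * expi t]) expR); last exact: continuous_expR.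
      apply: (@rcirc_Re _ (fun w => (P j).[w]) 1) => // w _.
      exact/cderivable_cont/cderivable_horner.
    - by apply: rcircM; [exact: rcirc_cst|apply: rcircD => //; exact: rcirc_cst].
    - by move=> w w1; have /andP[] := hP j w w1.
  rewrite rmeanZ; last by apply: rcircD => //; exact: rcirc_cst.
  rewrite rmeanD //; last exact: rcirc_cst.
  rewrite rmean_cst ler_wpM2l ?mulr_ge0 ?expR_ge0 ?powR_ge0 // lerD2r.
  rewrite /fj (rmean_dil (fun w => normc (f w) `^ p)) mulr1; apply: hS.
  exact: radius_bounds.
have hb j w : normc w < (radius j)^-1 -> cderivable (b j) w.
  by move=> wr; apply: cderivableM; [exact: hfj|exact: cderivable_cexp_horner].
have hV j w : normc w < (radius j)^-1 -> cderivable (V j) w.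
  by move=> _; exact: cderivable_cexp_horner.
have hF j w : normc w < (radius j)^-1 -> cderivable (F j) w.
  by move=> _; exact: cderivable_cexp_horner.
have circ g j : (forall w, normc w < (radius j)^-1 -> cderivable g w) -> circle_cont g 1.
  by move=> hg w w1; apply/cderivable_cont/hg; rewrite w1.
have Pc j : rcirc (fun w => expR (complex.Re (P j).[w])) 1.
  have := rcirc_normc2 ler01 (circ _ j (@hF j)).
  by under [X in rcirc X _ -> _]eq_fun do rewrite nF.
have bE j : sq_bound (tcoef (b j)) E.
  apply: (bessel_sq_bound (rho1 j) (@hb j)); rewrite /E.
  apply: (@le_trans _ _ (rmean (fun=> 1) 1)); last by rewrite rmean_cst lerDl.
  apply: rmean_le => //; first exact: (rcirc_normc2 ler01 (circ _ j (@hb j))).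
    exact: rcirc_cst.
  by move=> w w1; rewrite exprn_ile1 ?normc_ge0 ?b1.
have FE j : sq_bound (tcoef (F j)) E.
  apply: (bessel_sq_bound (rho1 j) (@hF j)); rewrite /E.
  rewrite (rmean_eq (h := fun w => expR (complex.Re (P j).[w]))) //.
  by rewrite (le_trans (meanP j)) // lerDr.
have VE j : sq_bound (tcoef (V j)) E.
  apply: (bessel_sq_bound (rho1 j) (@hV j)); rewrite /E.
  apply: (@le_trans _ _ (rmean (fun w => 1 + expR (complex.Re (P j).[w])) 1)).
    apply: rmean_le => //; first exact: (rcirc_normc2 ler01 (circ _ j (@hV j))).
      by apply: rcircD; [exact: rcirc_cst|exact: Pc].
    move=> w w1; rewrite /V normc_cexp ReZ -expRM_natl.
    set u := complex.Re _; have [u0|u0] := leP 0 u.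
      rewrite (@le_trans _ _ (expR u)) ?lerDr // ler_expR mulrA ler_piMl //.
      by rewrite ler_pdivrMr // mul1r.
    apply: (@le_trans _ _ 1); last by rewrite lerDl expR_ge0.
    rewrite -[leRHS]expR0 ler_expR; apply: mulr_ge0_le0 => //.
    by apply: mulr_ge0_le0; [rewrite invr_ge0 ltW|exact: ltW].
  rewrite rmeanD; [|exact: rcirc_cst|exact: Pc].
  by rewrite rmean_cst lerD2l.
(* A single ultrafilter gives limits to the three factors simultaneously; being finer than the
   cofinite filter, it also sees [radius j] tend to 1, so that the products converge to [f]. *)
have [U [UU subU]] := ultraFilterLemma eventually_filter.
have UP : ProperFilter U by case: UU.
have [cb [b' [cbE cbps bcv]]] := sq_limit UU bE (fun j => taylor_has_ps (rho1 j) (@hb j)).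
have [cV [V' [cVE cVps Vcv]]] := sq_limit UU VE (fun j => taylor_has_ps (rho1 j) (@hV j)).
have [cF [F' [cFE cFps Fcv]]] := sq_limit UU FE (fun j => taylor_has_ps (rho1 j) (@hF j)).
exists (Num.sqrt E), E, cb, cV, cF, b', V', F'; split => // z z1.
have fcv : ucvg U (fun j => fj j z) (f z).
  move=> e e0; have [l hl] := hf z z1; have [d d0 hd] := cderiv_cont hl e0.
  apply: filterS (subU _ (radius_near d0)) => j /= rj; apply/ltW/hd.
  have /andP[r0 r1] := radius_bounds j.
  rewrite dil_sub.
  rewrite normcM normc_real distrC ger0_norm ?subr_ge0 ?(ltW r1) //.
  rewrite (le_lt_trans _ rj) // ler_piMr ?subr_ge0 ?(ltW r1) //; exact: ltW.
(* The bound on the circle passes to the interior, where it is also what makes [F] dominate [f]. *)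
have bz1 j : normc (b j z) <= 1 by exact: max_modulus (rho1 j) (@hb j) (@b1 j) z1.
split.
- apply: (ucvg_unique UU fcv).
  have := ucvgM UU (bcv z z1) (ucvgX UU n (Vcv z z1)).
  by under [X in ucvg _ X _ -> _]eq_fun do rewrite -fbV.
- rewrite -(subr0 (b' z)); apply: (ucvg_close UU (bcv z z1)).
  by move=> j; rewrite subr0.
- have fF j : normc (fj j z) `^ p <= normc (F j z) ^+ 2.
    rewrite -nVnp; apply: ge0_ler_powR; rewrite ?nnegrE ?exprn_ge0 ?normc_ge0 //.
      exact: ltW.
    by rewrite fbV normcM normcX ler_piMl ?exprn_ge0 ?normc_ge0.
  apply/ler_addgt0Pr => e e0; have e20 : 0 < e / 2 by rewrite divr_gt0.
  have pc : {for normc (f z), continuous (fun y : R => `|y| `^ p)}.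
    apply: continuous_powR_nng => //; exact: norm_continuous.
  have sc : {for normc (F' z), continuous (fun y : R => y ^+ 2)} by exact: exprn_continuous.
  have [j [/= h1 h2]] := filter_ex (filterI (ucvg_normc_cont UU pc fcv e20)
    (ucvg_normc_cont UU sc (Fcv z z1) e20)).
  move: h1 h2 (fF j); rewrite !(ger0_norm (normc_ge0 _)).
  rewrite !ler_norml => /andP[h1 _] /andP[_ h2] h3; lra.
Qed.

End Factorization.

(** * Dilations converge in the mean of order [p] *)

Section DilationConvergence.
Variable R : realType.
Implicit Types (f g : R[i] -> R[i]) (z w : R[i]) (p S E T d : R).

Lemma normc_expB_le z w T n : normc z <= T -> normc w <= T ->
  normc (z ^+ n - w ^+ n) <= n%:R * (1 + T) ^+ n * normc (z - w).
Proof.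
move=> zT wT; have T0 : 0 <= T by exact: le_trans (normc_ge0 z) zT.
elim: n => [|n IH]; first by rewrite !expr0 subrr normc0 !mul0r.
have -> : z ^+ n.+1 - w ^+ n.+1 = z * (z ^+ n - w ^+ n) + (z - w) * w ^+ n.
  by rewrite !exprS; ring.
have d0 := normc_ge0 (z - w); have e0 := normc_ge0 (z ^+ n - w ^+ n).
have X0 : 0 <= (1 + T) ^+ n by rewrite exprn_ge0 // addr_ge0.
have wX : normc w ^+ n <= (1 + T) ^+ n.
  by rewrite lerXn2r ?nnegrE ?normc_ge0 ?addr_ge0 // (le_trans wT) // lerDr.
rewrite (le_trans (le_normcD _ _)) // !normcM normcX.
have h1 : normc z * normc (z ^+ n - w ^+ n) <=
    T * (n%:R * (1 + T) ^+ n * normc (z - w)).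
  by rewrite ler_pM ?normc_ge0.
have h2 : normc (z - w) * normc w ^+ n <= normc (z - w) * (1 + T) ^+ n.
  by rewrite ler_wpM2l.
have n0 : 0 <= (n%:R : R) by [].
have h3 : 0 <= n%:R * (1 + T) ^+ n * normc (z - w) by rewrite !mulr_ge0.
have h4 : 0 <= T * ((1 + T) ^+ n * normc (z - w)) by rewrite !mulr_ge0.
rewrite exprS -natr1; set X := (1 + T) ^+ n in h1 h2 h3 h4 X0 *; lra.
Qed.

Lemma sqr_normc_le2 z w : normc z ^+ 2 <= 2 * normc (z - w) ^+ 2 + 2 * normc w ^+ 2.
Proof.
have h := le_normc_sub z w; have a0 := normc_ge0 z.
have b0 := normc_ge0 w; have c0 := normc_ge0 (z - w).
have : normc z ^+ 2 <= (normc (z - w) + normc w) ^+ 2.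
  by rewrite lerXn2r // nnegrE addr_ge0.
by have := sqr_ge0 (normc (z - w) - normc w); rewrite sqrrB sqrrD; lra.
Qed.

(* Away from the exceptional set, where one of the four quotients exceeds 1,
   the p-th power of the difference is small; on it the quotients absorb the
   bounded part of the crude bound through F. *)
Lemma factored_diff_le (b1 b2 V1 V2 F1 F2 G1 G2 : R[i]) p B T d eta n :
  0 < p -> 0 < T -> 0 < d -> 0 <= eta ->
  normc b1 <= 1 -> normc b2 <= 1 ->
  normc (b1 * V1 ^+ n) `^ p <= normc F1 ^+ 2 ->
  normc (b2 * V2 ^+ n) `^ p <= normc F2 ^+ 2 ->
  normc G1 <= B -> normc G2 <= B ->
  (d * ((n%:R + 1) * (1 + T) ^+ n)) `^ p <= eta ->
  normc (b1 * V1 ^+ n - b2 * V2 ^+ n) `^ p <=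
    2 `^ p * 2 * (normc (F1 - G1) ^+ 2 + normc (F2 - G2) ^+ 2) + (eta +
    2 `^ p * 4 * B ^+ 2 * (((T ^+ 2)^-1 * normc V1 ^+ 2 + (T ^+ 2)^-1 * normc V2 ^+ 2) +
       ((d ^+ 2)^-1 * normc (b1 - b2) ^+ 2 + (d ^+ 2)^-1 * normc (V1 - V2) ^+ 2))).
Proof.
move=> p0 T0 d0 eta0 b11 b21 hF1 hF2 G1B G2B hd; have T0' := ltW T0.
have c0 : 0 <= 2 `^ p :> R by exact: powR_ge0.
have B0 : 0 <= B by exact: le_trans (normc_ge0 _) G1B.
have q0 : 0 <= 2 `^ p * 4 * B ^+ 2 by rewrite !mulr_ge0 ?sqr_ge0.
have sq x y : 0 < y -> 0 <= (y ^+ 2)^-1 * x ^+ 2 :> R.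
  by move=> y0; rewrite mulr_ge0 ?invr_ge0 ?sqr_ge0.
have big x y : 0 < y -> y < x -> 1 <= (y ^+ 2)^-1 * x ^+ 2 :> R.
  move=> y0 yx; rewrite mulrC ler_pdivlMr ?exprn_gt0 // mul1r.
  by rewrite lerXn2r ?nnegrE ?ltW // (lt_trans y0).
set s1 := (T ^+ 2)^-1 * normc V1 ^+ 2; set s2 := (T ^+ 2)^-1 * normc V2 ^+ 2.
set s3 := (d ^+ 2)^-1 * normc (b1 - b2) ^+ 2.
set s4 := (d ^+ 2)^-1 * normc (V1 - V2) ^+ 2.
have s10 : 0 <= s1 by exact: sq.
have s20 : 0 <= s2 by exact: sq.
have s30 : 0 <= s3 by exact: sq.
have s40 : 0 <= s4 by exact: sq.
have FG0 : 0 <= 2 `^ p * 2 * (normc (F1 - G1) ^+ 2 + normc (F2 - G2) ^+ 2).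
  by rewrite !mulr_ge0 ?addr_ge0 ?sqr_ge0.
have crude : normc (b1 * V1 ^+ n - b2 * V2 ^+ n) `^ p <=
  2 `^ p * 2 * (normc (F1 - G1) ^+ 2 + normc (F2 - G2) ^+ 2) + 2 `^ p * 4 * B ^+ 2.
  apply: (@le_trans _ _ (2 `^ p * (normc F1 ^+ 2 + normc F2 ^+ 2))).
    apply: (@le_trans _ _ (2 `^ p * (normc (b1 * V1 ^+ n) `^ p + normc (b2 * V2 ^+ n) `^ p))).
      rewrite (le_trans _ (powR_ge0D (ltW p0) (normc_ge0 _) (normc_ge0 _))) //.
      apply: ge0_ler_powR; rewrite ?nnegrE ?addr_ge0 ?normc_ge0 //; first exact: ltW.
      exact: le_normcB.
    by rewrite ler_wpM2l // lerD.
  rewrite -!mulrA -mulrDr ler_wpM2l //.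
  have h1 := sqr_normc_le2 F1 G1; have h2 := sqr_normc_le2 F2 G2.
  have h3 : normc G1 ^+ 2 <= B ^+ 2 by rewrite lerXn2r ?nnegrE ?normc_ge0.
  have h4 : normc G2 ^+ 2 <= B ^+ 2 by rewrite lerXn2r ?nnegrE ?normc_ge0.
  lra.
have fin : 1 <= s1 + s2 + (s3 + s4) -> normc (b1 * V1 ^+ n - b2 * V2 ^+ n) `^ p <=
    2 `^ p * 2 * (normc (F1 - G1) ^+ 2 + normc (F2 - G2) ^+ 2) + (eta +
    2 `^ p * 4 * B ^+ 2 * (s1 + s2 + (s3 + s4))).
  move=> h; have := ler_wpM2l q0 h; rewrite mulr1 => h'.
  by rewrite (le_trans crude) // lerD2l; lra.
have [h1|V1T] := ltP T (normc V1); first by apply: fin; have := big _ _ T0 h1; rewrite -/s1; lra.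
have [h2|V2T] := ltP T (normc V2); first by apply: fin; have := big _ _ T0 h2; rewrite -/s2; lra.
have [h3|bd] := ltP d (normc (b1 - b2)).
  by apply: fin; have := big _ _ d0 h3; rewrite -/s3; lra.
have [h4|Vd] := ltP d (normc (V1 - V2)).
  by apply: fin; have := big _ _ d0 h4; rewrite -/s4; lra.
have small : normc (b1 * V1 ^+ n - b2 * V2 ^+ n) <= d * ((n%:R + 1) * (1 + T) ^+ n).
  have -> : b1 * V1 ^+ n - b2 * V2 ^+ n = (b1 - b2) * V1 ^+ n + b2 * (V1 ^+ n - V2 ^+ n).
    by ring.
  rewrite (le_trans (le_normcD _ _)) // !normcM normcX.
  have X0 : 0 <= (1 + T) ^+ n by rewrite exprn_ge0 // addr_ge0.
  have g1 : normc (b1 - b2) * normc V1 ^+ n <= d * (1 + T) ^+ n.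
    rewrite ler_pM ?exprn_ge0 ?normc_ge0 // lerXn2r ?nnegrE ?normc_ge0 ?addr_ge0 //.
    by rewrite (le_trans V1T) // lerDr.
  have g2 : normc b2 * normc (V1 ^+ n - V2 ^+ n) <= n%:R * (1 + T) ^+ n * d.
    rewrite -[leRHS]mul1r ler_pM ?normc_ge0 //.
    rewrite (le_trans (normc_expB_le n V1T V2T)) // ler_wpM2l //.
    by rewrite mulr_ge0.
  lra.
have : normc (b1 * V1 ^+ n - b2 * V2 ^+ n) `^ p <= eta.
  apply: le_trans hd; apply: ge0_ler_powR; rewrite ?nnegrE ?normc_ge0 //; first exact: ltW.
  exact: le_trans (normc_ge0 _) small.
move/le_trans; apply.
have : 0 <= 2 `^ p * 4 * B ^+ 2 * (s1 + s2 + (s3 + s4)) by rewrite mulr_ge0 ?addr_ge0.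
lra.
Qed.

Theorem hardy_dilation f p S e : 0 < p ->
  (forall z, normc z < 1 -> cderivable f z) ->
  (forall r, 0 < r < 1 -> rmean (fun w => normc (f w) `^ p) r <= S) -> 0 < e ->
  exists2 s, 0 < s < 1 & forall r, 0 < r < 1 ->
    rmean (fun w => normc (f w - f (s%:C * w)) `^ p) r <= e.
Proof.
move=> p0 hf hS e0.
have [n pn] : exists n : nat, 2 <= p * n%:R.
  exists (Num.truncn (2 / p)).+1; rewrite -ler_pdivrMl // mulrC ltW //.
  exact: truncnS_gt.
have [K [E [cb [cV [cF [b [V [F [[bps bE] [Vps VE] [Fps FE] hbVF]]]]]]]]] :=
  hardy_factorization p0 pn hf hS.
have K0 := has_ps_ge0 bps; have E0 := sq_bound_ge0 bE.
pose c1 := 2 `^ p * 2 : R.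
have c10 : 0 < c1 by rewrite mulr_gt0 // powR_gt0.
(* The error [e] is spent as follows: [e / 8] for each of [F] and its dilate by [s], compared with
   their dilates by [g0]; [e / 4] for [eta]; [e / 8] for each of the four quotients of
   [factored_diff_le]. The constants are chosen in the order [g0], [B], [T], [d], [s], each in terms
   of the previous ones. *)
have tau0 : 0 < e / (8 * c1) by rewrite divr_gt0 // mulr_gt0.
have [g0 /andP[g00 g01] hg] := sq_dilation Fps FE tau0.
(* Dilation by [g0] keeps the argument in the disk of radius [g0], so [B] bounds the comparison
   functions on every circle. *)
pose B := K / (1 - g0).
have B0 : 0 <= B by rewrite divr_ge0 // subr_ge0 ltW.
pose Q := 2 `^ p * 4 * B ^+ 2.
have Q0 : 0 <= Q by apply: mulr_ge0; [rewrite mulr_ge0 ?powR_ge0|exact: sqr_ge0].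
(* Since [T <= T ^+ 2], this choice ensures [Q * E / T ^+ 2 <= e / 8]. *)
have [T T1 TE] : exists2 T, 1 <= T & T = 1 + 8 * Q * E / e.
  exists (1 + 8 * Q * E / e) => //.
  by rewrite lerDl; apply: divr_ge0 (ltW e0); apply: mulr_ge0 => //; exact: mulr_ge0.
have T0 : 0 < T by lra.
pose L := (n%:R + 1) * (1 + T) ^+ n.
have L0 : 0 < L.
  by apply: mulr_gt0; [rewrite ltr_wpDl|apply: exprn_gt0; lra].
pose eta := e / 4; have eta0 : 0 < eta by rewrite divr_gt0.
have [d d0 dL] : exists2 d, 0 < d & (d * L) `^ p <= eta.
  exists (eta `^ p^-1 / L); first by rewrite divr_gt0 // powR_gt0.
  by rewrite divfK ?gt_eqF // -powRrM mulVf ?gt_eqF // powRr1 // ltW.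
have eps0 : 0 < d ^+ 2 * e / (8 * (Q + 1)).
  by rewrite divr_gt0 ?mulr_gt0 ?exprn_gt0 //; lra.
have [sb /andP[sb0 sb1] hsb] := sq_dilation bps bE eps0.
have [sV /andP[sV0 sV1] hsV] := sq_dilation Vps VE eps0.
pose s := (Num.max sb sV + 1) / 2.
have [s0 s1 ssb ssV] : [/\ 0 < s, s < 1, sb <= s & sV <= s].
  rewrite /s; case: (leP sb sV) => h; split; lra.
have s01 : 0 <= s <= 1 by apply/andP; split; exact: ltW.
have g01' : 0 <= g0 <= 1 by apply/andP; split => //; exact: ltW.
exists s; first by rewrite s0.
move=> r /andP[r0 r1]; have r0' := ltW r0.
have disk w : normc w = r -> normc w < 1 by move=> ->.
have disks w : normc w = r -> normc (s%:C * w) < 1.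
  move=> wr; rewrite normcM normc_real gtr0_norm // wr.
  by rewrite (le_lt_trans _ r1) // ler_piMl // ltW.
have dc g k (c : nat -> R[i]) M : 0 <= k <= 1 -> has_ps M c g -> circle_cont (fun w => g (k%:C * w)) r.
  by move=> k01 gps; exact: has_ps_circle (has_ps_dil k01 gps) r1.
have Fsc := dc _ _ _ _ s01 Fps.
have Fgc := dc _ _ _ _ g01' Fps.
have bsc := dc _ _ _ _ s01 bps.
have Vsc := dc _ _ _ _ s01 Vps.
have bc := has_ps_circle bps r1.
have Vc := has_ps_circle Vps r1.
have Fc := has_ps_circle Fps r1.
have Fgsc : circle_cont (fun w => F (g0%:C * (s%:C * w))) r.
  exact: has_ps_circle (has_ps_dil s01 (has_ps_dil g01' Fps)) r1.
have fc : circle_cont f r by move=> w wr; apply/cderivable_cont/hf; rewrite wr.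
have fsc : circle_cont (fun w => f (s%:C * w)) r.
  by move=> w wr; apply/cderivable_cont/cderivable_dil/hf/disks.
have sqc g : circle_cont g r -> rcirc (fun w => normc (g w) ^+ 2) r by exact: rcirc_normc2.
have Zc k (g : R[i] -> R) : rcirc g r -> rcirc (fun w => k * g w) r.
  by move=> gc; apply: rcircM => //; exact: rcirc_cst.
have r1a := sqc _ (circle_contB Fc Fgc).
have r1b := sqc _ (circle_contB Fsc Fgsc).
have r2a := Zc (T ^+ 2)^-1 _ (sqc _ Vc).
have r2b := Zc (T ^+ 2)^-1 _ (sqc _ Vsc).
have r3a := Zc (d ^+ 2)^-1 _ (sqc _ (circle_contB bc bsc)).
have r3b := Zc (d ^+ 2)^-1 _ (sqc _ (circle_contB Vc Vsc)).
have r4 := rcircD (rcircD r2a r2b) (rcircD r3a r3b).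
have r5 := rcircD (@rcirc_cst _ eta r) (Zc Q _ r4).
have r6 := rcircD (Zc c1 _ (rcircD r1a r1b)) r5.
apply: le_trans (rmean_le r0' (rcirc_powR p0 r0' (circle_contB fc fsc)) r6 _) _.
  move=> w wr; have [fw bw Fw] := hbVF _ (disk _ wr).
  have [fsw bsw Fsw] := hbVF _ (disks _ wr).
  rewrite fw fsw; apply: factored_diff_le => //; try exact: ltW.
  - by rewrite -fw.
  - by rewrite -fsw.
  - have h : normc (g0%:C * w) <= g0.
      by rewrite normcM normc_real ger0_norm // ler_piMr // ltW // disk.
    rewrite (le_trans (has_ps_bound Fps (le_lt_trans h g01))) // ler_wpM2l //.
    by rewrite lef_pV2 ?posrE; lra.
  - have h : normc (g0%:C * (s%:C * w)) <= g0.
      by rewrite normcM normc_real ger0_norm // ler_piMr // ltW // disks.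
    rewrite (le_trans (has_ps_bound Fps (le_lt_trans h g01))) // ler_wpM2l //.
    by rewrite lef_pV2 ?posrE; lra.
rewrite (rmeanD (Zc c1 _ (rcircD r1a r1b)) r5) (rmeanZ _ (rcircD r1a r1b)).
rewrite (rmeanD r1a r1b) (rmeanD (@rcirc_cst _ eta r) (Zc Q _ r4)) rmean_cst.
rewrite (rmeanZ _ r4) (rmeanD (rcircD r2a r2b) (rcircD r3a r3b)).
rewrite (rmeanD r2a r2b) (rmeanD r3a r3b).
rewrite (rmeanZ _ (sqc _ Vc)) (rmeanZ _ (sqc _ Vsc)).
rewrite (rmeanZ _ (sqc _ (circle_contB bc bsc))) (rmeanZ _ (sqc _ (circle_contB Vc Vsc))).
have rr : 0 <= r < 1 by rewrite r0'.
have sr : s * r < 1 by rewrite (lt_trans _ r1) // gtr_pMl.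
have srr : 0 <= s * r < 1 by rewrite sr mulr_ge0 // ltW.
have gg : g0 <= g0 < 1 by rewrite lexx.
have sbs : sb <= s < 1 by rewrite ssb.
have sVs : sV <= s < 1 by rewrite ssV.
have m1 := hg g0 r gg rr.
have m2 : rmean (fun w => normc (F (s%:C * w) - F (g0%:C * (s%:C * w))) ^+ 2) r <= e / (8 * c1).
  by rewrite (rmean_dil (fun w => normc (F w - F (g0%:C * w)) ^+ 2)) hg.
have m3 := sq_mean_le Vps VE rr.
have m4 : rmean (fun w => normc (V (s%:C * w)) ^+ 2) r <= E.
  by rewrite (rmean_dil (fun w => normc (V w) ^+ 2)); exact: sq_mean_le Vps VE srr.
have m5 := hsb s r sbs rr.
have m6 := hsV s r sVs rr.
have k1 x : x <= e / (8 * c1) -> c1 * x <= e / 8.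
  move=> h; have := ler_wpM2l (ltW c10) h.
  by rewrite (_ : c1 * (e / (8 * c1)) = e / 8) //; field; rewrite gt_eqF.
have k2 x : x <= E -> Q * ((T ^+ 2)^-1 * x) <= e / 8.
  move=> h; apply: (@le_trans _ _ (Q * ((T ^+ 2)^-1 * E))).
    by rewrite !ler_wpM2l // invr_ge0 sqr_ge0.
  rewrite mulrCA mulrC ler_pdivrMr ?exprn_gt0 //.
  have TT : T <= T ^+ 2 by rewrite expr2 ler_pMr.
  have : e / 8 * T <= e / 8 * T ^+ 2 by rewrite ler_wpM2l // divr_ge0 // ltW.
  apply: le_trans; rewrite (_ : e / 8 * T = e / 8 + Q * E); first by lra.
  by rewrite TE; field; rewrite gt_eqF.
have k3 x : x <= d ^+ 2 * e / (8 * (Q + 1)) -> Q * ((d ^+ 2)^-1 * x) <= e / 8.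
  move=> h; apply: (@le_trans _ _ (Q * ((d ^+ 2)^-1 * (d ^+ 2 * e / (8 * (Q + 1)))))).
    by rewrite !ler_wpM2l // invr_ge0 sqr_ge0.
  rewrite (_ : _ * _ = Q / (Q + 1) * (e / 8)); last first.
    by field; rewrite !gt_eqF //; lra.
  rewrite ler_piMl //; first by rewrite divr_ge0 // ltW.
  by rewrite ler_pdivrMr ?mul1r; lra.
have := k1 _ m1; have := k1 _ m2; have := k2 _ m3; have := k2 _ m4.
have := k3 _ m5; have := k3 _ m6.
rewrite !mulrDr /eta; lra.
Qed.

End DilationConvergence.

(** * The inverse Cesaro operator on weighted sequences *)

Section CesaroSequences.
Variable R : realType.
Implicit Types (x y f g : nat -> R) (c d M e : R) (n k : nat).

(** On power series this is the operator sending [f] to [(1 - z) (z f)']. The factor [n%:R] makes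
    the convention [0.-1 = 0] harmless. *)
Definition ces_inv x n : R := n.+1%:R * x n - n%:R * x n.-1.

(** Forward substitution for the equation [ces_inv u + c u = f]; in particular [ces_res 0] is the
    Cesaro operator on coefficients. *)
Fixpoint ces_res c f n : R :=
  if n is m.+1 then (m.+1%:R * ces_res c f m + f m.+1) / (m.+2%:R + c)
  else f 0%N / (1 + c).

Lemma ces_resE c f n : 0 <= c ->
  (n.+1%:R + c) * ces_res c f n = f n + n%:R * ces_res c f n.-1.
Proof.
move=> c0; have nz m : m.+1%:R + c != 0 by rewrite gt_eqF // ltr_pwDl.
case: n => [|n].
  by rewrite mul0r addr0 [LHS]mulrC divfK //; exact: (nz 0%N).
by rewrite [LHS]mulrC [in LHS]/= divfK ?nz // addrC.
Qed.

(** The way resolvent identities are proved below: both sides solve the same recursion. *)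
Lemma ces_res_unique c f g : 0 <= c ->
  (forall n, (n.+1%:R + c) * g n = f n + n%:R * g n.-1) -> g = ces_res c f.
Proof.
move=> c0 hg; have nz m : m.+1%:R + c != 0 by rewrite gt_eqF // ltr_pwDl.
apply/funext; elim=> [|n IH].
  by apply: (mulfI (nz 0%N)); rewrite hg ces_resE // !mul0r.
by apply: (mulfI (nz n.+1)); rewrite hg ces_resE //= IH.
Qed.

Lemma ces_resD c f g d : 0 <= c ->
  ces_res c (fun n => f n + d * g n) = fun n => ces_res c f n + d * ces_res c g n.
Proof.
move=> c0; apply/esym/ces_res_unique => // n.
have := ces_resE f n c0; have := ces_resE g n c0 => hg hf.
rewrite mulrDr hf mulrCA hg; ring.
Qed.

Lemma ces_res0 c : 0 <= c -> ces_res c (fun=> 0) = fun=> 0.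
Proof. by move=> c0; apply/esym/ces_res_unique => // n; rewrite !mulr0 addr0. Qed.

(** Each value is a convex combination of the previous one and of [x n]. *)
Lemma ces_res_bounded x M : (forall n, `|x n| <= M) -> forall n, `|ces_res 0 x n| <= M.
Proof.
move=> xM; have M0 : 0 <= M by exact: le_trans (normr_ge0 _) (xM 0%N).
elim=> [|n IH] /=; first by rewrite addr0 divr1.
rewrite addr0 normrM normfV (ger0_norm (ler0n _ n.+2)) ler_pdivrMr //.
rewrite (le_trans (ler_normD _ _)) // normrM (ger0_norm (ler0n _ n.+1)).
rewrite -[n.+2%:R]natr1 mulrDr mulr1 lerD // mulrC ler_wpM2r //.
Qed.

Section Weight.
Variable a : R.
Hypotheses (a0 : 0 < a) (a1 : a < 1).

(** It decays like [n^(a - 1)]. Up to a multiple of [delta 0], it satisfies the eigenvector equation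
    of [ces_inv] for the eigenvalue [a] ([weightE]). *)
Fixpoint weight n : R := if n is m.+1 then weight m * (m.+1%:R / (m.+2%:R - a)) else 1.

Lemma weight_den n : 0 < n.+1%:R - a.
Proof.
by rewrite subr_gt0 (lt_le_trans a1) // ler1n.
Qed.

Lemma weight_gt0 n : 0 < weight n.
Proof. by elim: n => //= n IH; rewrite mulr_gt0 // divr_gt0 // weight_den. Qed.

Lemma weightE n : (n.+1%:R - a) * weight n = (1 - a) * (n == 0)%:R + n%:R * weight n.-1.
Proof.
case: n => [|n] /=; first by rewrite mul0r addr0.
have := weight_den n.+1 => nz.
by rewrite mulr0 add0r mulrC -!mulrA mulVf ?gt_eqF // mulr1 mulrC.
Qed.

Definition wbounded M x := forall n, `|x n| <= M * weight n.

Lemma wboundedD M K x y : wbounded M x -> wbounded K y ->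
  wbounded (M + K) (fun n => x n + y n).
Proof. by move=> hx hy n; rewrite (le_trans (ler_normD _ _)) // mulrDl lerD. Qed.

Lemma wboundedZ M x d : wbounded M x -> wbounded (`|d| * M) (fun n => d * x n).
Proof. by move=> hx n; rewrite normrM -mulrA ler_wpM2l. Qed.

Lemma wbounded_ge0 M x : wbounded M x -> 0 <= M.
Proof. by move=> /(_ 0%N) h; have := le_trans (normr_ge0 _) h; rewrite /= mulr1. Qed.

Lemma wbounded_le M K x : M <= K -> wbounded M x -> wbounded K x.
Proof.
by move=> MK hx n; rewrite (le_trans (hx n)) // ler_wpM2r // ltW // weight_gt0.
Qed.

(* The weight is chosen so that (n+1-a) weight n = n weight (n-1) for n > 0,
   hence it is a supersolution of the recursion defining the resolvent. *)
Lemma ces_res_wbounded M c f : 0 <= c -> wbounded M f ->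
  wbounded (M / (a + c)) (ces_res c f).
Proof.
move=> c0 hf; have M0 := wbounded_ge0 hf; have a0' := a0; have a1' := a1.
have ac : 0 < a + c by lra.
elim=> [|n IH].
  rewrite /= mulr1 normrM normfV (gtr0_norm (_ : 0 < 1 + c)); last lra.
  apply: ler_pM => //; first by rewrite invr_ge0; lra.
    by have := hf 0%N; rewrite /= mulr1.
  by rewrite lef_pV2 ?posrE; lra.
have den : 0 < n.+2%:R + c by rewrite ltr_pwDl.
rewrite -(ler_pM2l den) -{1}(gtr0_norm den) -normrM ces_resE // [n.+1.-1]/=.
rewrite (le_trans (ler_normD _ _)) // normrM (ger0_norm (ler0n _ n.+1)).
have h1 : n.+1%:R * `|ces_res c f n| <= n.+1%:R * (M / (a + c) * weight n).
  by rewrite ler_wpM2l.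
have h2 := hf n.+1.
have h3 : n.+1%:R * weight n = (n.+2%:R - a) * weight n.+1.
  by rewrite weightE mulr0 add0r.
apply: le_trans (lerD h2 h1) _; rewrite [n.+1%:R * _]mulrCA h3.
rewrite le_eqVlt; apply/orP; left; apply/eqP; rewrite -/weight.
by field; exact: lt0r_neq0.
Qed.

Definition delta k : nat -> R := fun n => (n == k)%:R.

(** Real scalars suffice here, as the orbit of [chi] and the targets [delta k] have real
    coefficients; complex ones enter in [polynomial_approximable]. *)
Inductive in_orbit_span : (nat -> R) -> Prop :=
| span_zero : in_orbit_span (fun=> 0)
| span_add d k x : in_orbit_span x ->
    in_orbit_span (fun n => d * iter k (ces_res 0) (delta 0) n + x n).

Lemma orbit_spanD x y : in_orbit_span x -> in_orbit_span y ->
  in_orbit_span (fun n => x n + y n).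
Proof.
move=> hx hy; elim: hx => [|d k x' _ IH].
  by under eq_fun do rewrite add0r.
by under eq_fun do rewrite -addrA; exact: span_add.
Qed.

Lemma orbit_spanZ x d : in_orbit_span x -> in_orbit_span (fun n => d * x n).
Proof.
elim=> [|d' k x' _ IH]; first by under eq_fun do rewrite mulr0; exact: span_zero.
by under eq_fun do rewrite mulrDr mulrA; exact: span_add.
Qed.

Lemma orbit_span_ces x : in_orbit_span x -> in_orbit_span (ces_res 0 x).
Proof.
elim=> [|d k x' _ IH]; first by rewrite ces_res0 //; exact: span_zero.
have -> : ces_res 0 (fun n => d * iter k (ces_res 0) (delta 0) n + x' n) =
    fun n => d * iter k.+1 (ces_res 0) (delta 0) n + ces_res 0 x' n.
  have := ces_resD x' (iter k (ces_res 0) (delta 0)) d (lexx 0).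
  under eq_fun do rewrite addrC; move=> ->.
  by apply/funext => n; rewrite addrC.
exact: span_add.
Qed.

Lemma orbit_span_wbounded x : in_orbit_span x -> exists M, wbounded M x.
Proof.
elim=> [|d k x' _ [M hM]].
  by exists 0 => n; rewrite normr0 mul0r.
have [K hK] : exists K, wbounded K (iter k (ces_res 0) (delta 0)).
  elim: k => [|k [K hK]].
    exists 1 => n; rewrite mul1r /delta /=; case: n => [|n] /=; first by rewrite normr1.
    by rewrite normr0 mulr_ge0 // ?(ltW (weight_gt0 n)) // divr_ge0 // ltW // weight_den.
  by exists (K / (a + 0)) => /=; exact: ces_res_wbounded.
exists (`|d| * K + M); apply: wboundedD => //; exact: wboundedZ.
Qed.

Definition approximable x := forall e, 0 < e ->
  exists2 y, in_orbit_span y & wbounded e (fun n => x n - y n).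

Lemma approximable_span x : in_orbit_span x -> approximable x.
Proof.
by move=> hx e e0; exists x => // n; rewrite subrr normr0 mulr_ge0 ?(ltW e0) // ltW // weight_gt0.
Qed.

Lemma approximable_close x : (forall e, 0 < e ->
  exists2 y, approximable y & wbounded e (fun n => x n - y n)) -> approximable x.
Proof.
move=> hx e e0; have e20 : 0 < e / 2 by rewrite divr_gt0.
have [y hy hxy] := hx _ e20; have [z hz hyz] := hy _ e20.
exists z => //; have := wboundedD hxy hyz; rewrite -splitr.
by under eq_fun do rewrite addrA subrK.
Qed.

Lemma approximableD x y : approximable x -> approximable y ->
  approximable (fun n => x n + y n).
Proof.
move=> hx hy e e0; have e20 : 0 < e / 2 by rewrite divr_gt0.
have [x' sx' hx'] := hx _ e20; have [y' sy' hy'] := hy _ e20.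
exists (fun n => x' n + y' n); first exact: orbit_spanD.
have := wboundedD hx' hy'; rewrite -splitr.
by under eq_fun do rewrite addrACA -opprD.
Qed.

Lemma approximableZ x d : approximable x -> approximable (fun n => d * x n).
Proof.
move=> hx e e0; have d1 : 0 < `|d| + 1 by rewrite ltr_wpDl.
have [x' sx' hx'] := hx _ (divr_gt0 e0 d1).
exists (fun n => d * x' n); first exact: orbit_spanZ.
have := wboundedZ d hx'; under eq_fun do rewrite mulrBr.
apply: wbounded_le; rewrite mulrCA ler_piMr //; first exact: ltW.
by rewrite ler_pdivrMr // mul1r lerDl.
Qed.

Lemma approximable_wbounded x : approximable x -> exists M, wbounded M x.
Proof.
move=> /(_ _ ltr01)[y /orbit_span_wbounded[M hM] hy].
exists (1 + M); have := wboundedD hy hM.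
by under eq_fun do rewrite subrK.
Qed.

Definition res_stable c := forall x, approximable x -> approximable (ces_res c x).

Lemma res_stable0 : res_stable 0.
Proof.
(* The operator [ces_res 0] has norm at most [1 / a], whence the tolerance [a * e]. *)
move=> x hx e e0; have [y sy hy] := hx _ (mulr_gt0 a0 e0).
exists (ces_res 0 y); first exact: orbit_span_ces.
have := ces_res_wbounded (lexx 0) hy.
have -> : a * e / (a + 0) = e by rewrite addr0 mulrAC divff ?mul1r // gt_eqF.
have -> // : ces_res 0 (fun n => x n - y n) = fun n => ces_res 0 x n - ces_res 0 y n.
have := ces_resD x y (-1) (lexx 0).
by under eq_fun do rewrite mulN1r; move=> ->; apply/funext => n; rewrite mulN1r.
Qed.

(* The resolvent at c + d is the limit of the contraction
   u |-> ces_res c (x - d u). *)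
Lemma res_stable_step c d : 0 <= c -> 0 <= d -> d < a + c ->
  res_stable c -> res_stable (c + d).
Proof.
move=> c0 d0 dac hc x hx; have a0' := a0; have ac : 0 < a + c by lra.
pose y := ces_res (c + d) x.
pose phi u := ces_res c (fun n => x n + (- d) * u n).
have yE : y = phi y.
  apply: ces_res_unique => // n; have := ces_resE x n (addr_ge0 c0 d0).
  rewrite -/y => h; have -> : (n.+1%:R + c) * y n = (n.+1%:R + (c + d)) * y n - d * y n.
    by ring.
  by rewrite h; ring.
have [M hM] := approximable_wbounded hx.
have yM : wbounded (M / (a + (c + d))) y by apply: ces_res_wbounded => //; exact: addr_ge0.
pose q := d / (a + c).
have q01 : 0 <= q < 1.
  by rewrite divr_ge0 ?(ltW ac) //= ltr_pdivrMr // mul1r.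
have uk k : approximable (iter k phi (fun=> 0)).
  elim: k => [|k IH]; first exact: approximable_span span_zero.
  by apply: hc; apply: approximableD => //; exact: approximableZ.
have cl k : wbounded (M / (a + (c + d)) * q ^+ k) (fun n => y n - iter k phi (fun=> 0) n).
  elim: k => [|k IH].
    by rewrite mulr1; under eq_fun do rewrite subr0.
  have := wboundedZ (- d) (ces_res_wbounded c0 IH).
  rewrite normrN (ger0_norm d0) exprS.
  have -> : d * (M / (a + (c + d)) * q ^+ k / (a + c)) = M / (a + (c + d)) * (q * q ^+ k).
    by rewrite /q; ring.
  have -> // : (fun n => - d * ces_res c (fun n0 => y n0 - iter k phi (fun=> 0) n0) n) =
    (fun n => y n - iter k.+1 phi (fun=> 0) n).
  have := ces_resD y (iter k phi (fun=> 0)) (-1) c0.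
  under eq_fun do rewrite mulN1r; move=> ->.
  apply/funext => n /=; rewrite [in RHS]yE /phi !ces_resD //; ring.
apply: approximable_close => e e0.
have [k hk] := geometric_small (M / (a + (c + d))) q01 e0.
exists (iter k phi (fun=> 0)) => //.
apply: wbounded_le (cl k); exact/ltW/hk.
Qed.

(** The step allowed by [d < a + c] does not shrink as [c] grows, so steps of [a / 2] reach
    arbitrarily large values. *)
Lemma res_stable_multiples k : res_stable (k%:R * (a / 2)).
Proof.
have a0' := a0; elim: k => [|k IH]; first by rewrite mul0r; exact: res_stable0.
rewrite -natr1 mulrDl mul1r; apply: res_stable_step => //.
- by rewrite mulr_ge0 // divr_ge0 // ltW.
- by rewrite divr_ge0 // ltW.
- by rewrite ltr_wpDr ?mulr_ge0 ?divr_ge0 ?(ltW a0) //; lra.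
Qed.

(** Write A for [ces_inv] and Q for [ces_res c]. Then [x - c Q x = Q A x] ([e1]), and
    [A x - c Q A x = Q A A x] ([e2]), which is at most [M / (a + c)] in norm. So [c (x - c Q x)],
    which is approximable, is close to [A x]. *)
Lemma approximable_inv x M : approximable x -> wbounded M (ces_inv (ces_inv x)) ->
  approximable (ces_inv x).
Proof.
move=> hx hM; have M0 := wbounded_ge0 hM; have a0' := a0.
apply: approximable_close => e e0.
have a20 : 0 < a / 2 by rewrite divr_gt0.
have [k hk] : exists k : nat, M / e / (a / 2) < k%:R.
  exists (Num.truncn (M / e / (a / 2))).+1; exact: truncnS_gt.
pose c := k%:R * (a / 2).
have c0 : 0 <= c by rewrite mulr_ge0 // ltW.
have hc : M / (a + c) <= e.
  have hk' : M / e < c by rewrite -ltr_pdivrMr.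
  rewrite ler_pdivrMr; last by lra.
  by rewrite mulrC -ler_pdivrMr // ltW // (lt_trans hk') // ltrDr.
have e1 : (fun n => x n - c * ces_res c x n) = ces_res c (ces_inv x).
  apply: ces_res_unique => // n; have := ces_resE x n c0 => h.
  rewrite mulrBr mulrCA h /ces_inv; ring.
have e2 : (fun n => ces_inv x n - ces_res c (ces_inv (ces_inv x)) n) =
    (fun n => c * ces_res c (ces_inv x) n).
  have -> : (fun n => c * ces_res c (ces_inv x) n) = ces_res c (fun n => c * ces_inv x n).
    by apply: ces_res_unique => // n; rewrite mulrCA ces_resE //; ring.
  apply: ces_res_unique => // n; have := ces_resE (ces_inv (ces_inv x)) n c0 => h.
  rewrite mulrBr h; set u := ces_inv x.
  have -> : ces_inv u n = n.+1%:R * u n - n%:R * u n.-1 by [].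
  ring.
exists (fun n => c * (x n - c * ces_res c x n)).
  apply: approximableZ.
  have := approximableD hx (approximableZ (- c) (res_stable_multiples k hx)).
  by under eq_fun do rewrite mulNr.
apply: wbounded_le hc _; have := ces_res_wbounded c0 hM.
have -> // : ces_res c (ces_inv (ces_inv x)) =
    (fun n => ces_inv x n - c * (x n - c * ces_res c x n)).
apply/funext => n; have := congr1 (fun f => f n) e2; have := congr1 (fun f => f n) e1.
by move=> /= -> <-; ring.
Qed.

Lemma finite_wbounded x N : (forall n, (N <= n)%N -> x n = 0) -> exists M, wbounded M x.
Proof.
elim: N x => [|N IH] x hx.
  by exists 0 => n; rewrite hx // normr0 mul0r.
have [n Nn|M hM] := IH (fun n => if n == N then 0 else x n).
  by case: eqP => // /eqP nN; apply: hx; rewrite ltn_neqAle eq_sym nN.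
exists (`|x N| / weight N + M) => n; have w0 := weight_gt0 n.
have := hM n; have M0 := wbounded_ge0 hM.
case: eqP => [-> _|_ h].
  rewrite mulrDl divfK ?lerDl ?mulr_ge0 ?(ltW (weight_gt0 N)) //.
  by rewrite gt_eqF // weight_gt0.
rewrite (le_trans h) // mulrDl lerDr mulr_ge0 ?divr_ge0 ?(ltW w0) //.
by rewrite ltW // weight_gt0.
Qed.

Lemma ces_inv_delta k n :
  ces_inv (delta k) n = k.+1%:R * delta k n - k.+1%:R * delta k.+1 n.
Proof.
rewrite /ces_inv /delta; case: n => [|n] /=.
  by rewrite mul0r subr0 mulr0 subr0; case: k => [|k] //; rewrite !mulr0.
rewrite eqSS; have [<-|h1] := eqVneq n.+1 k.
  have -> : (n == n.+1) = false by lia.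
  by rewrite !mulr0.
by have [->|h2] := eqVneq n k; rewrite ?mulr0.
Qed.

(** [ces_inv (delta k)] is a combination of [delta k] and [delta k.+1] with nonzero coefficients,
    and a second application still has finite support, hence is bounded. Thus [approximable_inv]
    leads from [k] to [k.+1]. *)
Theorem delta_approximable k : approximable (delta k).
Proof.
elim: k => [|k IH].
  apply: approximable_span; have := span_add 1 0 span_zero.
  by under eq_fun do rewrite addr0 mul1r.
have [n Nn|M hM] := @finite_wbounded (ces_inv (ces_inv (delta k))) k.+3.
  rewrite /ces_inv /delta; case: n Nn => // -[//|n] Nn /=.
  have h1 : (n.+2 == k) = false by rewrite gtn_eqF //; lia.
  have h2 : (n.+1 == k) = false by rewrite gtn_eqF //; lia.
  have h3 : (n == k) = false by rewrite gtn_eqF //; lia.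
  by rewrite h1 h2 h3 !mulr0 !subrr !mulr0 subrr.
have hA := approximable_inv IH hM.
have := approximableD IH (approximableZ (- k.+1%:R^-1) hA).
have -> // : (fun n => delta k n + - k.+1%:R^-1 * ces_inv (delta k) n) = delta k.+1.
apply/funext => n; rewrite ces_inv_delta; field.
by rewrite nat1r pnatr_eq0.
Qed.

End Weight.
End CesaroSequences.

(** * From weighted coefficients to H^p *)

Section BinomialSequences.
Variable R : realType.
Implicit Types (a b : R) (u v : nat -> R) (n k : nat).

(** The coefficients of [(1 - z)^(- a)]. *)
Fixpoint kap a n : R := if n is m.+1 then kap a m * ((m%:R + a) / m.+1%:R) else 1.

Lemma kapS a n : n.+1%:R * kap a n.+1 = (n%:R + a) * kap a n.
Proof. by rewrite /= [LHS]mulrC -!mulrA mulVf ?pnatr_eq0 // mulr1 mulrC. Qed.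

Lemma kap_ge0 a n : 0 <= a -> 0 <= kap a n.
Proof.
by move=> a0; elim: n => //= n IH; rewrite mulr_ge0 // divr_ge0 // addr_ge0.
Qed.

Lemma kap_gt0 a n : 0 < a -> 0 < kap a n.
Proof.
by move=> a0; elim: n => //= n IH; rewrite mulr_gt0 // divr_gt0 // ltr_wpDl.
Qed.

Lemma kap0 n : kap 0 n = (n == 0%N)%:R.
Proof.
elim: n => //= n IH; rewrite IH; case: n {IH} => [|n] /=; last by rewrite mul0r.
by rewrite addr0 mul0r mulr0.
Qed.

(* Both sides solve n d_n = (n - 1 + a + b) d_{n-1}. *)
Lemma kap_conv a b n : \sum_(k < n.+1) kap a k * kap b (n - k) = kap (a + b) n.
Proof.
elim: n => [|n IH]; first by rewrite big_ord1 /= mulr1.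
have nz : n.+1%:R != 0 :> R by rewrite pnatr_eq0.
apply: (mulfI nz); rewrite kapS -IH mulr_sumr.
have -> : \sum_(k < n.+2) n.+1%:R * (kap a k * kap b (n.+1 - k)) =
   \sum_(k < n.+2) k%:R * (kap a k * kap b (n.+1 - k)) +
   \sum_(k < n.+2) (n.+1 - k)%:R * (kap a k * kap b (n.+1 - k)).
  rewrite -big_split; apply: eq_bigr => k _ /=; rewrite -mulrDl -natrD subnKC //.
  by rewrite -ltnS.
rewrite big_ord_recl mul0r add0r [X in _ + X]big_ord_recr /= subnn mul0r addr0.
rewrite -big_split mulr_sumr; apply: eq_bigr => k _ /=.
have kn : (k <= n)%N by rewrite -ltnS.
rewrite /bump /= add1n subSS subSn // mulrA kapS.
rewrite [X in _ + X]mulrCA kapS.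
have -> : n%:R = k%:R + (n - k)%:R :> R by rewrite -natrD subnKC.
ring.
Qed.

(** With divisions cleared, the hypothesis says that [u / v] does not increase from [n0] on; [K]
    absorbs the finitely many earlier ratios. *)
Lemma ratio_le u v n0 : (forall n, 0 < u n) -> (forall n, 0 < v n) ->
  (forall n, (n0 <= n)%N -> u n.+1 * v n <= u n * v n.+1) ->
  exists2 K, 0 < K & forall n, u n <= K * v n.
Proof.
move=> u0 v0 h.
have [K K0 hK] : exists2 K, 0 < K & forall n, (n <= n0)%N -> u n <= K * v n.
  elim: n0 {h} => [|m [K K0 hK]].
    exists (u 0%N / v 0%N); first by rewrite divr_gt0.
    by move=> n; rewrite leqn0 => /eqP ->; rewrite divfK // gt_eqF.
  exists (K + u m.+1 / v m.+1); first by rewrite addr_gt0 // divr_gt0.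
  move=> n; rewrite leq_eqVlt => /orP[/eqP ->|nm].
    by rewrite mulrDl divfK ?gt_eqF // lerDr mulr_ge0 ?ltW.
  by rewrite mulrDl (le_trans (hK n nm)) // lerDl mulr_ge0 ?divr_ge0 ?ltW.
exists K => // n; have [/hK //|/ltnW] := leqP n n0.
elim: n => [|n IH]; first by rewrite leqn0 => /eqP z; apply: hK; rewrite z.
rewrite leq_eqVlt => /orP[/eqP <-|n0n]; first exact: hK.
rewrite -(ler_pM2r (v0 n)) (le_trans (h n n0n)) //.
by rewrite mulrAC ler_wpM2r ?IH // ltW.
Qed.

Lemma weight_le_kap a b : 0 < a -> a < b -> b < 1 ->
  exists2 K, 0 < K & forall n, weight a n <= K * kap b n.
Proof.
move=> a0 ab b1; have a1 := lt_trans ab b1.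
(* Cross-multiplied, the comparison of successive ratios reads [n * (b - a) >= 1 - b * (2 - a)], so
   [n * (b - a) >= 1] suffices. *)
have [n0 hn0] : exists n0 : nat, (b - a)^-1 < n0%:R.
  by exists (Num.truncn (b - a)^-1).+1; exact: truncnS_gt.
apply: (@ratio_le _ _ n0) => [n|n|n nn0].
- exact: weight_gt0.
- exact: kap_gt0 (lt_trans a0 ab).
- have w0 := weight_gt0 a1 n; have k0 := kap_gt0 n (lt_trans a0 ab).
  have d0 := weight_den a1 n.+1.
  rewrite /=.
  have -> : weight a n * (n.+1%:R / (n.+2%:R - a)) * kap b n =
     weight a n * kap b n * (n.+1%:R / (n.+2%:R - a)) by ring.
  rewrite [leRHS](_ : _ = weight a n * kap b n * ((n%:R + b) / n.+1%:R)); last by ring.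
  rewrite ler_wpM2l ?mulr_ge0 ?(ltW w0) ?(ltW k0) //.
  rewrite ler_pdivrMr // mulrAC ler_pdivlMr //.
  have hn : 1 < n%:R * (b - a).
    rewrite -ltr_pdivrMr ?subr_gt0 // mul1r (lt_le_trans hn0) // ler_nat //.
  rewrite -[n.+2%:R]natr1 -[n.+1%:R]natr1; nra.
Qed.

(** A telescoping majorant: [rho n / n.+1%:R] equals [4 * (rho n - rho n.+1)]. The squares decay
    like [n^(-3/2)], the majorant like [n^(-5/4)]. *)
Lemma kap_sq_summable : forall N, \sum_(k < N) kap (4^-1) k ^+ 2 <= 4 :> R.
Proof.
pose rho n : R := kap (3 / 4) n.
have q0 : 0 < 4^-1 :> R by rewrite invr_gt0.
have rho0 n : 0 < rho n by apply: kap_gt0; rewrite divr_gt0.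
have h n : kap 4^-1 n ^+ 2 <= rho n / n.+1%:R :> R.
  elim: n => [|n IH]; first by rewrite /rho /= expr1n divr1.
  rewrite /rho /= -/(rho n) exprMn.
  apply: (@le_trans _ _ (rho n / n.+1%:R * ((n%:R + 4^-1) / n.+1%:R) ^+ 2)).
    by rewrite ler_wpM2r ?sqr_ge0.
  rewrite -!mulrA ler_wpM2l ?(ltW (rho0 n)) //.
  have n0 : 0 <= n%:R :> R by [].
  have n2 : 0 < n.+2%:R :> R by []. have n1 : 0 < n.+1%:R :> R by [].
  rewrite -subr_ge0 (_ : _ - _ = (n.+1%:R^+2 * (n%:R + 3/4) - n.+2%:R * (n%:R + 4^-1) ^+ 2) /
     (n.+1%:R ^+ 3 * n.+2%:R)); last by field; rewrite !nat1r ?pnatr_eq0 // -natrD pnatr_eq0.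
  rewrite divr_ge0 ?mulr_ge0 ?exprn_ge0 // -[n.+2%:R]natr1 -[n.+1%:R]natr1; nra.
move=> N; apply: (@le_trans _ _ (4 * (1 - rho N))); last first.
  by have := rho0 N; lra.
elim: N => [|N IH]; first by rewrite big_ord0 /rho /= subrr mulr0.
rewrite big_ord_recr /= (le_trans (lerD IH (h N))) //.
rewrite /rho /= -/(rho N) le_eqVlt; apply/orP; left; apply/eqP.
by rewrite -[N.+1%:R]natr1; field; rewrite natr1 pnatr_eq0.
Qed.

End BinomialSequences.

(** * Means of order [p] bounded by weighted coefficients *)

Section CoefficientBound.
Variable R : realType.
Implicit Types (P : {poly R[i]}) (c : nat -> R[i]) (g : R[i] -> R[i]) (p a b K e : R).

(** As for powers of [(1 - z)^(- b)], the parameters add up, by [kap_conv]. *)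
Lemma coef_exp_bound P b K m : 0 <= b -> 0 <= K ->
  (forall k, normc P`_k <= K * kap b k) ->
  forall k, normc (P ^+ m)`_k <= K ^+ m * kap (m%:R * b) k.
Proof.
move=> b0 K0 hP; elim: m => [|m IH] k.
  rewrite expr0 mul1r mul0r kap0 coef1 normc_nat //.
rewrite exprS coefM (le_trans (normc_sum _ _ _)) //.
rewrite -natr1 mulrDl mul1r addrC -kap_conv exprS mulr_sumr.
apply: ler_sum => j _; rewrite normcM.
have -> : K * K ^+ m * (kap b j * kap (m%:R * b) (k - j)) =
   (K * kap b j) * (K ^+ m * kap (m%:R * b) (k - j)) by ring.
by rewrite ler_pM ?normc_ge0.
Qed.

Lemma psum_poly c N w : psum c N w = (\poly_(k < N) c k).[w].
Proof. by rewrite horner_poly. Qed.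

(** Parseval is applied to the powers of the partial sums of [g], so that only polynomials are
    multiplied; the parameter [4^-1 / m%:R] becomes [4^-1] in the power [m]. *)
Lemma pow_mean_bound M c g m K r : (0 < m)%N -> 0 <= K -> has_ps M c g ->
  (forall k, normc (c k) <= K * kap (4^-1 / m%:R) k) -> 0 <= r < 1 ->
  rmean (fun w => normc (g w ^+ m) ^+ 2) r <= (K ^+ m) ^+ 2 * 4.
Proof.
move=> m0 K0 hg hc /andP[r0 r1].
have mz : m%:R != 0 :> R by rewrite pnatr_eq0 -lt0n.
have M0 := has_ps_ge0 hg.
pose T := M / (1 - r).
have T0 : 0 <= T by rewrite divr_ge0 // subr_ge0 ltW.
have gT w : normc w = r -> normc (g w) <= T.
  by move=> wr; rewrite (le_trans (has_ps_bound hg _)) ?wr.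
have Xc h : circle_cont h r -> circle_cont (fun w => h w ^+ m) r.
  move=> hh; elim: m {m0 hc mz} => [|k IH] w wr.
    by apply: (@ccont_ext _ (fun=> 1) _ _ 1) (ccont_cst _ _) => // u _; rewrite expr0.
  apply: (@ccont_ext _ (fun w => h w * h w ^+ k) _ _ 1) => //.
    by move=> u _; rewrite exprS.
  by apply: ccontM; [exact: hh|exact: IH].
apply: (@sq_mean_approx _ _ _ (T ^+ m)) => //.
- exact/Xc/(has_ps_circle hg r1).
- by move=> w wr; rewrite normcX lerXn2r ?nnegrE ?normc_ge0 // gT.
move=> e e0.
have L0 : 0 < m%:R * (1 + (T + 1)) ^+ m :> R.
  by rewrite mulr_gt0 ?exprn_gt0 ?ltr0n //; lra.
have [h [h0 h1 he]] : exists h : R, [/\ 0 < h, h <= 1 & m%:R * (1 + (T + 1)) ^+ m * h <= e].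
  exists (Num.min 1 (e / (m%:R * (1 + (T + 1)) ^+ m))).
  rewrite lt_min ltr01 divr_gt0 // ge_min lexx; split => //.
  by rewrite mulrC -ler_pdivlMr // ge_min lexx orbT.
have [|N /(_ N (leqnn N)) hN] := @geometric_small _ r (M / (1 - r)) h _ h0.
  by rewrite r0.
have close w : normc w = r -> normc (g w - psum c N w) <= h.
  move=> wr; rewrite (le_trans (hg.2 _ N _)) ?wr //.
  by rewrite mulrAC ltW.
exists (fun w => psum c N w ^+ m); split; first exact/Xc/psum_circle_cont.
- pose P : {poly R[i]} := \poly_(k < N) c k.
  have hP k : normc P`_k <= K * kap (4^-1 / m%:R) k.
    rewrite coef_poly; case: ifP => [_|_]; first exact: hc.
    by rewrite normc0; apply: mulr_ge0 => //; apply: kap_ge0; rewrite divr_ge0 // invr_ge0.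
  have b0 : 0 <= 4^-1 / m%:R :> R by rewrite divr_ge0 // invr_ge0.
  rewrite (rmean_eq (h := fun w => normc (psum (fun k => (P ^+ m)`_k) (size (P ^+ m)) w) ^+ 2)) //; last first.
    by move=> w _; rewrite psum_poly -horner_exp [in LHS]horner_coef.
  rewrite parseval_radius.
  apply: (@le_trans _ _ (\sum_(k < size (P ^+ m)) (K ^+ m) ^+ 2 * kap (4^-1) k ^+ 2)).
    apply: ler_sum => k _; rewrite -exprMn lerXn2r ?nnegrE ?normc_ge0 ?mulr_ge0 ?exprn_ge0 ?kap_ge0 ?invr_ge0 //.
    have r01 : 0 <= r <= 1 by rewrite r0 ltW.
    apply: le_trans (normc_scale_le _ _ r01) _.
    have := coef_exp_bound m b0 K0 hP k.
    have -> : m%:R * (4^-1 / m%:R) = 4^-1 :> R by rewrite mulrCA divff ?mulr1.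
    exact.
  by rewrite -mulr_sumr ler_wpM2l ?sqr_ge0 // kap_sq_summable.
- move=> w wr; have gw := gT w wr; have cw := close w wr.
  have pT : normc (psum c N w) <= T + 1.
    by have := le_normc_sub (psum c N w) (g w); rewrite normcB_sym; lra.
  have gT1 : normc (g w) <= T + 1 by lra.
  rewrite (le_trans (normc_expB_le m gT1 pT)) // (le_trans _ he) //.
  by rewrite ler_wpM2l // ltW.
Qed.

(** As [p <= m], the power [p] of the modulus is at most 1 plus its power [2 m]. This bound is not
    homogeneous, so [g] is first divided by [e], and the factor in [e] is restored at the end. *)
Theorem weight_mean_bound p : 0 < p -> exists a C : R, [/\ 0 < a, a < 1, 0 <= C &
  forall e M c g, 0 < e -> has_ps M c g -> (forall k, normc (c k) <= e * weight a k) ->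
  forall r, 0 < r < 1 -> rmean (fun w => normc (g w) `^ p) r <= e `^ p * C].
Proof.
move=> p0; pose m := (Num.truncn p).+1.
have pm : p <= m%:R by rewrite ltW // truncnS_gt.
have m0 : 0 < m%:R :> R by [].
have m1 : 1 <= m%:R :> R by rewrite ler1n.
pose b : R := 4^-1 / m%:R.
have b0 : 0 < b by rewrite divr_gt0 // invr_gt0.
have b1 : b < 1.
  by rewrite /b ltr_pdivrMr // mul1r (lt_le_trans _ m1) // invf_lt1 // ltr1n.
have b2 : b / 2 < b by lra.
have [K K0 hK] := weight_le_kap (divr_gt0 b0 (ltr0n _ 2)) b2 b1.
exists (b / 2), (1 + (K ^+ m) ^+ 2 * 4); split.
- by rewrite divr_gt0.
- lra.
- by rewrite addr_ge0 // mulr_ge0 // sqr_ge0.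
move=> e M c g e0 hg hc r /andP[r0 r1].
have eC0 : e%:C != 0 :> R[i] by rewrite -normc_gt0 normc_real gtr0_norm.
pose g' w := e%:C^-1 * g w; pose c' k := e%:C^-1 * c k.
have ne : normc (e%:C^-1 : R[i]) = e^-1 by rewrite normcV normc_real gtr0_norm.
have hg' : has_ps (e^-1 * M) c' g'.
  split=> [k|z N z1]; first by rewrite normcM ne ler_wpM2l ?invr_ge0 ?(ltW e0) // hg.1.
  have -> : psum c' N z = e%:C^-1 * psum c N z.
    by rewrite mulr_sumr; apply: eq_bigr => k _; rewrite mulrA.
  rewrite -mulrBr normcM ne -!mulrA ler_wpM2l ?invr_ge0 ?(ltW e0) // mulrA.
  exact: hg.2.
have hc' k : normc (c' k) <= K * kap b k.
  rewrite normcM ne ler_pdivrMl // (le_trans (hc k)) // ler_wpM2l //.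
  exact: ltW.
have rr : 0 <= r < 1 by rewrite ltW.
have hm := pow_mean_bound (ltn0Sn _) (ltW K0) hg' hc' rr.
have gc := has_ps_circle hg r1; have gc' := has_ps_circle hg' r1.
have r0' := ltW r0.
rewrite (rmean_eq (h := fun w => e `^ p * normc (g' w) `^ p)) //; last first.
  move=> w _; rewrite -powRM ?normc_ge0 // ?(ltW e0) //; congr (_ `^ p).
  by rewrite normcM ne mulrA divff ?mul1r // gt_eqF.
rewrite rmeanZ; last exact: rcirc_powR.
rewrite ler_wpM2l ?powR_ge0 //.
have r2 : rcirc (fun w => normc (g' w ^+ m) ^+ 2) r.
  have := @rcircX _ _ _ (2 * m)%N (rcirc_normc r0' gc').
  by under eq_fun do rewrite mulnC exprM -normcX.
apply: (@le_trans _ _ (rmean (fun w => 1 + normc (g' w ^+ m) ^+ 2) r)).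
  apply: rmean_le => //; first exact: rcirc_powR.
    by apply: rcircD => //; exact: rcirc_cst.
  move=> w _; rewrite normcX -exprM; have n0 := normc_ge0 (g' w).
  have [n1|n1] := leP (normc (g' w)) 1.
    rewrite (@le_trans _ _ 1) ?lerDl ?exprn_ge0 //.
    have := @ge0_ler_powR R p (ltW p0) (normc (g' w)) 1; rewrite powR1.
    by apply; rewrite ?nnegrE.
  rewrite (@le_trans _ _ (normc (g' w) ^+ (m * 2))) ?lerDr //.
  rewrite -powR_mulrn //; apply: ler_powR; first exact: ltW.
  by rewrite (le_trans pm) // ler_nat leq_pmulr.
rewrite rmeanD //; last exact: rcirc_cst.
by rewrite rmean_cst lerD2l.
Qed.

End CoefficientBound.

(** * The Cesaro operator on H^p *)

Section CesaroOnPowerSeries.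
Variable R : realType.
Implicit Types (x : nat -> R) (f g : R[i] -> R[i]) (z w : R[i]) (M e : R) (n k N : nat).

Lemma natr_expr_le (y : R) n : 0 <= y <= 1 -> n%:R * (1 - y) * y ^+ n <= 1 - y ^+ n.
Proof.
move=> /andP[y0 y1]; elim: n => [|n IH]; first by rewrite !mul0r subrr.
have yn : 0 <= y ^+ n by rewrite exprn_ge0.
have yn1 : y ^+ n.+1 <= 1 by rewrite exprn_ile1.
have h1 := ler_wpM2l y0 IH.
have h2 : 0 <= (1 - y) * (1 - y ^+ n.+1) by rewrite mulr_ge0 ?subr_ge0.
by rewrite -natr1; rewrite !exprS in h2 yn1 *; lra.
Qed.

Lemma natr_geometric_small (y M e : R) : 0 <= y < 1 -> 0 < e ->
  exists N, forall n, (N <= n)%N -> M * (n%:R * y ^+ n) < e.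
Proof.
(* With [y = s ^+ 2], one factor [s ^+ n] absorbs [n%:R] by [natr_expr_le], and the other tends to
   0. *)
move=> /andP[y0 y1] e0; pose s := Num.sqrt y.
have s0 : 0 <= s by exact: sqrtr_ge0.
have ss : s ^+ 2 = y by rewrite sqr_sqrtr.
have s1 : s < 1 by rewrite -sqrtr1 ltr_sqrt.
have s01 : 0 <= s < 1 by rewrite s0.
have [N hN] := geometric_small (`|M| / (1 - s)) s01 e0; exists N => n /hN h.
have sn : 0 <= s ^+ n by rewrite exprn_ge0.
have hs : n%:R * s ^+ n <= 1 / (1 - s).
  rewrite ler_pdivlMr ?subr_gt0 // mulrAC.
  have := @natr_expr_le s n; rewrite s0 ltW // => /(_ isT); lra.
apply: le_lt_trans h; rewrite -ss -exprM mulnC exprM expr2.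
apply: (@le_trans _ _ (`|M| * (n%:R * (s ^+ n * s ^+ n)))).
  by rewrite ler_wpM2r ?ler_norm // mulr_ge0 // mulr_ge0.
rewrite -mulrA ler_wpM2l // mulrA -div1r ler_wpM2r //.
Qed.

Definition creal x : nat -> R[i] := fun n => (x n)%:C.

(** The truncated form of [(1 - w) (w u)' = f] where [u] is the series of [ces_res 0 x]: the sum
    approximates the Cesaro integrand [f w / (1 - w)], up to a boundary term. *)
Lemma ces_geometric x n w :
  (1 - w) * (\sum_(k < n) (k.+1%:R * ces_res 0 x k)%:C * w ^+ k) =
  psum (creal x) n w - (n%:R * ces_res 0 x n.-1)%:C * w ^+ n.
Proof.
elim: n => [|n IH]; first by rewrite big_ord0 /psum big_ord0 mulr0 !mul0r subrr.
rewrite big_ord_recr /= mulrDr IH psumS /creal.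
have /= := ces_resE x n (lexx (0 : R)); rewrite addr0 => h.
have -> : x n = n.+1%:R * ces_res 0 x n - n%:R * ces_res 0 x n.-1.
  by rewrite h addrK.
rewrite exprS rmorphB /=; ring.
Qed.

Lemma curve_ray z (t : R) : curve_cont (fun t => t%:C * z) t.
Proof.
apply: curveM; last exact: curve_cst.
by apply/curve_contP; split => /=; [exact: cvg_id|exact: cvg_cst].
Qed.

Lemma curve_monomial k (t : R) : curve_cont (fun t => t%:C ^+ k) t.
Proof.
elim: k => [|k IH]; first exact: curve_cst.
under eq_fun do rewrite exprS; apply: curveM => //.
by apply/curve_contP; split => /=; [exact: cvg_id|exact: cvg_cst].
Qed.

Lemma cint_monomial k : cint 0 1 (fun t : R => t%:C ^+ k) = (k.+1%:R^-1)%:C.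
Proof.
have k0 : k.+1%:R != 0 :> R by rewrite pnatr_eq0.
rewrite /cint; apply: eq_complexP => /=.
- rewrite (RI_eq (g := fun t => t ^+ k)); last by move=> t _; rewrite -rmorphXn.
  have dF (t : R) : is_derive t 1 (k.+1%:R^-1 \*: (id ^+ k.+1)) (t ^+ k).
    by apply: is_derive_eq; rewrite /GRing.scale /= mulr1 mulrA mulVf ?mul1r.
  rewrite (RI_FTC ltr01 dF); last exact: exprn_continuous.
  by rewrite !fctE /= /GRing.scale /= expr1n expr0n /= mulr0 subr0 mulr1.
- rewrite (RI_eq (g := fun=> 0)); last by move=> t _; rewrite -rmorphXn.
  by rewrite RI_cst // mul0r.
Qed.

Lemma cint_ray_sum (c : nat -> R[i]) n z :
  cint 0 1 (fun t => (\sum_(k < n) c k * (t%:C * z) ^+ k) * z) =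
  \sum_(k < n) c k * z ^+ k.+1 * (k.+1%:R^-1)%:C.
Proof.
rewrite (cint_eq (k := fun t => \sum_(k < n) c k * z ^+ k.+1 * t%:C ^+ k)).
  rewrite (@cint_sum _ _ _ _ _ (fun k : 'I_n => fun t => c k * z ^+ k.+1 * t%:C ^+ k)).
    apply: eq_bigr => k _; rewrite cintZ ?cint_monomial //.
    by move=> t _; exact: curve_monomial.
  move=> k t _; apply: curveM; [exact: curve_cst|exact: curve_monomial].
move=> t _; rewrite mulr_suml; apply: eq_bigr => k _.
by rewrite exprMn exprS; ring.
Qed.

(** No exchange of series and integral: along the segment the integrand is compared with the
    polynomial of [ces_geometric], whose integral is exactly [z] times the partial sum sought. *)
Theorem Cesaro_has_ps x M f : has_ps M (creal x) f ->
  has_ps M (creal (ces_res 0 x)) (Cesaro f).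
Proof.
move=> hf; have M0 := has_ps_ge0 hf.
have xM n : `|x n| <= M by rewrite -normc_real; exact: hf.1.
have gM n : normc (creal (ces_res 0 x) n) <= M.
  by rewrite normc_real; exact: ces_res_bounded.
split=> // z N z1; apply: psum_lim => // e e0.
have [z0|z0] := eqVneq z 0.
  (* At 0 the operator has its separate value [f 0], the coefficient of index 0, and every nonempty
     partial sum is exact. *)
  exists 1%N => -[//|n] _; rewrite z0 /Cesaro eqxx.
  have := hf.2 0 1%N; rewrite normc0 => /(_ ltr01).
  rewrite expr1 mulr0 mul0r /psum big_ord1 expr0 mulr1 => h0.
  have {h0} : normc (f 0 - creal x 0%N) = 0 by apply/le_anti; rewrite h0 normc_ge0.
  move=> /eq0_normc/eqP; rewrite subr_eq0 => /eqP ->.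
  rewrite big_ord_recl big1 => [|k _]; last by rewrite expr0n mulr0.
  by rewrite expr0 mulr1 addr0 /creal /= addr0 divr1 subrr normc0 ltW.
have r0 : 0 < normc z by rewrite normc_gt0.
have r01 : 0 <= normc z < 1 by rewrite normc_ge0.
have d0 : 0 < 1 - normc z by rewrite subr_gt0.
have e20 : 0 < e / 2 by rewrite divr_gt0.
(* The difference of the integrands is divided by [1 - w], of modulus at least [1 - normc z]; [N1]
   takes care of the remainder of [f], and [N2] of the boundary term. *)
have [N1 hN1] := geometric_small (M / (1 - normc z) / (1 - normc z)) r01 e20.
have [N2 hN2] := natr_geometric_small (M / (1 - normc z)) r01 e20.
exists (maxn N1 N2) => n; rewrite geq_max => /andP[/hN1 n1 /hN2 n2].
pose S w := \sum_(k < n) (k.+1%:R * ces_res 0 x k)%:C * w ^+ k.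
pose h (t : R) := f (t%:C * z) / (1 - t%:C * z) * z.
have tz1 (t : R) : 0 <= t <= 1 -> normc (t%:C * z) <= normc z.
  move=> /andP[t0 t1]; rewrite normcM normc_real ger0_norm //.
  by rewrite ler_piMl ?normc_ge0.
have den (t : R) : 0 <= t <= 1 -> 1 - normc z <= normc (1 - t%:C * z).
  move=> /tz1 h'; have := normc_sub_ge (t%:C * z) 1; rewrite normc1; lra.
have hc : ccont 0 1 h.
  move=> t t01; apply: curveM; last exact: curve_cst.
  have tzl := le_lt_trans (tz1 t t01) z1.
  have t1 : 1 - t%:C * z != 0.
    by rewrite -normc_gt0 (lt_le_trans d0) // den.
  have := @curve_ray z t; apply: (@curve_comp _ (fun w => f w / (1 - w))).
  apply/cderivable_cont/cderivable_div => //.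
    exact: has_ps_cderivable hf tzl.
  by apply: cderivableB; [exact: cderivable_cst|exact: cderivable_id].
have Sc : ccont 0 1 (fun t => S (t%:C * z) * z).
  move=> t _; apply: curveM; last exact: curve_cst.
  have := @curve_ray z t; apply: (@curve_comp _ S).
  by apply: (psum_circle_cont (fun k => (k.+1%:R * ces_res 0 x k)%:C) n (r := normc (t%:C * z))).
have SE : z * psum (creal (ces_res 0 x)) n z = cint 0 1 (fun t => S (t%:C * z) * z).
  rewrite /S (cint_ray_sum (fun k => (k.+1%:R * ces_res 0 x k)%:C)) mulr_sumr.
  apply: eq_bigr => k _.
  rewrite rmorphM /= exprS /creal.
  have -> : (k.+1%:R^-1)%:C = (k.+1%:R%:C)^-1 :> R[i] by rewrite fmorphV.
  have k0 : k.+1%:R%:C != 0 :> R[i] by rewrite -normc_gt0 normc_real normr_nat ltr0n.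
  by field.
have -> : Cesaro f z - psum (creal (ces_res 0 x)) n z =
    z^-1 * cint 0 1 (fun t => h t - S (t%:C * z) * z).
  rewrite cintB // -SE mulrBr mulKf // /Cesaro (negPf z0); congr (_ - _).
rewrite normcM normcV ler_pdivrMl //.
apply: (@le_trans _ _ ((normc z * e) * (1 - 0))); last by rewrite subr0 mulr1.
apply: normc_cint_le => //; first exact: ccontcB.
move=> t t01; set w := t%:C * z.
have w1 : 1 - w != 0 by rewrite -normc_gt0 (lt_le_trans d0) // den.
have -> : h t - S w * z = ((f w - psum (creal x) n w) +
    (n%:R * ces_res 0 x n.-1)%:C * w ^+ n) / (1 - w) * z.
  rewrite /h -/w -mulrBl; congr (_ * _); apply: (mulIf w1).
  rewrite mulrBl !divfK // [S w * _]mulrC /S ces_geometric.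
  by rewrite opprB addrA addrAC.
rewrite normcM mulrC ler_wpM2l ?(ltW r0) // normcM normcV.
have wz : normc w <= normc z by exact: tz1.
have wl : normc w < 1 by exact: le_lt_trans z1.
have dw := den t t01; rewrite -/w in dw.
have wn : normc w ^+ n <= normc z ^+ n by rewrite lerXn2r ?nnegrE ?normc_ge0.
have h1 : normc (f w - psum (creal x) n w) <= M * normc z ^+ n / (1 - normc z).
  rewrite (le_trans (hf.2 w n wl)) // ler_pM ?mulr_ge0 ?exprn_ge0 ?normc_ge0 ?invr_ge0 //.
  - by rewrite subr_ge0 ltW.
  - by rewrite ler_wpM2l.
  - by rewrite lef_pV2 ?posrE ?subr_gt0 // lerD2l lerN2.
have h2 : normc ((n%:R * ces_res 0 x n.-1)%:C * w ^+ n) <= M * (n%:R * normc z ^+ n).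
  rewrite normcM normc_real normrM normr_nat normcX mulrAC [leRHS]mulrC mulrAC.
  rewrite [leRHS]mulrAC.
  by apply: ler_pM; rewrite ?mulr_ge0 ?exprn_ge0 ?normc_ge0 // ?ler_wpM2l // ces_res_bounded.
rewrite ler_pdivrMr; last exact: lt_le_trans dw.
apply: (@le_trans _ _ (e * (1 - normc z))); last by rewrite ler_wpM2l // ltW.
rewrite (le_trans (le_normcD _ _)) // (le_trans (lerD h1 h2)) //.
rewrite -ler_pdivrMr // mulrDl.
move: n1 n2; rewrite ![_ / (1 - normc z) * _]mulrAC; lra.
Qed.

Lemma chi_has_ps : has_ps 1 (creal (delta R 0)) (@chi R).
Proof.
split=> [k|z N z1].
  by rewrite normc_real normr_nat; case: k.
rewrite /chi; case: N => [|N].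
  rewrite /psum big_ord0 subr0 normc1 expr0 mulr1 ler_pdivlMr ?subr_gt0 //.
  by rewrite mul1r gerBl normc_ge0.
rewrite /psum big_ord_recl big1 => [|k _]; last by rewrite mul0r.
rewrite expr0 mulr1 addr0 subrr normc0 mul1r.
by rewrite divr_ge0 ?exprn_ge0 ?normc_ge0 // subr_ge0 ltW.
Qed.

Theorem iter_Cesaro_has_ps n :
  has_ps 1 (creal (iter n (ces_res 0) (delta R 0))) (iter n (@Cesaro R) (@chi R)).
Proof. by elim: n => [|n IH]; [exact: chi_has_ps|exact: Cesaro_has_ps]. Qed.

End CesaroOnPowerSeries.

(** * Translation to [derivable], to the norm and to the distance of H^p *)

Section HardySpaceBridge.
Variable R : realType.
Implicit Types (f g : R[i] -> R[i]) (z w : R[i]) (p r S e : R).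

Lemma unit_diskP z : unit_disk z <-> normc z < 1.
Proof. by rewrite /unit_disk /= normCE (ltcR (normc z) 1). Qed.

Lemma derivable_cderivable f z :
  derivable (f : R[i]^o -> R[i]^o) z 1 <-> cderivable f z.
Proof.
split=> [df|[l hl]].
- exists ('D_1 (f : R[i]^o -> R[i]^o) z) => e e0.
  move/cvgrPdist_lt : (df) => /(_ e%:C); rewrite ltcR => /(_ e0).
  rewrite near_withinE => /nbhs_ballP[d /= d0 hd].
  (* A positive element of [R[i]] is a positive real number, so radii can be moved to [R]. *)
  have [d' d'0 dE] : exists2 d' : R, 0 < d' & d = d'%:C.
    move: d0; rewrite ltcE => /andP[/eqP i0 r0]; exists (complex.Re d) => //.
    by apply: eq_complexP.
  exists d' => // w wd; have [->|wz] := eqVneq w z.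
    by rewrite !subrr mulr0 subr0 normc0 mulr0.
  have wz0 : w - z != 0 by rewrite subr_eq0.
  have := hd (w - z); rewrite /ball /= sub0r normrN normCE dE ltcR => /(_ wd wz0).
  rewrite normCE ltcR /GRing.scale /= mulr1 subrK => h.
  rewrite -(ler_pM2l (_ : 0 < normc (w - z)^-1)) ?normc_gt0 ?invr_eq0 //.
  rewrite -normcM mulrBr (mulrC (_^-1) (_ * (w - z))) mulfK //.
  rewrite mulrCA normcV mulVf ?normc_eq0 // mulr1 normcB_sym; exact: ltW h.
- apply/cvg_ex; exists l; apply/cvgrPdist_lt => e e0.
  have [e' e'0 eE] : exists2 e' : R, 0 < e' & e = e'%:C.
    move: e0; rewrite ltcE => /andP[/eqP i0 r0]; exists (complex.Re e) => //.
    by apply: eq_complexP.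
  have [d d0 hd] := hl _ (divr_gt0 e'0 (ltr0n _ 2)).
  rewrite near_withinE; apply/nbhs_ballP; exists d%:C; first by rewrite /= ltcR.
  move=> h; rewrite /ball /= sub0r normrN normCE ltcR => hdd h0.
  rewrite eE normCE ltcR /GRing.scale /= mulr1.
  have := hd (h + z); rewrite addrK => /(_ hdd) hh.
  have nh : 0 < normc h by rewrite normc_gt0.
  have -> : l - h^-1 * (f (h + z) - f z) = - (h^-1 * (f (h + z) - f z - l * h)).
    by field.
  rewrite normcN normcM normcV ltr_pdivrMl //.
  rewrite (le_lt_trans hh) // mulrC ltr_pM2l // ltr_pdivrMr // mulr2n mulrDr mulr1.
  by rewrite ltrDl.
Qed.

Lemma analytic_cderivable f : analytic_on_disk f <-> forall z, normc z < 1 -> cderivable f z.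
Proof.
split=> hf z; first by move=> z1; apply/derivable_cderivable/hf/unit_diskP.
by move=> /unit_diskP z1; apply/derivable_cderivable/hf.
Qed.

Lemma circle_mean_rmean p f r : 0 < p -> 0 <= r -> circle_cont f r ->
  circle_mean p f r = (rmean (fun w => normc (f w) `^ p) r)%:E.
Proof.
move=> p0 r0 fc; rewrite /circle_mean /rmean EFinM; congr (_ * _)%E.
rewrite /RI /Rintegral fineK //; apply: integrable_fin_num => //.
exact: (rcont_integrable (rcirc_rcont (rcirc_powR p0 r0 fc))).
Qed.

Lemma Hp_norm_le p f S : 0 < p -> 0 <= S -> analytic_on_disk f ->
  (forall r, 0 < r < 1 -> rmean (fun w => normc (f w) `^ p) r <= S) ->
  (Hp_norm p f <= (S `^ p^-1)%:E)%E.
Proof.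
move=> p0 S0 /analytic_cderivable fa hS.
(* The power is monotone on nonnegative extended reals only, and a supremum is known to be
   nonnegative only once some radius is exhibited. *)
have sup0 : (0 <= ereal_sup [set circle_mean p f r | r in [set r : R | (0 < r < 1)%R]])%E.
  have h2 : 0 < (2^-1 : R) < 1 by rewrite invr_gt0 ltr0n invf_lt1 // ltr1n.
  apply: (@le_trans _ _ (circle_mean p f 2^-1)); last first.
    by apply: ereal_sup_ubound; exists 2^-1.
  rewrite circle_mean_rmean ?invr_ge0 // ?lee_fin ?rmean_ge0 ?invr_ge0 //.
    by move=> z _; exact: powR_ge0.
  by move=> z zs; apply/cderivable_cont/fa; rewrite zs invf_lt1 // ltr1n.
rewrite /Hp_norm -poweR_EFin; apply: gt0_ler_poweR; rewrite ?invr_ge0 ?(ltW p0) //.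
- by rewrite in_itv /= sup0 leey.
- by rewrite in_itv /= lee_fin S0 leey.
apply: ge_ereal_sup => _ [r /= r01 <-]; have /andP[r0 r1] := r01.
rewrite circle_mean_rmean ?(ltW r0) // ?lee_fin ?hS //.
by move=> z zr; apply/cderivable_cont/fa; rewrite zr.
Qed.

Lemma Hp_mean_bound p f : 0 < p -> Hp p f -> exists2 S, 0 <= S &
  forall r, 0 < r < 1 -> rmean (fun w => normc (f w) `^ p) r <= S.
Proof.
move=> p0 [/analytic_cderivable fa].
have pV : p^-1 != 0 by rewrite invr_eq0 gt_eqF.
move=> /(lty_poweRy pV); set s := ereal_sup _ => sy.
have hr r : 0 < r < 1 -> ((rmean (fun w => normc (f w) `^ p) r)%:E <= s)%E.
  move=> r01; have /andP[r0 r1] := r01; rewrite -circle_mean_rmean ?(ltW r0) //.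
    by apply: ereal_sup_ubound; exists r.
  by move=> z zr; apply/cderivable_cont/fa; rewrite zr.
have h2 : 0 < (2^-1 : R) < 1 by rewrite invr_gt0 ltr0n invf_lt1 // ltr1n.
have s0 : (0 <= s)%E.
  apply: le_trans (hr _ h2); rewrite lee_fin rmean_ge0 ?invr_ge0 //.
  by move=> z _; exact: powR_ge0.
have sfin : s \is a fin_num by rewrite ge0_fin_numE.
exists (fine s); first exact: fine_ge0.
by move=> r r01; rewrite -lee_fin fineK //; exact: hr.
Qed.

Lemma Hp_intro p f S : 0 < p -> 0 <= S -> analytic_on_disk f ->
  (forall r, 0 < r < 1 -> rmean (fun w => normc (f w) `^ p) r <= S) -> Hp p f.
Proof.
move=> p0 S0 fa hS; split=> //.
by apply: le_lt_trans (Hp_norm_le p0 S0 fa hS) _; exact: ltry.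
Qed.

Lemma Hp_dist_small p e : 0 < p -> 0 < e -> exists2 d, 0 < d &
  forall f g, analytic_on_disk f -> analytic_on_disk g ->
  (forall r, 0 < r < 1 -> rmean (fun w => normc (f w - g w) `^ p) r <= d) ->
  (Hp_dist p f g < e%:E)%E.
Proof.
(* The first bound is for [p < 1], where the distance is the norm to the power [p]; the second is
   for [p >= 1], where a root of order [p] is taken. *)
move=> p0 e0; pose h := Num.min (e / 2) ((e / 2) `^ p).
have e20 : 0 < e / 2 by rewrite divr_gt0.
have h0 : 0 < h by rewrite lt_min e20 powR_gt0.
have e2e : e / 2 < e by lra.
exists h => // f g /analytic_cderivable fa /analytic_cderivable ga hS.
have fga : analytic_on_disk (fun z => f z - g z).
  by apply/analytic_cderivable => z z1; apply: cderivableB; [exact: fa|exact: ga].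
have := Hp_norm_le p0 (ltW h0) fga hS; rewrite /Hp_dist.
set N := Hp_norm _ _ => hN; have N0 : (0 <= N)%E by exact: poweR_ge0.
case: ifP => _.
  apply: (@le_lt_trans _ _ (h%:E)); last first.
    by rewrite lte_fin (le_lt_trans _ e2e) // ge_min lexx.
  have -> : h%:E = ((h `^ p^-1)%:E `^ p)%E.
    by rewrite poweR_EFin -powRrM mulVf ?gt_eqF // powRr1 // ltW.
  apply: gt0_ler_poweR => //; first exact: ltW.
  - by rewrite in_itv /= N0 leey.
  - by rewrite in_itv /= lee_fin powR_ge0 leey.
apply: le_lt_trans hN _; rewrite lte_fin (le_lt_trans _ e2e) //.
rewrite [leRHS](_ : _ = ((e / 2) `^ p) `^ p^-1); last first.
  by rewrite -powRrM mulfV ?gt_eqF // powRr1 // ltW.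
apply: ge0_ler_powR; rewrite ?nnegrE ?invr_ge0 ?powR_ge0 ?(ltW p0) ?(ltW h0) //.
by rewrite ge_min lexx orbT.
Qed.

End HardySpaceBridge.

(** * From coefficient sequences to functions in the span of the orbit *)

Section SpanOfOrbit.
Variable R : realType.
Implicit Types (f g : R[i] -> R[i]) (A : set (R[i] -> R[i])) (c d : nat -> R[i]).

Lemma complex_span0 A : complex_span A (fun=> 0).
Proof.
exists 0%N, (fun=> 0), (fun=> fun=> 0); split; first by case.
by apply/funext => z; rewrite big_ord0.
Qed.

Lemma complex_span_cons A (k : R[i]) f g : A f -> complex_span A g ->
  complex_span A (fun z => k * f z + g z).
Proof.
move=> Af [n [c [h [hA ->]]]].
exists n.+1, (fun i => oapp c k (unlift ord0 i)), (fun i => oapp h f (unlift ord0 i)).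
split; first by move=> i; case: unliftP => [j _|_] //=; exact: hA.
apply/funext => z; rewrite big_ord_recl unlift_none /=; congr (_ + _).
by apply: eq_bigr => i _; rewrite liftK.
Qed.

Lemma complex_spanD A f g : complex_span A f -> complex_span A g ->
  complex_span A (fun z => f z + g z).
Proof.
move=> [n [c [h [hA ->]]]] Ag; elim: n c h hA => [|n IH] c h hA.
  by under eq_fun do rewrite big_ord0 add0r.
under eq_fun do rewrite big_ord_recl -addrA.
apply: complex_span_cons; first exact: hA.
by apply: (IH (fun i => c (lift ord0 i)) (fun i => h (lift ord0 i))) => i; exact: hA.
Qed.

Lemma complex_spanZ A (k : R[i]) f : complex_span A f -> complex_span A (fun z => k * f z).
Proof.
move=> [n [c [h [hA ->]]]]; exists n, (fun i => k * c i), h; split=> //.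
by apply/funext => z; rewrite mulr_sumr; apply: eq_bigr => i _; rewrite mulrA.
Qed.

Lemma has_ps0 : has_ps 0 (fun=> 0) (fun=> 0 : R[i]).
Proof.
split=> [k|z N z1]; first by rewrite normc0.
rewrite /psum big1 ?subrr ?normc0 ?mul0r // => k _; by rewrite mul0r.
Qed.

Definition cutoff c N n : R[i] := if (n < N)%N then c n else 0.

Lemma psum_cutoff c N n z : (N <= n)%N -> psum (cutoff c N) n z = psum c N z.
Proof.
move=> /subnK <-; elim: (n - N)%N => [|m IH].
  by apply: eq_bigr => k _; rewrite /cutoff ltn_ord.
by rewrite addSn psumS IH /cutoff ltnNge leq_addl mul0r addr0.
Qed.

Lemma psum_has_ps c N : exists M, has_ps M (cutoff c N) (psum c N).
Proof.
exists (\sum_(k < N) normc (c k)).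
have cM k : normc (cutoff c N k) <= \sum_(k < N) normc (c k).
  rewrite /cutoff; case: ifP => [kN|_]; last first.
    by rewrite normc0 sumr_ge0 // => i _; exact: normc_ge0.
  rewrite (bigD1 (Ordinal kN)) //= lerDl sumr_ge0 // => i _; exact: normc_ge0.
split=> // z n z1; apply: psum_lim => // e e0; exists N => m Nm.
by rewrite psum_cutoff // subrr normc0 ltW.
Qed.

Local Notation orbit := [set iter n (@Cesaro R) (@chi R) | n in [set: nat]].

Lemma orbit_function (x : nat -> R) : in_orbit_span x ->
  exists M g, complex_span orbit g /\ has_ps M (creal x) g.
Proof.
elim=> [|d k x' _ [M [g [gS gps]]]].
  by exists 0, (fun=> 0); split; [exact: complex_span0|exact: has_ps0].
exists (normc d%:C * 1 + M), (fun z => d%:C * iter k (@Cesaro R) (@chi R) z + g z).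
split; first by apply: complex_span_cons => //; exists k.
have := has_psD (has_psZ d%:C (iter_Cesaro_has_ps R k)) gps.
congr has_ps; apply/funext => n; rewrite /creal rmorphD rmorphM //.
Qed.

(** Each new monomial is approximated with real coefficients by [delta_approximable], then
    multiplied by the complex number [c N]. The bound with [W] is what later places [g] in H^p. *)
Lemma polynomial_approximable (a : R) c N e : 0 < a -> a < 1 -> 0 < e ->
  exists M d g, [/\ complex_span orbit g, has_ps M d g,
    exists2 W : R, 0 < W & forall n, normc (d n) <= W * weight a n &
    forall n, normc (cutoff c N n - d n) <= e * weight a n].
Proof.
move=> a0 a1; elim: N e => [|N IH] e e0.
  exists 0, (fun=> 0), (fun=> 0); split.
  - exact: complex_span0.
  - exact: has_ps0.
  - by exists 1 => // n; rewrite normc0 mul1r ltW // weight_gt0.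
  - by move=> n; rewrite /cutoff subrr normc0 mulr_ge0 ?ltW // weight_gt0.
have e20 : 0 < e / 2 by rewrite divr_gt0.
have [M [d [g [gS gps [W W0 dW] dc]]]] := IH _ e20.
have k0 : 0 < normc (c N) + 1 by rewrite ltr_wpDl ?normc_ge0.
have [y sy hy] := delta_approximable a0 a1 N (divr_gt0 e20 k0).
have [M' [g' [g'S g'ps]]] := orbit_function sy.
have [W' hW'] := orbit_span_wbounded a0 a1 sy.
have W'0 := wbounded_ge0 hW'.
exists (normc (c N) * M' + M), (fun n => c N * creal y n + d n), (fun z => c N * g' z + g z).
split.
- by apply: complex_spanD => //; exact: complex_spanZ.
- exact: has_psD (has_psZ _ g'ps) gps.
- exists (normc (c N) * W' + W); first by rewrite ltr_wpDl // mulr_ge0 ?normc_ge0.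
  move=> n; rewrite (le_trans (le_normcD _ _)) // mulrDl lerD //.
  by rewrite normcM -mulrA ler_wpM2l ?normc_ge0 // normc_real hW'.
- move=> n.
  have -> : cutoff c N.+1 n - (c N * creal y n + d n) =
     c N * creal (fun n => delta R N n - y n) n + (cutoff c N n - d n).
    rewrite /creal rmorphB /= mulrBr.
    have -> : cutoff c N.+1 n = c N * (delta R N n)%:C + cutoff c N n.
      rewrite /cutoff /delta ltnS leq_eqVlt; case: eqP => [->|_].
        by rewrite ltnn /= mulr1 addr0.
      by rewrite /= mulr0 add0r.
    ring.
  rewrite (le_trans (le_normcD _ _)) // (splitr e) mulrDl lerD //.
  rewrite normcM normc_real.
  apply: (@le_trans _ _ (normc (c N) * (e / 2 / (normc (c N) + 1) * weight a n))).
    by rewrite ler_wpM2l ?normc_ge0.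
  rewrite mulrA ler_wpM2r ?(ltW (weight_gt0 a1 n)) //.
  rewrite mulrCA ler_piMr ?(ltW e20) //.
  by rewrite ler_pdivrMr // mul1r lerDl.
Qed.

Lemma powR_three (x y u p : R) : 0 <= p -> 0 <= x -> 0 <= y -> 0 <= u ->
  (x + (y + u)) `^ p <= 2 `^ p * x `^ p + 2 `^ p * 2 `^ p * (y `^ p + u `^ p).
Proof.
move=> p0 x0 y0 u0.
rewrite (le_trans (powR_ge0D p0 x0 (addr_ge0 y0 u0))) // mulrDr lerD2l.
by rewrite -mulrA ler_wpM2l ?powR_ge0 // powR_ge0D.
Qed.

End SpanOfOrbit.

Theorem theorem1p1 (R : realType) (p : R) (hp : 0 < p) :
  Hp_closure p (complex_span [set iter n (@Cesaro R) (@chi R) | n in [set: nat]])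
  = Hp p.
Proof.
apply/seteqP; split=> [f [] //|f fH]; split=> // e e0.
have [fa _] := fH; have fd := (analytic_cderivable f).1 fa.
have [S S0 hS] := Hp_mean_bound hp fH.
have [del del0 hdel] := Hp_dist_small hp e0.
have [a [C [a0 a1 C0 hC]]] := weight_mean_bound hp.
(* The difference [f - g] is cut into [f] minus its dilate, the dilate minus a partial sum, and the
   partial sum minus [g]. By [powR_three] these come with the factors [q], [q * q] and [q * q]; each
   product is allotted [del / 3]. *)
pose q := 2 `^ p : R; have q0 : 0 < q by rewrite powR_gt0.
have e10 : 0 < del / (3 * q) by rewrite divr_gt0 // mulr_gt0.
have [s /andP[s0 s1] hs] := hardy_dilation hp fd hS e10.
have Q0 : 0 < 3 * (q * q) by rewrite !mulr_gt0.
pose t := del / (3 * (q * q)); have t0 : 0 < t by rewrite divr_gt0.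
pose e2 := t `^ p^-1; have e20 : 0 < e2 by rewrite powR_gt0.
have e2p : e2 `^ p = t by rewrite -powRrM mulVf ?gt_eqF // powRr1 // ltW.
have rho1 : 1 < s^-1 by rewrite invf_gt1.
have fsd w : normc w < s^-1 -> cderivable (fun w => f (s%:C * w)) w.
  move=> wr; apply: cderivable_dil; apply: fd.
  by rewrite normcM normc_real gtr0_norm // mulrC -ltr_pdivlMr // mul1r.
have [c [N hN]] := poly_approx rho1 fsd e20.
(* This makes the bound of [hC] at most [t]; [C] may vanish, hence the added 1. *)
pose e3 := (t / (C + 1)) `^ p^-1.
have C1 : 0 < C + 1 by rewrite ltr_wpDl.
have e30 : 0 < e3 by rewrite powR_gt0 // divr_gt0.
have e3p : e3 `^ p = t / (C + 1).
  by rewrite -powRrM mulVf ?gt_eqF // powRr1 // ltW // divr_gt0.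
have [M [d [g [gS gps [W W0 dW] dc]]]] := polynomial_approximable c N a0 a1 e30.
have gd z : normc z < 1 -> cderivable g z by exact: has_ps_cderivable gps.
have ga : analytic_on_disk g by apply/analytic_cderivable.
exists g; split; first exact: gS.
  apply: (Hp_intro hp _ ga (hC _ _ _ _ W0 gps dW)).
  by rewrite mulr_ge0 ?powR_ge0.
apply: (hdel _ _ fa ga) => r r01; have /andP[r0 r1] := r01; have r0' := ltW r0.
have [K hK] := psum_has_ps c N.
have hqg := hC _ _ _ _ e30 (has_psB hK gps) dc r r01.
have fc : circle_cont f r by move=> w wr; apply/cderivable_cont/fd; rewrite wr.
have gc : circle_cont g r by move=> w wr; apply/cderivable_cont/gd; rewrite wr.
have sw w : normc w = r -> normc w < s^-1 by move=> ->; exact: lt_trans rho1.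
have fsc : circle_cont (fun w => f (s%:C * w)) r.
  by move=> w wr; apply/cderivable_cont/fsd/sw.
have pc := psum_circle_cont c N (r := r).
have pw (h : R[i] -> R[i]) : circle_cont h r -> rcirc (fun w => normc (h w) `^ p) r.
  exact: rcirc_powR.
have c1 := rcircM (@rcirc_cst _ q r) (pw _ (circle_contB fc fsc)).
have c2 := rcircD (@rcirc_cst _ t r) (pw _ (circle_contB pc gc)).
have c3 := rcircM (@rcirc_cst _ (q * q) r) c2.
apply: le_trans (rmean_le r0' (pw _ (circle_contB fc gc)) (rcircD c1 c3) _) _.
  move=> w wr; have w1 : normc w <= 1 by rewrite wr ltW.
  have -> : f w - g w = (f w - f (s%:C * w)) + ((f (s%:C * w) - psum c N w) + (psum c N w - g w)).
    by ring.
  apply: (@le_trans _ _ ((normc (f w - f (s%:C * w)) +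
      (normc (f (s%:C * w) - psum c N w) + normc (psum c N w - g w))) `^ p)).
    apply: ge0_ler_powR; rewrite ?nnegrE ?addr_ge0 ?normc_ge0 ?(ltW hp) //.
    by rewrite (le_trans (le_normcD _ _)) // lerD2l le_normcD.
  rewrite (le_trans (powR_three (ltW hp) _ _ _)) ?normc_ge0 // lerD2l.
  rewrite ler_wpM2l ?mulr_ge0 ?(ltW q0) // lerD2r -e2p.
  by apply: ge0_ler_powR; rewrite ?nnegrE ?normc_ge0 ?(ltW hp) ?(ltW e20) ?hN.
rewrite (rmeanD c1 c3) (rmeanZ _ (pw _ (circle_contB fc fsc))) (rmeanZ _ c2).
rewrite (rmeanD (@rcirc_cst _ t r) (pw _ (circle_contB pc gc))) rmean_cst.
have h1 := hs r r01.
rewrite e3p in hqg.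
have h2 : t / (C + 1) * C <= t.
  by rewrite mulrAC ler_pdivrMr // ler_wpM2l ?(ltW t0) // lerDl.
have h3 : q * (del / (3 * q)) = del / 3 by field; rewrite gt_eqF.
have h4 : q * q * t = del / 3 by rewrite /t; field; rewrite gt_eqF.
have h5 := ler_wpM2l (ltW q0) h1.
have h6 := ler_wpM2l (ltW (mulr_gt0 q0 q0)) (le_trans hqg h2).
have h7 : del = del / 3 + (del / 3 + del / 3) by field.
rewrite [leRHS]h7 [X in _ + X <= _]mulrDr; apply: lerD; first by rewrite -h3.
by apply: lerD; [rewrite h4|rewrite -h4].
Qed.
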